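(* Let $\Omega\subset\mathbb{R}^2$ be a connected open set containing $0$, equipped with a Riemannian metric $g$ of class $C^{1,\alpha}$ for some $\alpha>0$. Let $N\in\mathbb{N}$ and let $p:\mathbb{C}^N\to\mathbb{C}$ be a real analytic function. If $f_i\in C^{2,\alpha}(\Omega)$ satisfy $\Delta_gf_i=0$ for $i=1,\dots,N$ and $p(f_1,\dots,f_N)$ vanishes to infinite order at $0$, then $p(f_1,\dots,f_N)\equiv0$ on $\Omega$. In particular, taking $p(F)=\det F$ to be the determinant of a $\mathbb{C}^{m\times m}$-valued matrix function $F$ all of whose entries satisfy $\Delta_g F_{ij}=0$, the determinant $\det F$ has the strong unique continuation property: if it vanishes to infinite order at a point, it vanishes identically.
   Context: $\Delta_g$ is the Laplace-Beltrami operator of $g$, $\Delta_g=-\frac{1}{\sqrt{\det g}}\partial_i\big(\sqrt{\det g}\,g^{ij}\partial_j\big)$. The functions $f_i$ are complex valued. *)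

(* Defs.v *)
From HB Require Import structures.
From mathcomp Require Import all_boot all_order all_algebra finmap.
From mathcomp Require Import all_classical all_reals all_analysis.
From mathcomp.analysis.showcase Require Import summability.
From mathcomp.real_closed Require Export complex.

Set Implicit Arguments.
Unset Strict Implicit.
Unset Printing Implicit Defensive.

Import Order.TTheory GRing.Theory Num.Theory.
Import numFieldNormedType.Exports.

Local Open Scope classical_set_scope.
Local Open Scope ring_scope.
Local Open Scope complex_scope.

Definition partial (R : realType) (n : nat) (i : 'I_n) (u : 'rV[R]_n -> R)
    (x : 'rV[R]_n) : R :=
  'D_(delta_mx 0 i : 'rV[R]_n) u x.

Definition locally_holder (R : realType) (n : nat) (Omega : set 'rV[R]_n)
    (alpha : R) (u : 'rV[R]_n -> R) : Prop :=
  forall K : set 'rV[R]_n, compact K -> K `<=` Omega ->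
  exists M : R, forall x y, K x -> K y ->
    `|u x - u y| <= M * `|x - y| `^ alpha.

(* The class C^{k,alpha}(Omega), Omega open: derivatives up to order k exist
   and are continuous in Omega, those of order k being Hoelder continuous of
   exponent alpha on the compact subsets of Omega. No uniformity up to the
   boundary is required, and the values outside Omega are irrelevant. *)
Fixpoint holder_class (R : realType) (n : nat) (Omega : set 'rV[R]_n)
    (k : nat) (alpha : R) (u : 'rV[R]_n -> R) : Prop :=
  {in Omega, continuous u} /\
  match k with
  | 0 => locally_holder Omega alpha u
  | k'.+1 => forall i : 'I_n,
      (forall x, Omega x -> derivable u x (delta_mx 0 i)) /\
      holder_class Omega k' alpha (partial i u)
  end.

Definition complex_holder_class (R : realType) (n : nat)
    (Omega : set 'rV[R]_n) (k : nat) (alpha : R) (f : 'rV[R]_n -> R[i]) : Prop :=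
  holder_class Omega k alpha (fun x => complex.Re (f x)) /\
  holder_class Omega k alpha (fun x => complex.Im (f x)).

Definition riemannian_metric (R : realType) (n : nat) (Omega : set 'rV[R]_n)
    (g : 'rV[R]_n -> 'M[R]_n) : Prop :=
  forall x, Omega x ->
    (g x)^T = g x /\
    forall v : 'rV[R]_n, v != 0 -> 0 < (v *m g x *m v^T) 0 0.

Definition metric_holder_class (R : realType) (n : nat) (Omega : set 'rV[R]_n)
    (k : nat) (alpha : R) (g : 'rV[R]_n -> 'M[R]_n) : Prop :=
  forall i j : 'I_n, holder_class Omega k alpha (fun x => g x i j).

Definition laplace_beltrami (R : realType) (n : nat)
    (g : 'rV[R]_n -> 'M[R]_n) (u : 'rV[R]_n -> R) (x : 'rV[R]_n) : R :=
  - (Num.sqrt (\det (g x)))^-1 *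
  \sum_(i < n) partial i (fun y =>
    \sum_(j < n) Num.sqrt (\det (g y)) * invmx (g y) i j * partial j u y) x.

Definition complex_laplace_beltrami (R : realType) (n : nat)
    (g : 'rV[R]_n -> 'M[R]_n) (f : 'rV[R]_n -> R[i]) (x : 'rV[R]_n) : R[i] :=
  laplace_beltrami g (fun y => complex.Re (f y)) x +i*
  laplace_beltrami g (fun y => complex.Im (f y)) x.

(* Near every point a, q is the sum of a power series centred at a. The
   convergence is along the directed set of finite sets of multi-indices, that
   is, unconditional (equivalently, absolute). *)
Definition real_analytic (R : realType) (d : nat) (q : 'rV[R]_d -> R) : Prop :=
  forall a : 'rV[R]_d, exists c : {ffun 'I_d -> nat} -> R,
    \forall x \near a,
      partial_sum (fun k : {ffun 'I_d -> nat} =>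
        c k * \prod_(i < d) (x - a) 0 i ^+ k i) @ totally --> q x.

(* The identification of R^(2N) with C^N. *)
Definition complexify (R : realType) (N : nat) (w : 'rV[R]_(N + N)) :
    'rV[R[i]]_N :=
  \row_i (lsubmx w 0 i +i* rsubmx w 0 i).

(* Real (not complex) analyticity of a map C^N -> C. *)
Definition complex_real_analytic (R : realType) (N : nat)
    (p : 'rV[R[i]]_N -> R[i]) : Prop :=
  real_analytic (fun w => complex.Re (p (complexify w))) /\
  real_analytic (fun w => complex.Im (p (complexify w))).

Definition vanishes_to_infinite_order (R : realType) (n : nat)
    (h : 'rV[R]_n -> R[i]) (x0 : 'rV[R]_n) : Prop :=
  forall k : nat, exists M : R,
    \forall x \near x0, `|h x| <= (M * `|x - x0| ^+ k)%:C.

(* Main.v *)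
Require Import Defs.
From mathcomp Require Import all_boot all_order all_algebra finmap.
From mathcomp Require Import all_classical all_reals all_analysis.
From mathcomp Require Import ring lra zify.
From mathcomp.analysis.showcase Require Import summability.

(* In dimension two the equation is conformally invariant, so it suffices to
   find isothermal coordinates. These solve the Beltrami equation w_y = tau w_x
   with tau = (g12 + i sqrt(det g)) / g11. After localising and rescaling, tau is
   a small perturbation of a constant t0 whose Fourier series converges
   absolutely; the operator d_x (d_y - t0 d_x)^-1 is a bounded Fourier
   multiplier, so that w is obtained from a Neumann series in the Wiener algebra.
   Being close to a linear map, w is a homeomorphism of the plane.

   A solution u has a conjugate v by the Poincare lemma, and u + i v is a
   holomorphic function of w. By Cauchy's formula u is, along every short segment
   of the chart w, the sum of a power series. The functions with this property
   are stable under sums, products and composition with real analytic functions;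
   in particular they contain p(f_1, ..., f_N) and det F. If such a function
   vanishes to infinite order at one point then it vanishes along every segment
   through this point, hence on a neighbourhood of uniform size, and the theorem
   follows by connectedness. *)

Set Implicit Arguments.
Unset Strict Implicit.
Unset Printing Implicit Defensive.

Import Order.TTheory GRing.Theory Num.Theory.
Import numFieldNormedType.Exports.

Local Open Scope classical_set_scope.
Local Open Scope ring_scope.
Local Open Scope complex_scope.

(** For a metric that is only of class [C^{1,alpha}] the solutions are not real analytic in the
    given coordinates. Analyticity appears only in the chart, so it is expressed along segments of
    the chart, with bounds uniform in the segment. The Wiener algebra is chosen because a bounded
    multiplier acts on it without any singular integral estimate. The price is a proof of absolute
    convergence for Fourier series in two variables. By Parseval and Cauchy-Schwarz the frequencies
    of size [N] cost a factor [N], and second differences of order [h^(1 + b)] on a grid of step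
    [1 / (2 N)] outweigh it by [N^(-b)]. This is where the Hoelder exponent of the first derivatives
    of the metric enters. Fourier analysis and Cauchy's formula are both carried out with finite
    sums over roots of unity, whose errors are explicit. Power series are likewise replaced by
    dominated polynomial approximants, which pass to uniform limits without exchanging sums. *)

Notation nc := Normc.normc.

(** * The complex modulus and geometric Cauchy sequences *)

Lemma ncD {R : realType} (x y : R[i]) : nc (x + y) <= nc x + nc y.
Proof. exact: le_normcD. Qed.

Lemma ncN {R : realType} (x : R[i]) : nc (- x) = nc x.
Proof. exact: normcN. Qed.

Lemma ncM {R : realType} (x y : R[i]) : nc (x * y) = nc x * nc y.
Proof. exact: Normc.normcM. Qed.

Lemma nc0 {R : realType} : nc (0 : R[i]) = 0.
Proof. exact: Normc.normc0. Qed.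

Lemma nc1 {R : realType} : nc (1 : R[i]) = 1.
Proof. exact: Normc.normc1. Qed.

Lemma ncV {R : realType} (x : R[i]) : nc x^-1 = (nc x)^-1.
Proof. exact: Normc.normcV. Qed.

Lemma nc_ge0 {R : realType} (x : R[i]) : 0 <= nc x.
Proof. by case: x => a b; rewrite sqrtr_ge0. Qed.

Lemma nc_eq0 {R : realType} (x : R[i]) : nc x = 0 -> x = 0.
Proof. exact: Normc.eq0_normc. Qed.

Lemma nc_gt0 {R : realType} (x : R[i]) : x != 0 -> 0 < nc x.
Proof.
move=> x0; rewrite lt_neqAle nc_ge0 andbT eq_sym.
by apply: contra x0 => /eqP/nc_eq0 ->.
Qed.

Lemma ncB {R : realType} (x y : R[i]) : nc (x - y) <= nc x + nc y.
Proof. by rewrite -(ncN y) ncD. Qed.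

Lemma ncC {R : realType} (x y : R[i]) : nc (x - y) = nc (y - x).
Proof. by rewrite -ncN opprB. Qed.

Lemma nc_trans {R : realType} (y x z : R[i]) :
  nc (x - z) <= nc (x - y) + nc (y - z).
Proof. by rewrite -[x - z](subrKA y); exact: ncD. Qed.

Lemma nc_sum {R : realType} (I : Type) (r : seq I) (P : pred I)
    (F : I -> R[i]) :
  nc (\sum_(i <- r | P i) F i) <= \sum_(i <- r | P i) nc (F i).
Proof.
elim/big_rec2 : _ => [|i y x _ h]; first by rewrite nc0.
by apply: (le_trans (ncD _ _)); rewrite lerD2l.
Qed.

Lemma nc_real {R : realType} (x : R) : nc (x%:C) = `|x|.
Proof. by rewrite /= expr0n /= addr0 sqrtr_sqr. Qed.

Lemma ncX {R : realType} (x : R[i]) n : nc (x ^+ n) = nc x ^+ n.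
Proof. by elim: n => [|n ih]; rewrite ?expr0 ?nc1 // !exprS ncM ih. Qed.

Lemma nc_i {R : realType} : nc ('i : R[i]) = 1.
Proof. by rewrite /= expr0n /= add0r expr1n sqrtr1. Qed.

Lemma nc_Re {R : realType} (z : R[i]) : `|complex.Re z| <= nc z.
Proof.
case: z => a b /=; rewrite -sqrtr_sqr ler_sqrt ?addr_ge0 ?sqr_ge0 //.
by rewrite lerDl sqr_ge0.
Qed.

Lemma nc_Im {R : realType} (z : R[i]) : `|complex.Im z| <= nc z.
Proof.
case: z => a b /=; rewrite -sqrtr_sqr ler_sqrt ?addr_ge0 ?sqr_ge0 //.
by rewrite lerDr sqr_ge0.
Qed.

Lemma nc_le {R : realType} (z : R[i]) :
  nc z <= `|complex.Re z| + `|complex.Im z|.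
Proof.
case: z => a b /=; rewrite -[leRHS]ger0_norm ?addr_ge0 // -sqrtr_sqr.
rewrite ler_sqrt ?sqr_ge0 // sqrrD !real_normK ?num_real //.
rewrite addrAC lerDl mulrn_wge0 ?mulr_ge0 //.
Qed.

Lemma ReB {R : realType} (x y : R[i]) :
  complex.Re (x - y) = complex.Re x - complex.Re y.
Proof. by case: x y => [a b] [c d]. Qed.

Lemma ImB {R : realType} (x y : R[i]) :
  complex.Im (x - y) = complex.Im x - complex.Im y.
Proof. by case: x y => [a b] [c d]. Qed.

Lemma ReD {R : realType} (x y : R[i]) :
  complex.Re (x + y) = complex.Re x + complex.Re y.
Proof. by case: x y => [a b] [c d]. Qed.

Lemma Re_sum {R : realType} (I : Type) (r : seq I) (P : pred I)
    (F : I -> R[i]) :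
  complex.Re (\sum_(i <- r | P i) F i) = \sum_(i <- r | P i) complex.Re (F i).
Proof. by elim/big_rec2 : _ => [//|i y x _ <-]; rewrite ReD. Qed.

Lemma Re_realM {R : realType} (x : R) (z : R[i]) :
  complex.Re (x%:C * z) = x * complex.Re z.
Proof. by case: z => a b /=; rewrite mul0r subr0. Qed.

Lemma nc_small_eq {R : realType} (x y : R[i]) :
  (forall e : R, 0 < e -> nc (x - y) <= e) -> x = y.
Proof.
move=> h; apply/eqP; rewrite -subr_eq0; apply/eqP/nc_eq0/eqP.
rewrite eq_le nc_ge0 andbT.
by apply/ler_addgt0Pr => e e0; rewrite add0r; apply: h.
Qed.

Lemma mvt_bound {R : realType} (f df : R -> R) (M a b : R) :
  (forall x, Num.min a b <= x <= Num.max a b ->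
    is_derive x 1 f (df x) /\ `|df x| <= M) ->
  `|f b - f a| <= M * `|b - a|.
Proof.
wlog ab : a b / a <= b => [hw|] h.
  have [/hw|/ltW ba] := leP a b; first exact.
  by rewrite distrC (distrC b); apply: hw => // x; rewrite minC maxC; exact: h.
rewrite min_l // max_r // in h.
have [| |c /itvP cab ->] := @MVT_segment R f df a b ab.
  by move=> x /itvP xab; apply: (proj1 (h x _)); rewrite !xab.
  apply: derivable_within_continuous => x /itvP xab.
  by have [] := h x; rewrite ?xab // => -[].
by rewrite normrM ler_wpM2r //; apply: (proj2 (h c _)); rewrite !cab.
Qed.

(** With [E n] the tail of the geometric series, [x n - E n] is nondecreasing and [x n + E n]
    nonincreasing. The limit is the supremum of the former and lies below the latter, so existence
    and rate come together. *)
Lemma geo_cauchy_real {R : realType} (x : nat -> R) (c q : R) :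
  0 <= q < 1 -> (forall n, `|x n.+1 - x n| <= c * q ^+ n) ->
  exists l, forall n, `|x n - l| <= c * q ^+ n / (1 - q).
Proof.
move=> /andP[q0 q1] h.
have p1 : 0 < 1 - q by rewrite subr_gt0.
pose E n := c * q ^+ n / (1 - q).
have ES n : E n - E n.+1 = c * q ^+ n.
  by rewrite /E exprS; field; rewrite gt_eqF.
have E0 n : 0 <= E n.
  by rewrite divr_ge0 ?(ltW p1) // (le_trans _ (h n)).
have lo : nondecreasing_seq (fun n => x n - E n).
  apply/nondecreasing_seqP => n.
  by move: (h n) (ES n); rewrite ler_norml => /andP[]; lra.
have hi : nonincreasing_seq (fun n => x n + E n).
  apply/nonincreasing_seqP => n.
  by move: (h n) (ES n); rewrite ler_norml => /andP[]; lra.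
have b m n : x m - E m <= x n + E n.
  apply: (le_trans (lo m (maxn m n) (leq_maxl _ _))).
  apply: (le_trans _ (hi n (maxn m n) (leq_maxr _ _))) => /=.
  by move: (E0 (maxn m n)); lra.
pose A := range (fun n => x n - E n).
have supA : has_sup A.
  split; first by exists (x 0 - E 0), 0.
  by exists (x 0 + E 0) => _ [n _ <-]; exact: b.
exists (sup A) => n.
have h1 : x n - E n <= sup A by apply: ub_le_sup; [exact: (proj2 supA)|exists n].
have h2 : sup A <= x n + E n.
  by apply: ge_sup; [exact: (proj1 supA)|move=> _ [m _ <-]; exact: b].
by rewrite ler_norml -/(E n); apply/andP; lra.
Qed.

Lemma geo_cauchy {R : realType} (x : nat -> R[i]) (c q : R) :
  0 <= q < 1 -> (forall n, nc (x n.+1 - x n) <= c * q ^+ n) ->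
  exists l : R[i], forall n, nc (x n - l) <= 2 * c / (1 - q) * q ^+ n.
Proof.
move=> hq h.
have [|a ha] := @geo_cauchy_real R (fun n => complex.Re (x n)) c q hq.
  by move=> n; rewrite -ReB (le_trans (nc_Re _)).
have [|b hb] := @geo_cauchy_real R (fun n => complex.Im (x n)) c q hq.
  by move=> n; rewrite -ImB (le_trans (nc_Im _)).
exists (a +i* b) => n; apply: (le_trans (nc_le _)); rewrite ReB ImB /=.
have -> : 2 * c / (1 - q) * q ^+ n = c * q ^+ n / (1 - q) + c * q ^+ n / (1 - q).
  by ring.
exact: lerD.
Qed.

Lemma geo_small {R : realType} (c q e : R) : 0 <= q < 1 -> 0 < e ->
  exists n0, forall n, (n0 <= n)%N -> c * q ^+ n <= e.
Proof.
move=> /andP[q0 q1] e0.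
have hc : 0 < `|c| + 1 by rewrite ltr_wpDl.
have : (fun n => q ^+ n) @ \oo --> (0 : R).
  by apply: cvg_expr; rewrite ger0_norm.
move/cvgrPdist_le => /(_ (e / (`|c| + 1))) []; first by rewrite divr_gt0.
move=> n0 _ h; exists n0 => n /h /=; rewrite sub0r normrN ler_pdivlMr //.
apply: le_trans; rewrite mulrC (le_trans (ler_norm _)) // normrM.
by rewrite ler_wpM2l // lerDl.
Qed.

(** * The unit circle *)

Definition cis {R : realType} (t : R) : R[i] := cos t +i* sin t.

Lemma cisD {R : realType} (s t : R) : cis (s + t) = cis s * cis t.
Proof.
rewrite /cis cosD sinD; apply/eqP; rewrite eq_complex /=; apply/andP; split=> //.
by rewrite addrC eqxx.
Qed.

Lemma cis0 {R : realType} : cis (0 : R) = 1.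
Proof. by rewrite /cis cos0 sin0. Qed.

Lemma nc_cis {R : realType} (t : R) : nc (cis t) = 1.
Proof. by rewrite /= cos2Dsin2 sqrtr1. Qed.

Lemma cisN {R : realType} (t : R) : cis (- t) = (cis t)^-1.
Proof.
have h : cis (- t) * cis t = 1 by rewrite -cisD addNr cis0.
have n0 : cis t != 0 by apply: contra_eq_neq h => ->; rewrite mulr0 eq_sym oner_eq0.
by rewrite -[LHS](mulfK n0) h mul1r.
Qed.

Lemma cos_bound {R : realType} (t : R) : `|cos t - 1| <= `|t|.
Proof.
have := @mvt_bound R cos (fun x => - sin x) 1 0 t.
rewrite cos0 subr0 mul1r; apply => x _; split; first exact: is_derive_cos.
by rewrite normrN ler_norml sin_geN1 sin_le1.
Qed.

Lemma sin_bound {R : realType} (t : R) : `|sin t| <= `|t|.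
Proof.
have := @mvt_bound R sin cos 1 0 t.
rewrite sin0 !subr0 mul1r; apply => x _; split; first exact: is_derive_sin.
by rewrite ler_norml cos_geN1 cos_le1.
Qed.

Lemma between0 {R : realType} (t x : R) :
  Num.min 0 t <= x <= Num.max 0 t -> `|x| <= `|t|.
Proof.
have [t0|t0] := leP 0 t => /andP[h1 h2].
  by rewrite !ger0_norm // (le_trans _ h2).
by rewrite !ler0_norm ?lerN2 // ltW.
Qed.

Lemma cos_bound2 {R : realType} (t : R) : `|cos t - 1| <= `|t| ^+ 2.
Proof.
have := @mvt_bound R cos (fun x => - sin x) `|t| 0 t.
rewrite cos0 subr0 expr2; apply => x /between0 h; split; first exact: is_derive_cos.
by rewrite normrN (le_trans (sin_bound _)).
Qed.

Lemma sin_bound2 {R : realType} (t : R) : `|sin t - t| <= `|t| ^+ 2.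
Proof.
have := @mvt_bound R (fun x => sin x - x) (fun x => cos x - 1) `|t| 0 t.
rewrite sin0 !subr0 expr2; apply => x /between0 h; split.
  by apply: is_deriveB.
by rewrite (le_trans (cos_bound _)).
Qed.

Lemma cis_bound {R : realType} (t : R) : nc (cis t - 1) <= 2 * `|t|.
Proof.
apply: (le_trans (nc_le _)); rewrite /= subr0 mulr2n mulrDl mul1r.
by rewrite lerD ?cos_bound ?sin_bound.
Qed.

Lemma cis_bound2 {R : realType} (t : R) :
  nc (cis t - 1 - t%:C * 'i) <= 2 * `|t| ^+ 2.
Proof.
apply: (le_trans (nc_le _)); rewrite /= !(mulr0, mul0r, mulr1, subr0, addr0, add0r).
rewrite mulr2n mulrDl mul1r; apply: lerD; last exact: sin_bound2.
by rewrite oppr0 subr0 cos_bound2.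
Qed.

(** * Functions dominated by power series with a prescribed bound *)

(* On [-r, r] the function is a uniform limit of polynomials dominated,
   coefficientwise, by polynomials bounded by [C] at [r]. This is an
   approximation form of "the sum of a power series of radius [r] whose absolute
   coefficients sum to at most [C] at [r]", stable under uniform limits. *)
Definition tame {R : realType} (C r : R) (h : R -> R) :=
  forall e : R, 0 < e -> exists Q Qh : {poly R},
    [/\ forall k, `|Q`_k| <= Qh`_k, Qh.[r] <= C &
        forall t, `|t| <= r -> `|h t - Q.[t]| <= e].

Lemma majorant_ge0 {R : realType} (Q Qh : {poly R}) k :
  (forall k, `|Q`_k| <= Qh`_k) -> 0 <= Qh`_k.
Proof. by move/(_ k); apply: le_trans. Qed.

Lemma horner_majorant {R : realType} (Q Qh : {poly R}) (r t : R) :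
  (forall k, `|Q`_k| <= Qh`_k) -> `|t| <= r -> `|Q.[t]| <= Qh.[r].
Proof.
move=> h tr; have n1 := leq_maxl (size Q) (size Qh).
have n2 := leq_maxr (size Q) (size Qh).
rewrite (horner_coef_wide _ n1) (horner_coef_wide _ n2).
apply: (le_trans (ler_norm_sum _ _ _)); apply: ler_sum => i _.
by rewrite normrM normrX ler_pM // lerXn2r ?nnegrE ?(le_trans _ tr).
Qed.

Lemma tame_bound {R : realType} (C r : R) (h : R -> R) t :
  tame C r h -> `|t| <= r -> `|h t| <= C.
Proof.
move=> H tr; apply/ler_addgt0Pr => e /H[Q [Qh [h1 h2 h3]]].
rewrite -(subrK Q.[t] (h t)) (le_trans (ler_normD _ _)) // addrC.
by rewrite lerD ?h3 // (le_trans (horner_majorant h1 tr)).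
Qed.

Lemma tame_ge0 {R : realType} (C r : R) (h : R -> R) :
  0 <= r -> tame C r h -> 0 <= C.
Proof. by move=> r0 /tame_bound -/(_ 0); rewrite normr0 => /(_ r0); apply: le_trans. Qed.

Lemma tame_le {R : realType} (C C' r : R) (h : R -> R) :
  C <= C' -> tame C r h -> tame C' r h.
Proof.
move=> CC H e /H[Q [Qh [h1 h2 h3]]]; exists Q, Qh; split=> //.
exact: le_trans h2 CC.
Qed.

Lemma tame_ext {R : realType} (C r : R) (g h : R -> R) :
  (forall t, `|t| <= r -> g t = h t) -> tame C r g -> tame C r h.
Proof.
move=> gh H e /H[Q [Qh [h1 h2 h3]]]; exists Q, Qh; split=> // t tr.
by rewrite -gh ?h3.
Qed.

Lemma tame_cst {R : realType} (c r : R) : tame `|c| r (fun=> c).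
Proof.
move=> e e0; exists c%:P, `|c|%:P; split=> [k||t _].
- by rewrite !coefC; case: ifP; rewrite ?normr0.
- by rewrite hornerC.
- by rewrite hornerC subrr normr0 ltW.
Qed.

Lemma tameD {R : realType} (C D r : R) (g h : R -> R) :
  tame C r g -> tame D r h -> tame (C + D) r (fun t => g t + h t).
Proof.
move=> G H e e0; have e2 : 0 < e / 2 by lra.
have [Q [Qh [h1 h2 h3]]] := G _ e2; have [P [Ph [k1 k2 k3]]] := H _ e2.
exists (Q + P), (Qh + Ph); split=> [k||t tr].
- by rewrite !coefD (le_trans (ler_normD _ _)) // lerD.
- by rewrite hornerD lerD.
- rewrite hornerD opprD addrACA (le_trans (ler_normD _ _)) // (splitr e).
  by rewrite lerD ?h3 ?k3.
Qed.

Lemma tameM {R : realType} (C D r : R) (g h : R -> R) : 0 <= r ->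
  tame C r g -> tame D r h -> tame (C * D) r (fun t => g t * h t).
Proof.
move=> r0 G H e e0.
have C0 := tame_ge0 r0 G; have D0 := tame_ge0 r0 H.
(* The error of the product is at most [e' * D + C * e']. *)
pose e' := e / (C + D + 1).
have s0 : 0 < C + D + 1 by lra.
have e2 : 0 < e' by rewrite divr_gt0.
have [Q [Qh [h1 h2 h3]]] := G _ e2; have [P [Ph [k1 k2 k3]]] := H _ e2.
exists (Q * P), (Qh * Ph); split=> [k||t tr].
- rewrite !coefM (le_trans (ler_norm_sum _ _ _)) // ler_sum // => i _.
  by rewrite normrM ler_pM.
- rewrite hornerM ler_pM //.
  + by apply: le_trans (horner_majorant (t := 0) h1 _); rewrite ?normr0.
  + by apply: le_trans (horner_majorant (t := 0) k1 _); rewrite ?normr0.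
- rewrite hornerM.
  have -> : g t * h t - Q.[t] * P.[t] =
    (g t - Q.[t]) * P.[t] + g t * (h t - P.[t]) by ring.
  apply: (le_trans (ler_normD _ _)); rewrite !normrM.
  apply: (@le_trans _ _ (e' * D + C * e')).
    apply: lerD; apply: ler_pM; rewrite ?h3 ?k3 //.
      by apply: le_trans k2; exact: horner_majorant.
    exact: tame_bound tr.
  rewrite [e' * D]mulrC -mulrDl /e' mulrA ler_pdivrMr // mulrC ler_pM2l //; lra.
Qed.

Lemma tame_sum {R : realType} (I : Type) (s : seq I) (P : pred I)
    (C : I -> R) (r : R) (h : I -> R -> R) : 0 <= r ->
  (forall i, P i -> tame (C i) r (h i)) ->
  tame (\sum_(i <- s | P i) C i) r (fun t => \sum_(i <- s | P i) h i t).
Proof.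
move=> r0 H; elim: s => [|i s ih].
  rewrite big_nil; apply: (@tame_ext _ _ _ (fun=> 0)) => [t _|].
    by rewrite big_nil.
  by have := @tame_cst R 0 r; rewrite normr0.
rewrite big_cons; case: ifPn => Pi; last first.
  by apply: tame_ext ih => t _; rewrite big_cons (negPf Pi).
apply: (@tame_ext _ _ _ (fun t => h i t + \sum_(i <- s | P i) h i t)).
  by move=> t _; rewrite big_cons Pi.
by apply: tameD => //; exact: H.
Qed.

Lemma tame_prod {R : realType} (I : Type) (s : seq I) (P : pred I)
    (C : I -> R) (r : R) (h : I -> R -> R) : 0 <= r ->
  (forall i, P i -> tame (C i) r (h i)) ->
  tame (\prod_(i <- s | P i) C i) r (fun t => \prod_(i <- s | P i) h i t).
Proof.
move=> r0 H; elim: s => [|i s ih].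
  rewrite big_nil; apply: (@tame_ext _ _ _ (fun=> 1)) => [t _|].
    by rewrite big_nil.
  by have := @tame_cst R 1 r; rewrite normr1.
rewrite big_cons; case: ifPn => Pi; last first.
  by apply: tame_ext ih => t _; rewrite big_cons (negPf Pi).
apply: (@tame_ext _ _ _ (fun t => h i t * \prod_(i <- s | P i) h i t)).
  by move=> t _; rewrite big_cons Pi.
by apply: tameM => //; exact: H.
Qed.

Lemma tameX {R : realType} (C r : R) (h : R -> R) n : 0 <= r ->
  tame C r h -> tame (C ^+ n) r (fun t => h t ^+ n).
Proof.
move=> r0 H; elim: n => [|n ih].
  by have := @tame_cst R 1 r; rewrite normr1.
by rewrite exprS; apply: tame_ext (tameM r0 H ih) => t _; rewrite exprS.
Qed.

Lemma tame_lim {R : realType} (C r : R) (h : R -> R) :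
  (forall e : R, 0 < e -> exists2 g, tame C r g &
     forall t, `|t| <= r -> `|h t - g t| <= e) -> tame C r h.
Proof.
move=> H e e0; have e2 : 0 < e / 2 by lra.
have [g G gh] := H _ e2; have [Q [Qh [h1 h2 h3]]] := G _ e2.
exists Q, Qh; split=> // t tr.
rewrite -(subrKA (g t)) (le_trans (ler_normD _ _)) // (splitr e).
by rewrite lerD ?h3 ?gh.
Qed.

(* Rescaling the variable by [k] shrinks all but the constant coefficient. *)
Lemma tame_shrink {R : realType} (C r k a : R) (h : R -> R) : 0 <= r ->
  0 <= k <= 1 -> tame C r h ->
  tame (`|h 0 - a| + k * C) r (fun t => h (k * t) - a).
Proof.
move=> r0 /andP[k0 k1] H e e0; have e2 : 0 < e / 2 by lra.
have [Q [Qh [h1 h2 h3]]] := H _ e2.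
exists (\poly_(i < size Q) (Q`_i * k ^+ i) - (Q`_0)%:P + (h 0 - a)%:P).
exists (`|h 0 - a|%:P + k *: Qh); split=> [i||t tr].
- rewrite coefD coefB coefD !coefC coefZ coef_poly.
  have Qh0 := majorant_ge0 i h1; have Qi := h1 i.
  case: eqP => [->|/eqP i0].
    rewrite expr0 mulr1; case: ifP => [_|/negbT].
      by rewrite subrr add0r lerDl mulr_ge0 // (majorant_ge0 0 h1).
    rewrite lt0n negbK size_poly_eq0 => /eqP ->.
    by rewrite coef0 subrr add0r lerDl mulr_ge0 // (majorant_ge0 0 h1).
  rewrite !(subr0, addr0, add0r); case: ifP => _; last first.
    by rewrite normr0 mulr_ge0.
  rewrite normrM normrX (ger0_norm k0) mulrC ler_pM ?exprn_ge0 //.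
  by case: i i0 {Qh0 Qi} => // i _; rewrite exprS ler_piMr // exprn_ile1.
- by rewrite hornerD hornerC hornerZ lerD2l ler_wpM2l.
- have ktr : `|k * t| <= r.
    by rewrite normrM (ger0_norm k0) (le_trans _ tr) // ler_piMl.
  have z0 : `|0 : R| <= r by rewrite normr0.
  have E : (\poly_(i < size Q) (Q`_i * k ^+ i)).[t] = Q.[k * t].
    rewrite horner_poly horner_coef; apply: eq_bigr => i _.
    by rewrite exprMn mulrA.
  rewrite !hornerD hornerN !hornerC E.
  have := h3 _ ktr; have := h3 _ z0; rewrite horner_coef0.
  rewrite !ler_norml => /andP[? ?] /andP[? ?]; apply/andP; split; lra.
Qed.

(* Vanishing at [0] forces the constant coefficients of the approximants to tend
   to [0], so that [h t / t] is again a limit of dominated polynomials. *)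
Lemma tame_flat_bound {R : realType} n : forall (C r M d : R) (h : R -> R)
    (Q Qh : nat -> {poly R}), 0 < r -> 0 < d ->
  (forall m k, `|(Q m)`_k| <= (Qh m)`_k) -> (forall m, (Qh m).[r] <= C) ->
  (forall t, 0 < `|t| < r -> (fun m => (Q m).[t]) @ \oo --> h t) ->
  (forall t, 0 < `|t| < d -> `|h t| <= M * `|t| ^+ n) ->
  forall t, 0 < `|t| < r -> `|h t| <= C * (`|t| / r) ^+ n.
Proof.
elim: n => [|n ih] C r M d h Q Qh r0 d0 QQh QhC Qlim hM t tr.
  rewrite expr0 mulr1.
  have : (fun m => `|(Q m).[t]|) @ \oo --> `|h t| by apply: cvg_norm; exact: Qlim.
  move=> H; rewrite -(cvg_lim _ H) //; apply: limr_le; first by apply/cvg_ex; eexists; exact: H.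
  near=> m; rewrite (le_trans _ (QhC m)) //; apply: horner_majorant => //.
  by case/andP: tr => _ /ltW.
(* [drp] drops the constant coefficient and divides by [X]. Domination survives, and the bound at
   [r] becomes [C / r]; this feeds the induction for [h x / x]. *)
pose drp (p : {poly R}) := \poly_(i < (size p).-1) p`_i.+1.
have coef_drp p k : (drp p)`_k = p`_k.+1.
  rewrite coef_poly; case: ltnP => // h0; rewrite nth_default //.
  by case: (size p) h0.
have drpE p : p = drp p * 'X + (p`_0)%:P.
  apply/polyP => -[|i]; rewrite coefD coefMX coefC /= ?add0r //.
  by rewrite addr0 coef_drp.
have drpH p x : p.[x] = (drp p).[x] * x + p`_0.
  by rewrite {1}(drpE p) hornerMXaddC.
have C0 : 0 <= C.
  rewrite (le_trans _ (QhC 0%N)) //.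
  by rewrite (le_trans _ (horner_majorant (t := 0) (QQh 0%N) _)) ?normr0 ?(ltW r0).
have drp_maj m k : `|(drp (Q m))`_k| <= (drp (Qh m))`_k by rewrite !coef_drp.
have drp_r m : (drp (Qh m)).[r] <= C / r.
  rewrite ler_pdivlMr // (le_trans _ (QhC m)) // [leRHS]drpH lerDl.
  exact: majorant_ge0 (QQh m).
(* At a small point [s] the constant coefficient of [Q m] is [(Q m).[s] - (drp (Q m)).[s] * s]. The
   first term is close to [h s], small by flatness, and the second is at most [C / r * s]. *)
have Q0 : (fun m => (Q m)`_0) @ \oo --> (0 : R).
  apply/cvgrPdist_le => e e0.
  pose M' := `|M| + C / r + 1.
  have M'0 : 0 < M' by rewrite ltr_wpDl // addr_ge0 // divr_ge0 // ltW.
  (* Below [d] and [r] so that both hypotheses apply, at most 1 so that [s ^+ n.+1 <= s], and small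
     against [M'], which collects the constants of the resulting linear bound. *)
  pose s := Num.min (Num.min (d / 2) (r / 2)) (Num.min 1 (e / 2 / M')).
  have s0 : 0 < s by rewrite !lt_min ltr01 !divr_gt0 ?divr_gt0 //.
  have sd : s < d by rewrite (@le_lt_trans _ _ (d / 2)) ?ge_min ?lexx //; lra.
  have sr : s < r by rewrite (@le_lt_trans _ _ (r / 2)) ?ge_min ?lexx ?orbT //; lra.
  have s1 : s <= 1 by rewrite !ge_min lexx !orbT.
  have se : s * M' <= e / 2 by rewrite -ler_pdivlMr // !ge_min lexx !orbT.
  have ns : `|s| = s by rewrite gtr0_norm.
  have hs := Qlim s; rewrite ns s0 sr in hs.
  have /cvgrPdist_le /(_ (e / 2)) := hs isT.
  move=> /(_ (divr_gt0 e0 (ltr0Sn _ 1))) hm.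
  near=> m.
  have : `|h s - (Q m).[s]| <= e / 2 by near: m.
  have := hM s; rewrite ns s0 sd => /(_ isT) => hs1.
  rewrite [(Q m).[s]]drpH.
  have : `|(drp (Q m)).[s]| <= C / r.
    by apply: le_trans (drp_r m); apply: horner_majorant => //; rewrite ns ltW.
  move=> hd hq; rewrite sub0r normrN.
  have -> : (Q m)`_0 = h s - (h s - ((drp (Q m)).[s] * s + (Q m)`_0)) - (drp (Q m)).[s] * s.
    by ring.
  apply: (le_trans (ler_normB _ _)); apply: (@le_trans _ _ (`|M| * s + e / 2 + C / r * s)).
    apply: lerD; last by rewrite normrM ns ler_wpM2r // ltW.
    apply: (le_trans (ler_normB _ _)); apply: lerD => //.
    apply: (le_trans hs1); apply: (@le_trans _ _ (`|M| * s ^+ n.+1)).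
      by rewrite ler_wpM2r ?exprn_ge0 ?ler_norm // ltW.
    by rewrite ler_wpM2l // exprS ler_piMr ?exprn_ile1 ?(ltW s0).
  have : s * M' = `|M| * s + C / r * s + s by rewrite /M'; ring.
  lra.
have lim1 x : 0 < `|x| < r -> (fun m => (drp (Q m)).[x]) @ \oo --> h x / x.
  move=> xr; have x0 : x != 0 by rewrite -normr_gt0; case/andP: xr.
  have -> : (fun m => (drp (Q m)).[x]) = (fun m => ((Q m).[x] - (Q m)`_0) / x).
    by apply/funext => m; rewrite [(Q m).[x]]drpH addrK mulfK.
  rewrite -[h x]subr0; apply: cvgM; last exact: cvg_cst.
  by apply: cvgB => //; exact: Qlim.
have hM1 x : 0 < `|x| < d -> `|h x / x| <= M * `|x| ^+ n.
  move=> xd; have x0 : 0 < `|x| by case/andP: xd.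
  by rewrite normrM normfV ler_pdivrMr // -mulrA -exprSr hM.
have t0 : 0 < `|t| by case/andP: tr.
have := ih _ _ _ _ (fun x => h x / x) _ _ r0 d0 drp_maj drp_r lim1 hM1 t tr.
rewrite normrM normfV ler_pdivrMr // => /le_trans; apply.
by rewrite exprSr le_eqVlt; apply/orP; left; apply/eqP; field; rewrite gt_eqF.
Unshelve. all: by end_near. Qed.

(** The bounds [C * (|t| / r)^n] hold for every [n] with the same [C], and [|t| < r] makes them tend
    to 0. The radius [d] must be common to all orders; only [M] may depend on [n]. *)
Lemma tame_flat {R : realType} (C r d : R) (h : R -> R) :
  0 < r -> 0 < d -> tame C r h ->
  (forall n, exists M, forall t, 0 < `|t| < d -> `|h t| <= M * `|t| ^+ n) ->
  forall t, 0 < `|t| < r -> h t = 0.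
Proof.
move=> r0 d0 H hM t tr.
have C0 := tame_ge0 (ltW r0) H.
have [Q] := choice (fun m : nat => H (m.+1%:R^-1) (ltac:(by rewrite invr_gt0))).
case/choice => Qh HQ.
have q1 : 0 <= `|t| / r < 1.
  by case/andP: tr => t0 t1; rewrite divr_ge0 ?(ltW r0) //= ltr_pdivrMr // mul1r.
apply/eqP; rewrite -normr_eq0 eq_le normr_ge0 andbT; apply/ler_addgt0Pr => e e0.
rewrite add0r; have [n0 /(_ n0 (leqnn _))] := geo_small C q1 e0.
apply: le_trans; have [M hn] := hM n0.
apply: (tame_flat_bound (Q := Q) (Qh := Qh) (M := M) (d := d)) => //.
- by move=> m k; case: (HQ m).
- by move=> m; case: (HQ m).
move=> x xr; apply/cvgrPdist_le => e' e'0.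
near=> m; have [_ _ /(_ x) hx] := HQ m.
apply: (le_trans (hx _)); first by case/andP: xr => _ /ltW.
apply: ltW; near: m; exact: (near_infty_natSinv_lt (PosNum e'0)).
Unshelve. all: by end_near. Qed.

(** * Roots of unity and a discrete Cauchy formula *)

Definition e2pi {R : realType} (t : R) : R[i] := cis (2 * pi * t).

Lemma exD {R : realType} (s t : R) : e2pi (s + t) = e2pi s * e2pi t.
Proof. by rewrite /e2pi mulrDr cisD. Qed.

Lemma ex0 {R : realType} : e2pi (0 : R) = 1.
Proof. by rewrite /e2pi mulr0 cis0. Qed.

Lemma ex1 {R : realType} : e2pi (1 : R) = 1.
Proof.
rewrite /e2pi mulr1 mulr_natl mulr2n cisD /cis cospi sinpi.
by apply/eqP; rewrite eq_complex /= !(mulr0, mul0r, mulrNN, mulr1, subr0, addr0) !eqxx.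
Qed.

Lemma ex_nat {R : realType} n : e2pi (n%:R : R) = 1.
Proof.
elim: n => [|n ih]; first by rewrite ex0.
by rewrite -addn1 natrD exD ih ex1 mulr1.
Qed.

Lemma nc_ex {R : realType} (t : R) : nc (e2pi t) = 1.
Proof. exact: nc_cis. Qed.

Lemma exN {R : realType} (t : R) : e2pi (- t) = (e2pi t)^-1.
Proof. by rewrite /e2pi mulrN cisN. Qed.

Lemma ex_int {R : realType} (n : int) : e2pi (n%:~R : R) = 1.
Proof.
case: n => n; first exact: ex_nat.
by rewrite NegzE mulrNz exN -pmulrn ex_nat invr1.
Qed.

Lemma exMn {R : realType} (t : R) n : e2pi (n%:R * t) = e2pi t ^+ n.
Proof.
elim: n => [|n ih]; first by rewrite mul0r ex0.
by rewrite -addn1 natrD mulrDl mul1r exD ih exprD expr1.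
Qed.

Lemma ex_neq1 {R : realType} (t : R) : 0 < t < 1 -> e2pi t != 1.
Proof.
move=> /andP[t0 t1]; apply/eqP => /(congr1 (@complex.Re R)) /=.
have -> : 2 * pi * t = pi * t + pi * t by ring.
rewrite cosD -!expr2 cos2sin2 => h.
have : 0 < sin (pi * t).
  by apply: sin_gt0_pi; rewrite mulr_gt0 ?pi_gt0 //= gtr_pMr ?pi_gt0.
by nra.
Qed.

Lemma sum_root1 {R : realType} (z : R[i]) m :
  z ^+ m = 1 -> z != 1 -> \sum_(j < m) z ^+ j = 0.
Proof.
move=> zm z1; have := subrX1 z m; rewrite zm subrr => /esym/eqP.
by rewrite mulf_eq0 subr_eq0 (negPf z1) => /eqP.
Qed.

Lemma nc_nat {R : realType} n : nc (n%:R : R[i]) = n%:R.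
Proof. by rewrite -(rmorph_nat (real_complex R)) nc_real ger0_norm. Qed.

(* The Riemann sums of the Cauchy integral of [F - F (b + y)] vanish up to an
   error: they are moved in [n] steps along the homotopy contracting the circle
   to the point [b + y], and each step changes them by a telescoping sum. *)
Lemma discrete_cauchy {R : realType} (F G : R[i] -> R[i]) (b y : R[i])
    (r e d : R) (m n : nat) (E := fun j : nat => e2pi (j%:R / m%:R : R)) :
  0 < r -> 0 < e -> nc y <= r / 2 -> (1 < m)%N -> (0 < n)%N ->
  (forall z z' : R[i], nc (z - b) <= r -> nc (z' - b) <= r -> nc (z' - z) <= d ->
     nc (F z' - F z - G z * (z' - z)) <= e * nc (z' - z)) ->
  2 * r / n%:R <= d -> r * nc (E 1%N - 1) <= d ->
  nc (\sum_(j < m) (F (b + r%:C * E j) - F (b + y)) *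
        (r%:C * E j / (r%:C * E j - y))) <= m%:R * (2 * e * r).
Proof.
move=> r0 e0 yr m1 n0 UD hn hm.
have m0 : (0 : R) < m%:R by rewrite ltr0n (ltn_trans _ m1).
have nR0 : (0 : R) < n%:R by rewrite ltr0n.
(* The circle contracted towards [b + y]: it is the full circle for [l = 1] and the point itself for
   [l = 0]. *)
pose p j (l : R) : R[i] := b + (y + l%:C * (r%:C * E j - y)).
have ncrE j : nc (r%:C * E j) = r by rewrite ncM nc_ex nc_real mulr1 gtr0_norm.
have pb j l : 0 <= l <= 1 -> nc (p j l - b) <= r.
  move=> /andP[l0 l1]; rewrite /p addrC addKr.
  have -> : y + l%:C * (r%:C * E j - y) = (1 - l)%:C * y + l%:C * (r%:C * E j).
    by rewrite rmorphB; ring.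
  apply: (le_trans (ncD _ _)).
  rewrite ncM nc_real (ncM l%:C) nc_real ncrE !ger0_norm ?subr_ge0 //.
  have : (1 - l) * nc y <= (1 - l) * (r / 2) by rewrite ler_wpM2l ?subr_ge0.
  nra.
have ES j : E j.+1 = E j * E 1%N by rewrite /E -exD -mulrDl -natrD addn1.
have E10 : E 1%N != 1.
  apply: ex_neq1; rewrite divr_gt0 //= ltr_pdivrMr // mul1r ltr1n //.
have eta0 : 0 < nc (E 1%N - 1) by rewrite nc_gt0 // subr_eq0.
(* At fixed [l] the increments of [F] telescope to 0 around the closed curve, and each is [G] times
   a chord up to a relative error [e]. Dividing by the common factor [l * (E 1 - 1)] of the chords
   gives this sum. *)
have S l : 0 < l <= 1 -> nc (\sum_(j < m) G (p j l) * (r%:C * E j)) <= m%:R * (e * r).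
  move=> /andP[l0 l1]; have l01 : 0 <= l <= 1 by rewrite l1 ltW.
  have dp j : p j.+1 l - p j l = l%:C * r%:C * (E j * (E 1%N - 1)).
    by rewrite /p ES; ring.
  have ndp j : nc (p j.+1 l - p j l) = l * (r * nc (E 1%N - 1)).
    by rewrite dp !ncM nc_ex !nc_real mul1r !gtr0_norm // mulrA.
  have T : \sum_(j < m) (F (p j.+1 l) - F (p j l)) = 0.
    rewrite -(big_mkord xpredT (fun j => F (p j.+1 l) - F (p j l))) telescope_sumr //.
    by rewrite /p /E divff ?gt_eqF // mul0r ex0 ex1 subrr.
  have H : nc (\sum_(j < m) G (p j l) * (p j.+1 l - p j l)) <=
      m%:R * (e * (l * (r * nc (E 1%N - 1)))).
    have -> : \sum_(j < m) G (p j l) * (p j.+1 l - p j l) = - \sum_(j < m)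
        (F (p j.+1 l) - F (p j l) - G (p j l) * (p j.+1 l - p j l)).
      by rewrite [in RHS]sumrB T sub0r opprK.
    rewrite ncN (le_trans (nc_sum _ _ _)) //.
    rewrite -[leLHS]mulr1 mulr1 -[m in m%:R]card_ord mulr_natl -sumr_const.
    apply: ler_sum => j _; rewrite -(ndp j); apply: UD; rewrite ?pb //.
    by rewrite ndp (le_trans _ hm) // ler_piMl ?(mulr_ge0 (ltW r0) (ltW eta0)).
  have HE : \sum_(j < m) G (p j l) * (p j.+1 l - p j l) =
     (l%:C * (E 1%N - 1)) * \sum_(j < m) G (p j l) * (r%:C * E j).
    by rewrite mulr_sumr; apply: eq_bigr => j _; rewrite dp; ring.
  rewrite HE ncM ncM nc_real gtr0_norm // in H.
  have le0 : 0 < l * nc (E 1%N - 1) by rewrite mulr_gt0.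
  rewrite -(ler_pM2l le0) (le_trans H) // le_eqVlt; apply/orP; left; apply/eqP; ring.
pose J (l : R) : R[i] := \sum_(j < m) F (p j l) * (r%:C * E j / (r%:C * E j - y)).
have rEy j : r%:C * E j - y != 0.
  rewrite subr_eq0; apply/eqP => h; have := ncrE j; rewrite h; lra.
(* In the direction of contraction the displacement carries the factor [r * E j - y]. It cancels the
   kernel and leaves the sum bounded by [S]. *)
have step i : (i < n)%N ->
    nc (J (i.+1%:R / n%:R) - J (i%:R / n%:R)) <= m%:R * (2 * e * r) / n%:R.
  move=> ilt; set l' := i.+1%:R / n%:R; set l := i%:R / n%:R.
  have l'0 : 0 < l' <= 1 by rewrite divr_gt0 //= ler_pdivrMr // mul1r ler_nat.
  have l'1 : 0 <= l' <= 1 by case/andP: l'0 => /ltW -> ->.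
  have l01 : 0 <= l <= 1 by rewrite divr_ge0 //= ler_pdivrMr // mul1r ler_nat ltnW.
  have ll : l' - l = n%:R^-1 by rewrite /l' /l -mulrBl -natrB // subSnn mul1r.
  have dp j : p j l - p j l' = - ((n%:R^-1)%:C * (r%:C * E j - y)).
    by rewrite /p -ll rmorphB; ring.
  have nyE j : nc (r%:C * E j - y) <= 2 * r.
    by apply: (le_trans (ncB _ _)); rewrite ncrE; lra.
  have -> : J l' - J l = (n%:R^-1)%:C * \sum_(j < m) G (p j l') * (r%:C * E j) -
     \sum_(j < m) (F (p j l) - F (p j l') - G (p j l') * (p j l - p j l')) *
        (r%:C * E j / (r%:C * E j - y)).
    rewrite /J mulr_sumr -!sumrB; apply: eq_bigr => j _; rewrite dp.
    move: (rEy j); set a : R[i] := r%:C * E j => ay.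
    move: (F (p j l')) (F (p j l)) (G (p j l')) (n%:R^-1)%:C ay => f1 f0 g0 k ay.
    have ay' : a - y != 0 by exact: ay.
    by clearbody a; clear -ay'; field.
  apply: (le_trans (ncB _ _)); rewrite ncM nc_real ger0_norm ?invr_ge0 //.
  have -> : m%:R * (2 * e * r) / n%:R = n%:R^-1 * (m%:R * (e * r)) + m%:R * (e * r / n%:R).
    by ring.
  apply: lerD; first by rewrite ler_wpM2l ?invr_ge0 // S.
  apply: (le_trans (nc_sum _ _ _)); rewrite -[m in m%:R]card_ord mulr_natl -sumr_const.
  apply: ler_sum => j _; rewrite ncM ncM ncrE ncV.
  have rE0 := nc_gt0 (rEy j).
  have h : nc (F (p j l) - F (p j l') - G (p j l') * (p j l - p j l')) <=
      e * (n%:R^-1 * nc (r%:C * E j - y)).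
    have nd : nc (p j l - p j l') = n%:R^-1 * nc (r%:C * E j - y).
      by rewrite dp ncN ncM nc_real ger0_norm ?invr_ge0.
    rewrite -nd; apply: UD; rewrite ?pb // nd (le_trans _ hn) // mulrC.
    by rewrite ler_wpM2r ?invr_ge0.
  apply: (@le_trans _ _ (e * (n%:R^-1 * nc (r%:C * E j - y)) * (r / nc (r%:C * E j - y)))).
    by rewrite ler_wpM2r // divr_ge0 // ltW.
  by rewrite le_eqVlt; apply/orP; left; apply/eqP; field; rewrite !gt_eqF.
have -> : \sum_(j < m) (F (b + r%:C * E j) - F (b + y)) *
        (r%:C * E j / (r%:C * E j - y)) = J (n%:R / n%:R) - J (0%:R / n%:R).
  rewrite /J -sumrB divff ?gt_eqF // mul0r; apply: eq_bigr => j _.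
  rewrite mulrBl /p; congr (F (b + _) * _ - F (b + _) * _).
    by rewrite mul1r; ring.
  by rewrite mul0r addr0.
rewrite -(telescope_sumr (fun i => J (i%:R / n%:R))) // big_mkord.
apply: (le_trans (nc_sum _ _ _)).
apply: (@le_trans _ _ (\sum_(i < n) (m%:R * (2 * e * r) / n%:R))).
  by apply: ler_sum => i _; exact: step.
rewrite sumr_const card_ord -mulr_natl.
by rewrite le_eqVlt; apply/orP; left; apply/eqP; field; rewrite gt_eqF.
Qed.

Lemma exists_nat_ge {R : realType} (x : R) :
  exists n0 : nat, forall n, (n0 <= n)%N -> x <= n%:R.
Proof.
exists (Num.bound `|x|) => n h; apply: (le_trans (ler_norm x)).
by apply: (le_trans (ltW (archi_boundP (normr_ge0 x)))); rewrite ler_nat.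
Qed.

Lemma sum_ex_inv {R : realType} m k : (k < m)%N ->
  \sum_(j < m) (e2pi (j%:R / m%:R : R))^-1 ^+ k = (if k == 0%N then m%:R else 0).
Proof.
move=> km; have m0 : (0 : R) < m%:R by rewrite ltr0n (leq_trans _ km).
have E (j : 'I_m) : (e2pi (j%:R / m%:R : R))^-1 ^+ k = (e2pi (- (k%:R / m%:R))) ^+ j.
  by rewrite -exN -!exMn; congr e2pi; ring.
case: eqP => [->|/eqP k0].
  rewrite (eq_bigr (fun=> 1)) => [|j _]; last by rewrite expr0.
  by rewrite sumr_const card_ord.
rewrite (eq_bigr _ (fun j _ => E j)) sum_root1 //.
  by rewrite -exMn mulrN mulrC divfK ?gt_eqF // exN ex_nat invr1.
rewrite exN invr_eq1; apply: ex_neq1.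
apply/andP; split; first by rewrite divr_gt0 // ltr0n lt0n.
by rewrite ltr_pdivrMr // mul1r ltr_nat.
Qed.

(* Over the [m]-th roots of unity the Cauchy kernel expands into powers of [t]
   of degree less than [m], up to a geometrically small remainder. *)
Lemma holomorphic_tame {R : realType} (F G : R[i] -> R[i]) (b : R[i]) (r B : R) :
  0 < r -> (forall z : R[i], nc (z - b) <= r -> nc (F z) <= B) ->
  (forall e : R, 0 < e -> exists2 d : R, 0 < d &
    forall z z' : R[i], nc (z - b) <= r -> nc (z' - b) <= r -> nc (z' - z) <= d ->
     nc (F z' - F z - G z * (z' - z)) <= e * nc (z' - z)) ->
  forall v, nc v <= r / 4 ->
  tame (2 * B) 2 (fun t => complex.Re (F (b + t%:C * v))).
Proof.
move=> r0 FB UD v vr e e0.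
have B0 : 0 <= B.
  by apply: le_trans (FB b _); rewrite ?nc_ge0 // subrr nc0 ltW.
(* Makes the error [2 * e1 * r] of [discrete_cauchy] equal to [e / 2]. *)
pose e1 := e / 4 / r; have e10 : 0 < e1 by rewrite !divr_gt0.
have [d d0 UDd] := UD _ e10.
have half01 : 0 <= (2^-1 : R) < 1 by apply/andP; split; lra.
have [n1 hn1] := geo_small (4 * B) half01 (divr_gt0 e0 (ltr0Sn R 1)).
have [n2 hn2] := exists_nat_ge (4 * pi * r / d).
have [n3 hn3] := exists_nat_ge (2 * r / d).
(* [m] makes the geometric remainder at most [e / 2] and the chords at most [d]; [n] makes the
   radial steps at most [d]. *)
pose m := maxn 2 (maxn n1 n2); pose n := maxn 1 n3.
have m2 : (1 < m)%N by rewrite leq_maxl.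
have n0 : (0 < n)%N by rewrite leq_maxl.
have m0 : (0 : R) < m%:R by rewrite ltr0n (ltn_trans _ m2).
have mC0 : m%:R != 0 :> R[i] by rewrite pnatr_eq0 -lt0n (ltn_trans _ m2).
have hm1 : 4 * B * 2^-1 ^+ m <= e / 2.
  by apply: hn1; rewrite !leq_max leqnn !orbT.
have hm2 : 4 * pi * r / d <= m%:R by apply: hn2; rewrite !leq_max leqnn !orbT.
have hn : 2 * r / n%:R <= d.
  rewrite ler_pdivrMr ?ltr0n // [d * _]mulrC -ler_pdivrMr //; apply: hn3.
  by rewrite leq_max leqnn orbT.
pose E j : R[i] := e2pi (j%:R / m%:R : R).
have hm : r * nc (E 1%N - 1) <= d.
  rewrite (@le_trans _ _ (r * (2 * (2 * pi / m%:R)))) //.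
    rewrite ler_pM2l // /E /e2pi div1r; apply: (le_trans (cis_bound _)).
    by rewrite ger0_norm // divr_ge0 // mulr_ge0 // pi_ge0.
  rewrite !mulrA ler_pdivrMr // mulrC.
  rewrite ler_pdivrMr // in hm2; rewrite [d * _]mulrC (le_trans _ hm2) //.
  by rewrite le_eqVlt; apply/orP; left; apply/eqP; ring.
have ncrE j : nc (r%:C * E j) = r by rewrite ncM nc_ex nc_real mulr1 gtr0_norm.
have rE0 j : r%:C * E j != 0.
  by apply/eqP => h; have := ncrE j; rewrite h nc0 => h'; rewrite h' ltxx in r0.
pose Fj j : R[i] := F (b + r%:C * E j).
have FjB j : nc (Fj j) <= B by apply: FB; rewrite addrC addKr ncrE.
(* Taylor coefficients along [v], as averages over the circle. Since [nc v <= r / 4] they are at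
   most [B / 4^k], so at [t = 2] the majorant is a geometric sum of ratio one half, at most
   [2 * B]. *)
pose q k : R := complex.Re (m%:R^-1 * \sum_(j < m) Fj j * (v / (r%:C * E j)) ^+ k).
pose Q := \poly_(k < m) q k; pose Qh := \poly_(k < m) (B * 4^-1 ^+ k).
have ncm : nc (m%:R^-1 : R[i]) = m%:R^-1 by rewrite ncV nc_nat.
exists Q, Qh; split.
- move=> k; rewrite !coef_poly; case: ifP => _; last by rewrite normr0.
  apply: (le_trans (nc_Re _)); rewrite ncM ncm mulrC ler_pdivrMr //.
  apply: (le_trans (nc_sum _ _ _)).
  rewrite -[m in _ * m%:R]card_ord mulr_natr -sumr_const.
  apply: ler_sum => j _; rewrite ncM ncX ncM ncV ncrE.
  apply: ler_pM; rewrite ?nc_ge0 ?exprn_ge0 ?divr_ge0 ?nc_ge0 ?(ltW r0) //.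
  rewrite lerXn2r ?nnegrE ?divr_ge0 ?nc_ge0 ?(ltW r0) ?invr_ge0 //.
  by rewrite ler_pdivrMr // mulrC.
- rewrite horner_poly.
  have -> : \sum_(i < m) B * 4^-1 ^+ i * 2 ^+ i = B * \sum_(i < m) (2^-1 : R) ^+ i.
    rewrite mulr_sumr; apply: eq_bigr => i _; rewrite -mulrA -exprMn.
    by congr (_ * _ ^+ _); field.
  rewrite mulrC ler_wpM2r //; have := subrX1 (2^-1 : R) m.
  have : 0 <= (2^-1 : R) ^+ m by rewrite exprn_ge0.
  lra.
move=> t t2; pose y := t%:C * v.
have yr : nc y <= r / 2.
  rewrite ncM nc_real; have : `|t| * nc v <= 2 * (r / 4) by rewrite ler_pM ?nc_ge0.
  lra.
pose x j : R[i] := y / (r%:C * E j).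
pose T j : R[i] := \sum_(k < m) x j ^+ k.
have QE : Q.[t] = complex.Re (m%:R^-1 * \sum_(j < m) Fj j * T j).
  rewrite horner_poly /T.
  have -> : m%:R^-1 * (\sum_(j < m) Fj j * \sum_(k < m) x j ^+ k) =
    \sum_(k < m) (t ^+ k)%:C * (m%:R^-1 * \sum_(j < m) Fj j * (v / (r%:C * E j)) ^+ k).
    under eq_bigr do rewrite mulr_sumr.
    rewrite exchange_big mulr_sumr; apply: eq_bigr => k _.
    rewrite !mulr_sumr; apply: eq_bigr => j _.
    by rewrite /x /y rmorphXn -mulrA exprMn; ring.
  by rewrite Re_sum; apply: eq_bigr => k _; rewrite Re_realM mulrC.
pose c j : R[i] := r%:C * E j / (r%:C * E j - y).
have nyE j : r / 2 <= nc (r%:C * E j - y).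
  have := ncD (r%:C * E j - y) y; rewrite subrK ncrE; lra.
have yE j : r%:C * E j - y != 0.
  apply/eqP => h; have := nyE j; rewrite h nc0; lra.
have cB j : nc (c j) <= 2.
  rewrite ncM ncV ncrE ler_pdivrMr; last by apply: lt_le_trans (nyE j); lra.
  have := nyE j; lra.
have xB j : nc (x j) <= 2^-1.
  rewrite ncM ncV ncrE ler_pdivrMr //; lra.
(* The finite geometric sum is the Cauchy kernel [c j] up to a remainder of size [2^-m]. *)
have TE j : T j = c j - c j * x j ^+ m.
  have x1 : x j - 1 = - (c j)^-1.
    by rewrite /x /c; move: (rE0 j) (yE j); set a : R[i] := r%:C * E j => a0 ay; field; rewrite a0 ay.
  have c0 : c j != 0 by rewrite mulf_neq0 // invr_eq0.
  have := subrX1 (x j) m; rewrite x1 => h.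
  have -> : c j - c j * x j ^+ m = c j * - (x j ^+ m - 1) by ring.
  by rewrite h mulNr opprK mulVKf.
(* The average of the [T j] is exactly 1, so [F (b + y)] can be brought under the sum without
   error. *)
have sT : \sum_(j < m) T j = m%:R.
  rewrite /T exchange_big /=.
  rewrite (eq_bigr (fun k : 'I_m => (y / r%:C) ^+ k * (if (k : nat) == 0%N then m%:R else 0))).
    rewrite (bigD1 (Ordinal (ltn_trans (ltn0Sn 0) m2))) //= expr0 mul1r big1 ?addr0 //.
    by move=> k; rewrite -val_eqE /= => /negPf ->; rewrite mulr0.
  move=> k _; rewrite -(sum_ex_inv (ltn_ord k)) mulr_sumr; apply: eq_bigr => j _.
  by rewrite /x invfM mulrA exprMn.
rewrite QE -ReB (le_trans (nc_Re _)) //.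
have -> : F (b + y) - m%:R^-1 * \sum_(j < m) Fj j * T j =
   m%:R^-1 * (\sum_(j < m) (Fj j - F (b + y)) * (c j * x j ^+ m) -
              \sum_(j < m) (Fj j - F (b + y)) * c j).
  have {1}-> : F (b + y) = m%:R^-1 * \sum_(j < m) F (b + y) * T j.
    by rewrite -mulr_sumr sT mulrCA mulVf // mulr1.
  rewrite -mulrBr -!sumrB; congr (_ * _); apply: eq_bigr => j _; rewrite TE; ring.
rewrite ncM ncm mulrC ler_pdivrMr //; apply: (le_trans (ncB _ _)).
have H1 : nc (\sum_(j < m) (Fj j - F (b + y)) * (c j * x j ^+ m)) <= e / 2 * m%:R.
  apply: (le_trans (nc_sum _ _ _)).
  rewrite -[m in _ * m%:R]card_ord mulr_natr -sumr_const.
  apply: ler_sum => j _; apply: le_trans hm1; rewrite ncM (ncM (c j)) ncX.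
  have -> : 4 * B * 2^-1 ^+ m = 2 * B * (2 * 2^-1 ^+ m) by ring.
  apply: ler_pM; rewrite ?mulr_ge0 ?exprn_ge0 ?nc_ge0 //.
    apply: (le_trans (ncB _ _)); have := FjB j.
    have : nc (F (b + y)) <= B.
      by apply: FB; rewrite (addrC b) addrK (le_trans yr) // ler_pdivrMr // mulr_natr mulr2n lerDl ltW.
    lra.
  apply: ler_pM; rewrite ?exprn_ge0 ?nc_ge0 ?cB //.
  by rewrite lerXn2r ?nnegrE ?nc_ge0 ?invr_ge0.
have H2 : nc (\sum_(j < m) (Fj j - F (b + y)) * c j) <= m%:R * (2 * e1 * r).
  exact: (discrete_cauchy r0 e10 yr m2 n0 UDd hn hm).
apply: (le_trans (lerD H1 H2)); rewrite mulrC -mulrDr mulrC ler_wpM2r ?(ltW m0) //.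
by rewrite /e1 -mulrA divfK ?gt_eqF //; lra.
Qed.

(** * The discrete Fourier transform in one and two variables *)

Definition dft {R : realType} (N : nat) (a : nat -> R[i]) (k : nat) : R[i] :=
  N%:R^-1 * \sum_(j < N) a j * e2pi (- (k%:R * j%:R / N%:R) : R).

Lemma natC_neq0 {R : realType} N : (0 < N)%N -> N%:R != 0 :> R[i].
Proof. by rewrite pnatr_eq0 lt0n. Qed.

Lemma sum_ex_ortho {R : realType} N i j : (i < N)%N -> (j < N)%N ->
  \sum_(k < N) e2pi (k%:R * ((j%:R - i%:R) / N%:R) : R) = (if i == j then N%:R else 0).
Proof.
move=> iN jN; have N0 : (0 : R) < N%:R by rewrite ltr0n (leq_trans _ iN).
case: eqP => [->|/eqP ij].
  rewrite (eq_bigr (fun=> 1)) => [|k _]; last by rewrite subrr mul0r mulr0 ex0.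
  by rewrite sumr_const card_ord.
rewrite (eq_bigr (fun k : 'I_N => e2pi ((j%:R - i%:R) / N%:R : R) ^+ k)); last first.
  by move=> k _; rewrite exMn.
apply: sum_root1.
  rewrite -exMn mulrC divfK ?gt_eqF //.
  have -> : (j%:R - i%:R : R) = (j%:Z - i%:Z)%:~R by rewrite rmorphB.
  exact: ex_int.
case: (ltngtP i j) ij => // h _.
  apply: ex_neq1; rewrite -natrB ?(ltnW h) //; apply/andP; split.
    by rewrite divr_gt0 // ltr0n subn_gt0.
  by rewrite ltr_pdivrMr // mul1r ltr_nat (leq_ltn_trans (leq_subr _ _)).
rewrite -(opprB i%:R) mulNr exN invr_eq1.
apply: ex_neq1; rewrite -natrB ?(ltnW h) //; apply/andP; split.
  by rewrite divr_gt0 // ltr0n subn_gt0.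
by rewrite ltr_pdivrMr // mul1r ltr_nat (leq_ltn_trans (leq_subr _ _)).
Qed.

Lemma dft_inv {R : realType} N (a : nat -> R[i]) j : (j < N)%N ->
  \sum_(k < N) dft N a k * e2pi (k%:R * j%:R / N%:R) = a j.
Proof.
move=> jN; have N0 := @natC_neq0 R N (leq_ltn_trans (leq0n j) jN).
rewrite (eq_bigr (fun k : 'I_N => N%:R^-1 * \sum_(i < N) a i *
    e2pi (k%:R * ((j%:R - i%:R) / N%:R)))); last first.
  move=> k _; rewrite /dft -[LHS]mulrA; congr (_ * _); rewrite mulr_suml; apply: eq_bigr => i _.
  by rewrite -mulrA -exD; congr (_ * e2pi _); ring.
rewrite -mulr_sumr exchange_big /=.
rewrite (eq_bigr (fun i : 'I_N => a i * (if (i : nat) == j then N%:R else 0))); last first.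
  by move=> i _; rewrite -mulr_sumr sum_ex_ortho.
rewrite (bigD1 (Ordinal jN)) //= eqxx big1 ?addr0; last first.
  by move=> i; rewrite -val_eqE /= => /negPf ->; rewrite mulr0.
by rewrite mulrCA mulVf // mulr1.
Qed.

Lemma conj_ex {R : realType} (t : R) : conjc (e2pi t) = e2pi (- t).
Proof. by rewrite /e2pi mulrN /cis cosN sinN. Qed.

Lemma conjcM_ex {R : realType} (x : R[i]) (t : R) :
  conjc (x * e2pi t) = conjc x * e2pi (- t).
Proof. by rewrite -conj_ex; exact: rmorphM. Qed.

Lemma nc_sqr {R : realType} (z : R[i]) : ((nc z) ^+ 2)%:C = z * conjc z.
Proof. by rewrite -sqr_normc rmorphXn. Qed.

Lemma dft_parseval {R : realType} N (a : nat -> R[i]) : (0 < N)%N ->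
  \sum_(k < N) nc (dft N a k) ^+ 2 = N%:R^-1 * \sum_(j < N) nc (a j) ^+ 2.
Proof.
move=> N0; apply: complexI; rewrite rmorphM !rmorph_sum /= fmorphV rmorph_nat.
rewrite (eq_bigr (fun k : 'I_N => N%:R^-1 * \sum_(j < N) conjc (a j) *
    (dft N a k * e2pi (k%:R * j%:R / N%:R)))); last first.
  move=> k _; rewrite nc_sqr {2}/dft rmorphM fmorphV rmorph_nat rmorph_sum /=.
  rewrite mulrCA mulr_sumr; congr (_ * _); apply: eq_bigr => j _.
  by rewrite conjcM_ex opprK; ring.
rewrite -mulr_sumr exchange_big /=; congr (_ * _); apply: eq_bigr => j _.
by rewrite -mulr_sumr dft_inv // nc_sqr mulrC.
Qed.

Lemma sum_double {V : nmodType} (F : nat -> V) N :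
  \sum_(J < N.*2) F J = \sum_(j < N) (F j.*2 + F j.*2.+1).
Proof.
elim: N => [|N ih]; first by rewrite !big_ord0.
by rewrite doubleS !big_ord_recr /= ih addrA.
Qed.

Lemma sum_halves {V : nmodType} (F : nat -> V) N :
  \sum_(J < N.*2) F J = \sum_(j < N) (F j + F (j + N)%N).
Proof.
rewrite -addnn big_split_ord big_split /=; congr (_ + _).
by apply: eq_bigr => j _; rewrite addnC.
Qed.

(** Sampling at half the rate cannot tell the frequencies [k] and [k + N] apart: in their sum the
    odd samples carry opposite signs and cancel. *)
Lemma dft_alias {R : realType} N (a : nat -> R[i]) k : (0 < N)%N ->
  dft N (fun j => a j.*2) k = dft N.*2 a k + dft N.*2 a (k + N)%N.
Proof.
move=> N0; have NR : (N%:R : R) != 0 by rewrite pnatr_eq0 -lt0n.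
have HR : N.*2%:R = 2 * N%:R :> R by rewrite -mul2n natrM.
have HC : N.*2%:R = 2 * N%:R :> R[i] by rewrite -mul2n natrM.
rewrite /dft -mulrDr -big_split /= HR HC invfM -[RHS]mulrA.
rewrite mulrCA; congr (_ * _).
apply: (mulfI (x := 2)); first by rewrite pnatr_eq0.
rewrite mulrA mulfV ?pnatr_eq0 // mul1r.
rewrite (sum_double (fun J => a J * e2pi (- (k%:R * J%:R / (2 * N%:R))) +
  a J * e2pi (- ((k + N)%:R * J%:R / (2 * N%:R))))) mulr_sumr.
apply: eq_bigr => j _.
have E1 : (- (k%:R * j.*2%:R / (2 * N%:R)) : R) = - (k%:R * j%:R / N%:R).
  by rewrite -muln2 natrM; field.
have E2 : (- ((k + N)%:R * j.*2%:R / (2 * N%:R)) : R) = - (k%:R * j%:R / N%:R) + - j%:R.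
  by rewrite -muln2 natrM natrD; field.
have E3 : (- ((k + N)%:R * j.*2.+1%:R / (2 * N%:R)) : R) =
    - (k%:R * j.*2.+1%:R / (2 * N%:R)) + (- j%:R + - 2^-1).
  by rewrite -addn1 -muln2 !natrD natrM; field.
(* A square root of 1 that is not 1 itself. *)
have exh : e2pi (- 2^-1 : R) = -1.
  have : e2pi (- 2^-1 : R) ^+ 2 = 1.
    by rewrite -exMn mulrN divff ?pnatr_eq0 // exN ex1 invr1.
  move/eqP; rewrite sqrf_eq1 => /orP[/eqP h|/eqP //].
  have : e2pi (2^-1 : R) != 1 by apply: ex_neq1; apply/andP; split; lra.
  by rewrite -invr_eq1 -exN h eqxx.
rewrite E1 E2 E3 exD (exD (- (k%:R * j.*2.+1%:R / (2 * N%:R)))) (exD (- j%:R)) exh.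
by rewrite (exN (nat_of_ord j)%:R) ex_nat invr1; ring.
Qed.

Lemma dft_shift {R : realType} N (a : nat -> R[i]) k : (0 < N)%N -> a N = a 0%N ->
  dft N (fun j => a j.+1) k = e2pi (k%:R / N%:R) * dft N a k.
Proof.
move=> N0 aN; have NR : (N%:R : R) != 0 by rewrite pnatr_eq0 -lt0n.
rewrite /dft mulrCA; congr (_ * _).
pose G j := a j * e2pi (- (k%:R * j%:R / N%:R) : R).
have T : \sum_(j < N) G j.+1 = \sum_(j < N) G j.
  apply/eqP; rewrite -subr_eq0 -sumrB -(big_mkord xpredT (fun j => G j.+1 - G j)).
  rewrite telescope_sumr // /G aN mulfK // mulr0 mul0r oppr0 ex0 mulr1.
  by rewrite exN ex_nat invr1 mulr1 subrr.
rewrite -/(G _) -[\sum_(i < N) a i * _]T mulr_sumr; apply: eq_bigr => j _.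
rewrite /G mulrCA -exD; congr (_ * e2pi _).
by rewrite -addn1 natrD; field.
Qed.

Lemma dft_lin {R : realType} N (a b c : nat -> R[i]) k :
  dft N (fun j => a j - 2 * b j + c j) k = dft N a k - 2 * dft N b k + dft N c k.
Proof.
rewrite /dft mulrCA -mulrBr -mulrDr; congr (_ * _).
rewrite mulr_sumr -sumrB -big_split /=; apply: eq_bigr => j _; ring.
Qed.

Lemma dft_diff2 {R : realType} N (a : nat -> R[i]) k : (0 < N)%N ->
  a N = a 0%N -> a N.+1 = a 1%N ->
  dft N (fun j => a j.+2 - 2 * a j.+1 + a j) k = (e2pi (k%:R / N%:R) - 1) ^+ 2 * dft N a k.
Proof.
move=> N0 h0 h1; rewrite dft_lin.
by rewrite (dft_shift (a := fun j => a j.+1)) // dft_shift //; ring.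
Qed.

(** The square of the modulus is [2 - 2 * cos (2 * pi * t)], and the cosine is nonpositive on this
    range. Hence at top frequencies the multiplier of a second difference can be divided out. *)
Lemma ex_top {R : realType} (t : R) : 4^-1 <= t <= 3 / 4 ->
  2 <= nc (e2pi t - 1) ^+ 2.
Proof.
move=> /andP[t1 t2]; have p0 := @pi_gt0 R.
have c0 : cos (2 * pi * t) <= 0.
  have -> : 2 * pi * t = (2 * pi * t - pi) + pi by rewrite subrK.
  rewrite cosDpi oppr_le0; apply: cos_ge0_pihalf; apply/andP; split; nra.
have := cos2Dsin2 (2 * pi * t).
rewrite /e2pi /cis /= sqr_sqrtr ?addr_ge0 ?sqr_ge0 // oppr0 addr0.
by nra.
Qed.

Lemma nc_dft {R : realType} N (a : nat -> R[i]) k (e : R) : (0 < N)%N ->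
  (forall j, nc (a j) <= e) -> nc (dft N a k) <= e.
Proof.
move=> N0 h; have NR : (0 : R) < N%:R by rewrite ltr0n.
rewrite /dft ncM ncV nc_nat mulrC ler_pdivrMr //.
apply: (le_trans (nc_sum _ _ _)).
rewrite -[N in e * N%:R]card_ord mulr_natr -sumr_const.
by apply: ler_sum => j _; rewrite ncM nc_ex mulr1.
Qed.

Definition dft2 {R : realType} N (a : nat -> nat -> R[i]) (k l : nat) : R[i] :=
  dft N (fun i => dft N (a i) l) k.

Lemma dft_exch {R : realType} N (a : nat -> nat -> R[i]) k l :
  dft2 N a k l = dft N (fun j => dft N (fun i => a i j) k) l.
Proof.
rewrite /dft2 /dft; congr (_ * _).
under eq_bigr do rewrite -(mulrA N%:R^-1) mulr_suml mulr_sumr.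
under [RHS]eq_bigr do rewrite -(mulrA N%:R^-1) mulr_suml mulr_sumr.
rewrite exchange_big /=; apply: eq_bigr => j _; apply: eq_bigr => i _; ring.
Qed.

Lemma dft2_inv {R : realType} N (a : nat -> nat -> R[i]) i j : (i < N)%N -> (j < N)%N ->
  \sum_(k < N) \sum_(l < N) dft2 N a k l *
    (e2pi (k%:R * i%:R / N%:R) * e2pi (l%:R * j%:R / N%:R)) = a i j.
Proof.
move=> iN jN; rewrite exchange_big /=.
rewrite (eq_bigr (fun l : 'I_N => dft N (a i) l * e2pi (l%:R * j%:R / N%:R))).
  exact: dft_inv.
move=> l _; rewrite -(dft_inv (fun i => dft N (a i) l) iN) mulr_suml.
by apply: eq_bigr => k _; rewrite mulrA.
Qed.

Lemma dft2_parseval {R : realType} N (a : nat -> nat -> R[i]) : (0 < N)%N ->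
  \sum_(k < N) \sum_(l < N) nc (dft2 N a k l) ^+ 2 =
  N%:R^-1 * (N%:R^-1 * \sum_(i < N) \sum_(j < N) nc (a i j) ^+ 2).
Proof.
move=> N0; rewrite exchange_big /=.
under eq_bigr do rewrite dft_parseval //.
rewrite -mulr_sumr exchange_big /=; congr (_ * _).
by rewrite mulr_sumr; apply: eq_bigr => i _; rewrite dft_parseval.
Qed.

Lemma dftD {R : realType} N (a b : nat -> R[i]) k :
  dft N (fun j => a j + b j) k = dft N a k + dft N b k.
Proof.
rewrite /dft -mulrDr -big_split /=; congr (_ * _).
by apply: eq_bigr => j _; rewrite mulrDl.
Qed.

Lemma dft2_alias {R : realType} N (a : nat -> nat -> R[i]) k l : (0 < N)%N ->
  dft2 N (fun i j => a i.*2 j.*2) k l =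
  (dft2 N.*2 a k l + dft2 N.*2 a k (l + N)) +
  (dft2 N.*2 a (k + N) l + dft2 N.*2 a (k + N) (l + N)).
Proof.
move=> N0; rewrite /dft2 (dft_alias (fun i => dft N (fun j => a i j.*2) l)) //.
have E m : dft N.*2 (fun i => dft N (fun j => a i j.*2) l) m =
   dft N.*2 (fun i => dft N.*2 (a i) l) m + dft N.*2 (fun i => dft N.*2 (a i) (l + N)%N) m.
  rewrite -dftD; congr (dft _ _ _); apply/funext => i.
  exact: dft_alias (a i) l N0.
by rewrite !E.
Qed.

(* The elementary form of Cauchy-Schwarz [sum x <= N d] for at most [N ^ 2] terms. *)
Lemma sum_le_square {R : realType} N (P : rel 'I_N) (x : 'I_N -> 'I_N -> R) (d : R) :
  (0 < N)%N -> 0 < d ->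
  \sum_(k < N) \sum_(l < N | P k l) x k l ^+ 2 <= d ^+ 2 ->
  \sum_(k < N) \sum_(l < N | P k l) x k l <= N%:R * d.
Proof.
move=> N0 d0 h; have NR : (0 : R) < N%:R by rewrite ltr0n.
apply: (@le_trans _ _ (\sum_(k < N) \sum_(l < N | P k l)
   (N%:R / (2 * d) * x k l ^+ 2) + \sum_(k < N) \sum_(l < N) (d / (2 * N%:R)))).
  rewrite -big_split /=; apply: ler_sum => k _.
  apply: (@le_trans _ _ (\sum_(l < N | P k l) (N%:R / (2 * d) * x k l ^+ 2) +
     \sum_(l < N | P k l) (d / (2 * N%:R)))).
    rewrite -big_split /=; apply: ler_sum => l _.
    have -> : N%:R / (2 * d) * x k l ^+ 2 + d / (2 * N%:R) =
       x k l + (N%:R * x k l - d) ^+ 2 / (2 * d * N%:R).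
      by field; rewrite !gt_eqF.
    by rewrite lerDl divr_ge0 ?sqr_ge0 // !mulr_ge0 // ltW.
  rewrite lerD2l [leRHS](bigID (P k)) /= lerDl sumr_ge0 // => l _.
  by rewrite divr_ge0 ?(ltW d0) // mulr_ge0 // ltW.
rewrite !sumr_const !card_ord.
under eq_bigr do rewrite -mulr_sumr.
rewrite -mulr_sumr; apply: (@le_trans _ _ (N%:R / (2 * d) * d ^+ 2 + d / (2 * N%:R) *+ N *+ N)).
  by rewrite lerD2r ler_wpM2l // divr_ge0 ?(ltW NR) // mulr_ge0 // ltW.
rewrite -(mulr_natr _ N) -(mulr_natr _ N) le_eqVlt; apply/orP; left; apply/eqP; field.
by rewrite !gt_eqF.
Qed.

(** * Trigonometric interpolation and absolutely convergent expansions *)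

(* A trigonometric polynomial with frequencies in [Z ^ 2]; [tnorm] is its norm
   in the Wiener algebra (an upper bound of it when frequencies are repeated). *)
Definition trig (R : realType) := seq (int * int * R[i]).

Definition tev {R : realType} (l : trig R) (x y : R) : R[i] :=
  \sum_(t <- l) t.2 * e2pi (t.1.1%:~R * x + t.1.2%:~R * y).

Definition tnorm {R : realType} (l : trig R) : R := \sum_(t <- l) nc t.2.

Lemma tnorm_ge0 {R : realType} (l : trig R) : 0 <= tnorm l.
Proof. by rewrite sumr_ge0 // => t _; exact: nc_ge0. Qed.

Lemma nc_tev {R : realType} (l : trig R) x y : nc (tev l x y) <= tnorm l.
Proof.
apply: (le_trans (nc_sum _ _ _)); apply: ler_sum => t _.
by rewrite ncM nc_ex mulr1.
Qed.

Lemma tev_cat {R : realType} (l l' : trig R) x y :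
  tev (l ++ l') x y = tev l x y + tev l' x y.
Proof. by rewrite /tev big_cat. Qed.

Lemma tnorm_cat {R : realType} (l l' : trig R) : tnorm (l ++ l') = tnorm l + tnorm l'.
Proof. by rewrite /tnorm big_cat. Qed.

(* The representative modulo [N] of smallest absolute value. Refining the grid
   from [N] to [2 N] points moves only the frequencies in [topfreq N], see
   [balanced_refine]. *)
Definition balanced (N k : nat) : int :=
  if (k.*2 < N)%N then k%:Z else k%:Z - N%:Z.

(** On the grid of size [2 N] these are the frequencies with [K / (2 N)] in [[1/4, 3/4)], the range
    of [ex_top]. *)
Definition topfreq (N K : nat) := (N <= K.*2)%N && (K.*2 < 3 * N)%N.

Lemma balanced_refine N K : (K < N.*2)%N -> ~~ topfreq N K ->
  balanced N.*2 K = balanced N (K %% N).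
Proof.
move=> K2; rewrite /topfreq negb_and -leqNgt -ltnNge /balanced => /orP[h|h].
  have -> : (K.*2 < N.*2)%N by rewrite ltn_double (leq_ltn_trans _ h) // -addnn leq_addr.
  by rewrite modn_small ?h // (leq_ltn_trans _ h) // -addnn leq_addr.
have NK : (N <= K)%N by rewrite -leq_double; apply: leq_trans h; rewrite -mul2n leq_mul2r orbT.
have -> : (K.*2 < N.*2)%N = false by rewrite ltn_double ltnNge NK.
have -> : (K %% N = K - N)%N.
  by rewrite -{1}(subnK NK) modnDr modn_small // ltn_subLR // addnn.
have -> : ((K - N).*2 < N)%N = false.
  by apply/negbTE; rewrite -leqNgt; lia.
by rewrite -subzn // -addnn PoszD; lia.
Qed.

Lemma ex_balanced {R : realType} N k i : (0 < N)%N ->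
  e2pi ((balanced N k)%:~R * (i%:R / N%:R) : R) = e2pi (k%:R * i%:R / N%:R).
Proof.
move=> N0; have NR : (N%:R : R) != 0 by rewrite pnatr_eq0 -lt0n.
rewrite /balanced; case: ifP => _; first by rewrite mulrA.
have -> : ((k%:Z - N%:Z)%:~R * (i%:R / N%:R) : R) = k%:R * i%:R / N%:R + - i%:R.
  by rewrite rmorphB /=; field.
by rewrite exD exN ex_nat invr1 mulr1.
Qed.

Section trig_interpolation.
Variables (R : realType) (U : R -> R -> R[i]).

Let grid N i j := U (i%:R / N%:R) (j%:R / N%:R).
Let coef N k l := dft2 N (grid N) k l.
Let mono N k l x y : R[i] :=
  e2pi ((balanced N k)%:~R * x + (balanced N l)%:~R * y).

Definition trig_interp N : trig R :=
  [seq ((balanced N (K.1 : 'I_N), balanced N (K.2 : 'I_N)), coef N K.1 K.2)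
  | K <- enum {: 'I_N * 'I_N}].

(* The difference of the interpolants on the grids of size [2 N] and [N]. Only
   top frequencies contribute, and second differences control their coefficients. *)
Definition trig_refine N : trig R := flatten
  [seq (if topfreq N (K.1 : 'I_N.*2) || topfreq N (K.2 : 'I_N.*2) then
    [:: ((balanced N.*2 K.1, balanced N.*2 K.2), coef N.*2 K.1 K.2);
        ((balanced N (K.1 %% N), balanced N (K.2 %% N)), - coef N.*2 K.1 K.2)]
    else [::]) | K <- enum {: 'I_N.*2 * 'I_N.*2}].

Lemma tev_interp N x y : tev (trig_interp N) x y =
  \sum_(k < N) \sum_(l < N) coef N k l * mono N k l x y.
Proof.
by rewrite /tev /trig_interp big_map big_enum pair_bigA.
Qed.

Lemma tnorm_interp N : tnorm (trig_interp N) =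
  \sum_(k < N) \sum_(l < N) nc (coef N k l).
Proof. by rewrite /tnorm /trig_interp big_map big_enum pair_bigA. Qed.

Lemma tev_interp_grid N i j : (i < N)%N -> (j < N)%N ->
  tev (trig_interp N) (i%:R / N%:R) (j%:R / N%:R) = U (i%:R / N%:R) (j%:R / N%:R).
Proof.
move=> iN jN; have N0 := leq_ltn_trans (leq0n i) iN.
rewrite tev_interp -[RHS](dft2_inv (grid N) iN jN).
apply: eq_bigr => k _; apply: eq_bigr => l _.
by rewrite /mono exD !ex_balanced.
Qed.

(** By aliasing, the coarse interpolant is the sum over the fine coefficients with frequencies
    reduced modulo [N]. By [balanced_refine] the terms that are not top frequencies then cancel
    against the fine interpolant. *)
Lemma tev_refine N x y : (0 < N)%N ->
  tev (trig_refine N) x y = tev (trig_interp N.*2) x y - tev (trig_interp N) x y.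
Proof.
move=> N0; rewrite /tev /trig_refine big_flatten big_map big_enum /= -/(tev _ x y) -/(tev _ x y).
rewrite !tev_interp.
rewrite -(pair_bigA _ (fun k l : 'I_N.*2 => \sum_(t <- if topfreq N k || topfreq N l then
    [:: ((balanced N.*2 k, balanced N.*2 l), coef N.*2 k l);
        ((balanced N (k %% N), balanced N (l %% N)), - coef N.*2 k l)]
    else [::]) t.2 * e2pi (t.1.1%:~R * x + t.1.2%:~R * y))) /=.
have -> : \sum_(k < N) \sum_(l < N) coef N k l * mono N k l x y =
  \sum_(K < N.*2) \sum_(L < N.*2) coef N.*2 K L * mono N (K %% N) (L %% N) x y.
  rewrite (sum_halves (fun K => \sum_(L < N.*2) coef N.*2 K L * mono N (K %% N) (L %% N) x y)).
  apply: eq_bigr => k _; rewrite -big_split /=.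
  rewrite (sum_halves (fun L => coef N.*2 k L * mono N (k %% N) (L %% N) x y +
     coef N.*2 (k + N) L * mono N ((k + N) %% N) (L %% N) x y)).
  apply: eq_bigr => l _; rewrite !modnDr !modn_small //.
  have -> : coef N k l = dft2 N (fun i j => grid N.*2 i.*2 j.*2) k l.
    congr (dft2 _ _ _ _); apply/funext => i; apply/funext => j.
    have half n : n.*2%:R / N.*2%:R = n%:R / N%:R :> R.
      by rewrite -!muln2 !natrM; field; rewrite pnatr_eq0 -lt0n.
    by rewrite /grid !half.
  by rewrite dft2_alias // -/(coef _ _ _); rewrite /coef; ring.
rewrite -sumrB; apply: eq_bigr => K _; rewrite -sumrB; apply: eq_bigr => L _.
case: ifPn => [_|].
  by rewrite !big_cons big_nil /= addr0 mulNr.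
rewrite negb_or big_nil => /andP[hK hL].
by rewrite /mono !balanced_refine ?subrr.
Qed.

Variables (e : R) (w : R -> R).
Hypothesis e0 : 0 < e.
Hypothesis w0 : forall h : R, 0 < h -> 0 < w h.
Hypothesis Ub : forall x y, nc (U x y) <= e.
Hypothesis U0 : forall x y, ~~ (4^-1 <= x <= 3 / 4) || ~~ (4^-1 <= y <= 3 / 4) ->
  U x y = 0.
Hypothesis U1 : forall h x y : R, 0 < h <= 1 ->
  nc (U (x + h + h) y - 2 * U (x + h) y + U x y) <= e * (h * w h).
Hypothesis U2 : forall h x y : R, 0 < h <= 1 ->
  nc (U x (y + h + h) - 2 * U x (y + h) + U x y) <= e * (h * w h).

Lemma tnorm_interp_le N : (0 < N)%N -> tnorm (trig_interp N) <= N%:R ^+ 2 * e.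
Proof.
move=> N0; rewrite tnorm_interp.
apply: (@le_trans _ _ (\sum_(k < N) \sum_(l < N) e)).
  apply: ler_sum => k _; apply: ler_sum => l _.
  by apply: nc_dft => // i; apply: nc_dft => // j; exact: Ub.
by rewrite !sumr_const !card_ord -mulrnA -[e *+ _]mulr_natl natrM expr2.
Qed.

(** Makes the samples periodic as far as second differences across the end of the grid can see. The
    condition [4 < N] places the grid point [1 / N] to the left of [1/4]. *)
Lemma grid_edge N i j : (4 < N)%N ->
  [|| i == 0%N, i == 1%N | (N <= i)%N] || [|| j == 0%N, j == 1%N | (N <= j)%N] ->
  grid N i j = 0.
Proof.
move=> N5 h; apply: U0.
have NR : (0 : R) < N%:R by rewrite ltr0n (ltn_trans _ N5).
have N5R : (4 : R) < N%:R by rewrite ltr_nat.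
have edge n : [|| n == 0%N, n == 1%N | (N <= n)%N] ->
    ~~ (4^-1 <= (n%:R / N%:R : R) <= 3 / 4).
  move=> /or3P[/eqP ->|/eqP ->|hn]; rewrite negb_and -!ltNge.
  - by rewrite mul0r invr_gt0 ltr0n.
  - by rewrite ltr_pdivrMr // ltr_pdivlMl // mulr1 N5R.
  - apply/orP; right; rewrite ltr_pdivlMr //.
    have : (N%:R : R) <= n%:R by rewrite ler_nat.
    by lra.
by case/orP: h => /edge ->; rewrite ?orbT.
Qed.

(** At top frequencies the squared multiplier has squared modulus at least 4, so Parseval bounds the
    [l^2] norm of [c] there by [d]. Passing to the [l^1] norm over at most [(2 N)^2] terms costs the
    factor [2 N]. *)
Lemma sum_topfreq N (c : nat -> nat -> R[i]) (g : nat -> nat -> R[i]) (d : R) :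
  (0 < N)%N -> 0 < d ->
  (forall k l, dft2 N.*2 g k l = (e2pi (k%:R / N.*2%:R) - 1) ^+ 2 * c k l) ->
  (forall i j, nc (g i j) <= 2 * d) ->
  \sum_(k < N.*2) \sum_(l < N.*2 | topfreq N k) nc (c k l) <= N.*2%:R * d.
Proof.
move=> N0 d0 hg gd; have M0 : (0 < N.*2)%N by rewrite double_gt0.
have MR : (0 : R) < N.*2%:R by rewrite ltr0n.
apply: (sum_le_square (P := fun k l => topfreq N k) (x := fun k l => nc (c k l))) => //.
have top2 k : topfreq N k -> 2 <= nc (e2pi (k%:R / N.*2%:R : R) - 1) ^+ 2.
  move=> /andP[h1 h2]; apply: ex_top; have NR : (0 : R) < N%:R by rewrite ltr0n.
  rewrite -muln2 natrM ler_pdivlMr ?mulr_gt0 // ler_pdivrMr ?mulr_gt0 //.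
  have : (N%:R : R) <= k.*2%:R by rewrite ler_nat.
  have : (k.*2%:R : R) <= (3 * N)%:R by rewrite ler_nat ltnW.
  by rewrite natrM -muln2 natrM => ? ?; apply/andP; split; lra.
rewrite -(ler_pM2l (x := 4)) //.
have -> : 4 * d ^+ 2 = (2 * d) ^+ 2 by ring.
apply: (@le_trans _ _ (\sum_(k < N.*2) \sum_(l < N.*2) nc (dft2 N.*2 g k l) ^+ 2)).
  rewrite mulr_sumr; apply: ler_sum => k _.
  rewrite mulr_sumr [leRHS](bigID (fun=> topfreq N k)) /=.
  rewrite -[leLHS]addr0; apply: lerD; last by apply: sumr_ge0 => l _; exact: sqr_ge0.
  apply: ler_sum => l /andP[h1 h2]; rewrite hg ncM exprMn ler_wpM2r ?sqr_ge0 //.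
  have : 2 <= nc (e2pi ((k : nat)%:R / N.*2%:R : R) - 1) ^+ 2 by apply: top2; rewrite /topfreq h1.
  by rewrite ncX; have := nc_ge0 (e2pi ((k : nat)%:R / N.*2%:R : R) - 1); nra.
rewrite dft2_parseval //.
apply: (@le_trans _ _ (N.*2%:R^-1 * (N.*2%:R^-1 *
    \sum_(i < N.*2) \sum_(j < N.*2) (2 * d) ^+ 2))).
  rewrite !ler_wpM2l ?invr_ge0 //; apply: ler_sum => i _; apply: ler_sum => j _.
  by rewrite lerXn2r ?nnegrE ?nc_ge0 // mulr_ge0 // ltW.
rewrite !sumr_const !card_ord; set c2 := (2 * d) ^+ 2.
have -> : c2 *+ N.*2 *+ N.*2 = N.*2%:R * (N.*2%:R * c2) by rewrite !mulr_natl.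
by rewrite !mulKf ?gt_eqF.
Qed.

(** The factor [2 N] lost in [sum_topfreq] is paid by the factor [h = 1 / (2 N)] of the second
    differences, which leaves only the modulus [w]. Top frequencies in either variable are counted,
    and each coefficient occurs twice in [trig_refine]. *)
Lemma tnorm_refine_le N : (4 < N)%N ->
  tnorm (trig_refine N) <= 2 * e * w (N.*2%:R^-1).
Proof.
move=> N5; have N0 : (0 < N)%N by rewrite (ltn_trans _ N5).
have M5 : (4 < N.*2)%N by rewrite (leq_trans N5) // -addnn leq_addr.
have M0 : (0 < N.*2)%N by rewrite double_gt0.
have MR : (0 : R) < N.*2%:R by rewrite ltr0n.
set h := N.*2%:R^-1.
have h01 : 0 < h <= 1 by rewrite invr_gt0 MR invf_le1 // ler1n.
have h0 : 0 < h by case/andP: h01.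
have hw := w0 h0.
pose d := e * (h * w h) / 2.
have d0 : 0 < d by rewrite divr_gt0 // mulr_gt0 // mulr_gt0.
have step (i : nat) : (i.+1%:R / N.*2%:R : R) = i%:R / N.*2%:R + h.
  by rewrite -addn1 natrD mulrDl mul1r.
have d2 : e * (h * w h) = 2 * d by rewrite /d; field.
have T1 : \sum_(k < N.*2) \sum_(l < N.*2 | topfreq N k) nc (coef N.*2 k l) <= N.*2%:R * d.
  apply: (sum_topfreq (g := fun i j => grid N.*2 i.+2 j - 2 * grid N.*2 i.+1 j + grid N.*2 i j)) => //.
    move=> k l; rewrite /coef /dft2.
    rewrite -(@dft_diff2 R N.*2 (fun i => dft N.*2 (grid N.*2 i) l) k) //.
    - by congr (dft _ _ _); apply/funext => i; rewrite dft_lin.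
    - by congr (dft _ _ _); apply/funext => i; rewrite !grid_edge ?leqnn ?orbT.
    - by congr (dft _ _ _); apply/funext => i; rewrite !grid_edge ?leqnSn ?orbT.
  by move=> i j; rewrite /grid !step -d2; apply: U1.
have T2 : \sum_(l < N.*2) \sum_(k < N.*2 | topfreq N l) nc (coef N.*2 k l) <= N.*2%:R * d.
  apply: (sum_topfreq (c := fun l k => coef N.*2 k l)
    (g := fun j i => grid N.*2 i j.+2 - 2 * grid N.*2 i j.+1 + grid N.*2 i j)) => //.
    move=> l k; rewrite /coef [dft2 _ (grid _) _ _]dft_exch /dft2.
    rewrite -(@dft_diff2 R N.*2 (fun j => dft N.*2 (fun i => grid N.*2 i j) k) l) //.
    - by congr (dft _ _ _); apply/funext => i; rewrite dft_lin.
    - by congr (dft _ _ _); apply/funext => i; rewrite !grid_edge ?leqnn ?orbT.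
    - by congr (dft _ _ _); apply/funext => i; rewrite !grid_edge ?leqnSn ?orbT.
  by move=> i j; rewrite /grid !step -d2; apply: U2.
have -> : 2 * e * w h = 2 * (N.*2%:R * d + N.*2%:R * d).
  by rewrite /d /h; field; rewrite gt_eqF.
apply: (@le_trans _ _ (2 * (\sum_(k < N.*2) \sum_(l < N.*2 | topfreq N k) nc (coef N.*2 k l) +
   \sum_(l < N.*2) \sum_(k < N.*2 | topfreq N l) nc (coef N.*2 k l)))); last first.
  by rewrite ler_wpM2l // lerD.
rewrite /tnorm /trig_refine big_flatten big_map big_enum /=.
rewrite -(pair_bigA _ (fun k l : 'I_N.*2 => \sum_(t <- if topfreq N k || topfreq N l then
    [:: ((balanced N.*2 k, balanced N.*2 l), coef N.*2 k l);
        ((balanced N (k %% N), balanced N (l %% N)), - coef N.*2 k l)]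
    else [::]) nc t.2)) /=.
rewrite mulrDr; have -> : \sum_(l < N.*2) \sum_(k < N.*2 | topfreq N l) nc (coef N.*2 k l) =
  \sum_(k < N.*2) \sum_(l < N.*2 | topfreq N l) nc (coef N.*2 k l).
  by rewrite (exchange_big_dep xpredT).
rewrite !mulr_sumr -big_split /=; apply: ler_sum => k _.
rewrite (big_mkcond (fun=> topfreq N k)) (big_mkcond (fun l : 'I_N.*2 => topfreq N l)) /=.
rewrite !mulr_sumr -big_split /=; apply: ler_sum => l _.
have n0 := nc_ge0 (coef N.*2 k l).
case: (topfreq N k); case: (topfreq N l); rewrite /= ?big_cons ?big_nil /= ?ncN; lra.
Qed.

End trig_interpolation.

(** The interpolants on the grids of size [8 * 2^n] are written as a telescoping sum, so a partial
    sum is exact on its grid and on every coarser one. The size 8 exceeds the 4 of [grid_edge], and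
    [64 * e] is the trivial bound [N^2 * e] of the first interpolant. *)
Lemma trig_grid_expansion {R : realType} (U : R -> R -> R[i]) (e b : R) :
  0 < e -> 0 < b ->
  (forall x y, nc (U x y) <= e) ->
  (forall x y, ~~ (4^-1 <= x <= 3 / 4) || ~~ (4^-1 <= y <= 3 / 4) -> U x y = 0) ->
  (forall h x y : R, 0 < h <= 1 ->
    nc (U (x + h + h) y - 2 * U (x + h) y + U x y) <= e * (h * h `^ b)) ->
  (forall h x y : R, 0 < h <= 1 ->
    nc (U x (y + h + h) - 2 * U x (y + h) + U x y) <= e * (h * h `^ b)) ->
  exists D : nat -> trig R,
    (forall n, tnorm (D n) <= 64 * e * (2^-1 `^ b) ^+ n) /\
    forall m i j n, (i < 8 * 2 ^ m)%N -> (j < 8 * 2 ^ m)%N -> (m <= n)%N ->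
      \sum_(l < n.+1) tev (D l) (i%:R / (8 * 2 ^ m)%:R) (j%:R / (8 * 2 ^ m)%:R) =
      U (i%:R / (8 * 2 ^ m)%:R) (j%:R / (8 * 2 ^ m)%:R).
Proof.
move=> e0 b0 Ub U0 U1 U2.
have P0 n : (0 < 8 * 2 ^ n)%N by rewrite muln_gt0 expn_gt0.
have P4 n : (4 < 8 * 2 ^ n)%N.
  by apply: (@leq_trans (8 * 1)%N) => //; rewrite leq_pmul2l // expn_gt0.
have PS n : (8 * 2 ^ n.+1 = (8 * 2 ^ n).*2)%N by rewrite expnS -muln2 mulnCA mulnC.
pose D n := if n is n'.+1 then trig_refine U (8 * 2 ^ n') else trig_interp U (8 * 2 ^ 0).
have DE n x y : \sum_(l < n.+1) tev (D l) x y = tev (trig_interp U (8 * 2 ^ n)) x y.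
  elim: n => [|n ih]; first by rewrite big_ord1.
  by rewrite big_ord_recr /= ih tev_refine // PS addrC subrK.
exists D; split.
  case=> [|n].
    rewrite expr0 mulr1 /D; apply: (le_trans (tnorm_interp_le Ub (P0 0%N))).
    by rewrite le_eqVlt; apply/orP; left; apply/eqP; rewrite muln1; ring.
  rewrite /D; apply: (le_trans (tnorm_refine_le e0 (w := fun h => h `^ b) _ U0 U1 U2 (P4 n))).
    by move=> h h0; exact: powR_gt0.
  apply: ler_pM; rewrite ?powR_ge0 ?mulr_ge0 ?(ltW e0) //; first by rewrite ler_wpM2r ?(ltW e0) // ler_nat.
  rewrite -powR_mulrn ?powR_ge0 // -powRrM mulrC powRrM powR_mulrn ?invr_ge0 //.
  apply: ge0_ler_powR; rewrite ?nnegrE ?invr_ge0 ?exprn_ge0 ?invr_ge0 ?(ltW b0) //.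
  rewrite -PS exprVn lef_pV2 ?posrE ?exprn_gt0 ?ltr0n ?P0 //.
  by rewrite natrM natrX ler_peMl ?exprn_ge0 // ler1n.
move=> m i j n im jm mn; rewrite DE.
have cancel k a c : (0 < a)%N -> (k * a)%:R / (a * c)%:R = k%:R / c%:R :> R.
  by move=> a0; rewrite !natrM invfM mulrA mulfK // pnatr_eq0 -lt0n.
have nE : (8 * 2 ^ n = 2 ^ (n - m) * (8 * 2 ^ m))%N.
  by rewrite -[in LHS](subnK mn) expnD mulnCA.
have E k : k%:R / (8 * 2 ^ m)%:R = (k * 2 ^ (n - m))%:R / (8 * 2 ^ n)%:R :> R.
  by rewrite nE cancel // expn_gt0.
rewrite (E i) (E j).
have lt i' : (i' < 8 * 2 ^ m)%N -> (i' * 2 ^ (n - m) < 8 * 2 ^ n)%N.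
  by move=> h; rewrite -[in X in (_ < X)%N](subnK mn) addnC expnD mulnA ltn_pmul2r // expn_gt0.
by rewrite tev_interp_grid ?lt.
Qed.

Lemma ex_lip {R : realType} (s t : R) : nc (e2pi s - e2pi t) <= 2 * (2 * pi * `|s - t|).
Proof.
have -> : e2pi s - e2pi t = e2pi t * (e2pi (s - t) - 1).
  by rewrite mulrBr mulr1 -exD (addrC t) subrK.
rewrite ncM nc_ex mul1r /e2pi (le_trans (cis_bound _)) // ler_wpM2l //.
by rewrite normrM ger0_norm // mulr_ge0 // pi_ge0.
Qed.

Lemma tev_lip {R : realType} (l : trig R) : exists2 C, 0 <= C &
  forall x y x' y', nc (tev l x' y' - tev l x y) <= C * (`|x' - x| + `|y' - y|).
Proof.
have p0 := @pi_ge0 R.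
elim: l => [|t l [C C0 ih]].
  by exists 0 => // x y x' y'; rewrite /tev !big_nil subrr nc0 mul0r.
pose K := nc t.2 * (2 * (2 * pi * (`|t.1.1%:~R| + `|t.1.2%:~R|))).
have K0 : 0 <= K.
  by rewrite mulr_ge0 ?nc_ge0 // mulr_ge0 // mulr_ge0 ?mulr_ge0 // addr_ge0.
exists (K + C); first by rewrite addr_ge0.
move=> x y x' y'; rewrite /tev !big_cons -!/(tev _ _ _) opprD addrACA.
apply: (le_trans (ncD _ _)); rewrite mulrDl; apply: lerD; last exact: ih.
rewrite -mulrBr ncM /K -[leRHS]mulrA ler_wpM2l ?nc_ge0 //.
rewrite (le_trans (ex_lip _ _)) // -[leRHS]mulrA ler_wpM2l //.
rewrite -[leRHS]mulrA ler_wpM2l ?mulr_ge0 //.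
have -> : t.1.1%:~R * x' + t.1.2%:~R * y' - (t.1.1%:~R * x + t.1.2%:~R * y) =
  t.1.1%:~R * (x' - x) + t.1.2%:~R * (y' - y) by ring.
apply: (le_trans (ler_normD _ _)); rewrite !normrM mulrDl.
by apply: lerD; rewrite ler_wpM2l // ?lerDl ?lerDr.
Qed.

Lemma dyadic_near {R : realType} (x d : R) : 0 <= x < 1 -> 0 < d ->
  exists m0, forall m, (m0 <= m)%N -> exists2 i, (i < 8 * 2 ^ m)%N &
    `|x - i%:R / (8 * 2 ^ m)%:R| <= d.
Proof.
move=> /andP[x0 x1] d0.
have half01 : 0 <= (2^-1 : R) < 1 by apply/andP; split; lra.
have [m0 hm0] := geo_small 1 half01 d0.
exists m0 => m /hm0; rewrite mul1r => hm.
have MR : (0 : R) < (8 * 2 ^ m)%:R by rewrite ltr0n muln_gt0 expn_gt0.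
have y0 : 0 <= x * (8 * 2 ^ m)%:R by rewrite mulr_ge0 // ltW.
have /andP[t1 t2] := truncn_itv y0.
exists (Num.truncn (x * (8 * 2 ^ m)%:R)).
  by rewrite -(ltr_nat R) (le_lt_trans t1) // gtr_pMl.
set i := Num.truncn _ in t1 t2 *.
have -> : x - i%:R / (8 * 2 ^ m)%:R = (x * (8 * 2 ^ m)%:R - i%:R) / (8 * 2 ^ m)%:R.
  by rewrite mulrBl mulfK ?gt_eqF.
rewrite normrM ger0_norm ?subr_ge0 // gtr0_norm ?invr_gt0 // ler_pdivrMr //.
apply: (@le_trans _ _ 1); first by move: t2; rewrite -addn1 natrD; lra.
apply: (@le_trans _ _ (2^-1 ^+ m * (8 * 2 ^ m)%:R)); last by rewrite ler_wpM2r // ltW.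
by rewrite natrM natrX mulrCA exprVn mulVf ?mulr1 ?ler1n // expf_neq0.
Qed.

(** From grid points to all points by density: the partial sums converge uniformly and are
    Lipschitz, and so is [U]. The Lipschitz constant of a partial sum depends on [n], so the nearby
    grid point is chosen after [n]. *)
Lemma trig_expansion {R : realType} (U : R -> R -> R[i]) (e b L : R) :
  0 < e -> 0 < b ->
  (forall x y, nc (U x y) <= e) ->
  (forall x y, ~~ (4^-1 <= x <= 3 / 4) || ~~ (4^-1 <= y <= 3 / 4) -> U x y = 0) ->
  (forall h x y : R, 0 < h <= 1 ->
    nc (U (x + h + h) y - 2 * U (x + h) y + U x y) <= e * (h * h `^ b)) ->
  (forall h x y : R, 0 < h <= 1 ->
    nc (U x (y + h + h) - 2 * U x (y + h) + U x y) <= e * (h * h `^ b)) ->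
  (forall x y x' y', nc (U x' y' - U x y) <= L * (`|x' - x| + `|y' - y|)) ->
  exists D : nat -> trig R,
    (forall n, tnorm (D n) <= 64 * e * (2^-1 `^ b) ^+ n) /\
    forall x y : R, 0 <= x < 1 -> 0 <= y < 1 -> forall r : R, 0 < r ->
      exists n0, forall n, (n0 <= n)%N ->
      nc (\sum_(l < n.+1) tev (D l) x y - U x y) <= r.
Proof.
move=> e0 b0 Ub U0 U1 U2 UL.
have [D [D1 D2]] := trig_grid_expansion e0 b0 Ub U0 U1 U2.
exists D; split=> // x y x01 y01 r r0.
set q := 2^-1 `^ b in D1.
have q01 : 0 <= q < 1.
  rewrite powR_ge0 /=; have -> : 1 = 1 `^ b by rewrite powR1.
  by rewrite gt0_ltr_powR ?nnegrE ?invr_ge0 // invf_lt1 // ltr1n.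
pose S n x y : R[i] := \sum_(l < n.+1) tev (D l) x y.
have SS x' y' n : nc (S n.+1 x' y' - S n x' y') <= 64 * e * q * q ^+ n.
  rewrite /S big_ord_recr /= addrAC subrr add0r (le_trans (nc_tev _ _ _)) //.
  by rewrite (le_trans (D1 _)) // exprS mulrA.
pose C := 2 * (64 * e * q) / (1 - q).
have r4 : 0 < r / 4 by lra.
have [n0 hn0] := geo_small C q01 r4.
have SC x' y' n k : (n0 <= n)%N -> nc (S (n + k)%N x' y' - S n x' y') <= r / 2.
  move=> nn0; have [l hl] := @geo_cauchy R (fun n => S n x' y') _ _ q01 (SS x' y').
  apply: (le_trans (nc_trans l _ _)); rewrite [nc (l - _)]ncC.
  have := hl n; have := hl (n + k)%N; have := hn0 n nn0.
  have := hn0 (n + k)%N (leq_trans nn0 (leq_addr _ _)); rewrite -/C; lra.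
exists n0 => n nn0; rewrite -/(S n x y).
have SnL : exists2 B, 0 <= B & forall x y x' y',
    nc (S n x' y' - S n x y) <= B * (`|x' - x| + `|y' - y|).
  rewrite /S; elim: n.+1 => [|m [B B0 ih]].
    by exists 0 => // *; rewrite !big_ord0 subrr nc0 mul0r.
  have [B' B'0 h] := tev_lip (D m).
  exists (B + B'); first by rewrite addr_ge0.
  move=> x1 y1 x2 y2; rewrite !big_ord_recr /= opprD addrACA mulrDl.
  by apply: (le_trans (ncD _ _)); exact: lerD.
have [B B0 SB] := SnL.
pose d := r / 4 / (B + `|L| + 1) / 2.
have BL0 : 0 < B + `|L| + 1 by rewrite ltr_wpDl // addr_ge0.
have d0 : 0 < d by rewrite !divr_gt0.
have [m1 hm1] := dyadic_near x01 d0; have [m2 hm2] := dyadic_near y01 d0.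
(* Fine enough to approximate both coordinates, and at least [n], so that [S m] is compared with
   [S n] and agrees with [U] at the grid point. *)
pose m := maxn n (maxn m1 m2).
have [|i im xi] := hm1 m; first by rewrite !leq_max leqnn !orbT.
have [|j jm yj] := hm2 m; first by rewrite !leq_max leqnn !orbT.
set x' := i%:R / _ in xi; set y' := j%:R / _ in yj.
have nm : (n <= m)%N by rewrite leq_max leqnn.
have Sm : S m x' y' = U x' y' by apply: D2.
have h1 := SC x' y' n (m - n)%N nn0; rewrite subnKC // Sm in h1.
have h2 := SB x' y' x y; have h3 := UL x y x' y'.
have h4 : `|x - x'| + `|y - y'| <= 2 * d by lra.
have h5 : (B + `|L|) * (2 * d) <= r / 4.
  have -> : r / 4 = (B + `|L| + 1) * (2 * d) by rewrite /d; field; rewrite gt_eqF.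
  by rewrite ler_wpM2r ?lerDl // mulr_ge0 // ltW.
have h6 : B * (`|x - x'| + `|y - y'|) <= B * (2 * d) by rewrite ler_wpM2l.
have h7 : L * (`|x' - x| + `|y' - y|) <= `|L| * (2 * d).
  rewrite (distrC x') (distrC y') (le_trans (ler_wpM2r _ (ler_norm L))) ?addr_ge0 //.
  by rewrite ler_wpM2l.
apply: (le_trans (nc_trans (S n x' y') _ _)).
apply: (le_trans (lerD (lexx _) (nc_trans (U x' y') _ _))).
rewrite [nc (S n x' y' - _)]ncC; lra.
Qed.

(** * The Beltrami equation with constant coefficient and a source term *)

Section beltrami.
Variables (R : realType) (tau : R[i]).
Hypothesis tau_gt0 : 0 < complex.Im tau.

Let kap := (complex.Im tau)^-1.

Let kap_gt0 : 0 < kap. Proof. by rewrite invr_gt0. Qed.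

(* [bel_op] is the Fourier multiplier [d_x (d_y - tau d_x)^-1], bounded because
   [Im tau > 0]. *)
Definition bel_den (k : int * int) : R[i] :=
  (k.2%:~R : R)%:C - tau * (k.1%:~R : R)%:C.

(** At the zero frequency the quotient is 0, by the convention for the inverse of 0. This is
    consistent with [bel_prim1], where the constant mode contributes a multiple of [y], whose
    [x]-derivative is 0. *)
Definition bel_mult (k : int * int) : R[i] := (k.1%:~R : R)%:C / bel_den k.

Lemma Im_mul_real (z : R[i]) (x : R) : complex.Im (z * x%:C) = complex.Im z * x.
Proof. by case: z => a b /=; rewrite mulr0 add0r. Qed.

(** The imaginary part of [bel_den k] is [- Im tau * k.1]: the ellipticity [Im tau > 0] keeps the
    denominator away from 0. *)
Lemma bel_den1 k : `|k.1%:~R| <= kap * nc (bel_den k).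
Proof.
rewrite /kap mulrC ler_pdivlMr //.
apply: le_trans (nc_Im _); rewrite /bel_den ImB Im_mul_real /= sub0r normrN normrM.
by rewrite mulrC (gtr0_norm tau_gt0).
Qed.

Lemma bel_den2 k : `|k.2%:~R| <= (1 + nc tau * kap) * nc (bel_den k).
Proof.
rewrite -nc_real -[X in nc X](subrK (tau * (k.1%:~R : R)%:C)) -/(bel_den k).
apply: (le_trans (ncD _ _)); rewrite mulrDl mul1r lerD2l ncM nc_real -mulrA.
by rewrite ler_wpM2l ?nc_ge0 ?bel_den1.
Qed.

Lemma bel_den_neq0 k : k != (0, 0) -> bel_den k != 0.
Proof.
apply: contra_neq => h; have := bel_den1 k; have := bel_den2 k.
rewrite h nc0 !mulr0 !normr_le0 !intr_eq0 => /eqP + /eqP.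
by case: k {h} => a b /= -> ->.
Qed.

Lemma nc_bel_mult k : nc (bel_mult k) <= kap.
Proof.
rewrite ncM ncV nc_real.
have [->|d0] := eqVneq (bel_den k) 0; first by rewrite nc0 invr0 mulr0 ltW.
by rewrite ler_pdivrMr ?nc_gt0 // bel_den1.
Qed.

Definition bel_op (l : trig R) : trig R := [seq (t.1, bel_mult t.1 * t.2) | t <- l].

Definition tmul (l l' : trig R) : trig R :=
  [seq ((t.1.1 + s.1.1, t.1.2 + s.1.2), t.2 * s.2) | t <- l, s <- l'].

Lemma tev_mul l l' x y : tev (tmul l l') x y = tev l x y * tev l' x y.
Proof.
rewrite /tev /tmul big_allpairs_dep mulr_suml; apply: eq_bigr => t _.
rewrite mulr_sumr; apply: eq_bigr => s _ /=.
have -> : (t.1.1 + s.1.1)%:~R * x + (t.1.2 + s.1.2)%:~R * y =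
  (t.1.1%:~R * x + t.1.2%:~R * y) + (s.1.1%:~R * x + s.1.2%:~R * y) :> R.
  by rewrite !intrD; ring.
by rewrite exD; ring.
Qed.

Lemma tnorm_mul l l' : tnorm (tmul l l') = tnorm l * tnorm l'.
Proof.
rewrite /tnorm /tmul big_allpairs_dep mulr_suml; apply: eq_bigr => t _.
by rewrite mulr_sumr; apply: eq_bigr => s _ /=; rewrite ncM.
Qed.

Lemma tnorm_bel_op l : tnorm (bel_op l) <= kap * tnorm l.
Proof.
rewrite /tnorm /bel_op big_map mulr_sumr; apply: ler_sum => t _ /=.
by rewrite ncM ler_wpM2r ?nc_ge0 ?nc_bel_mult.
Qed.

Lemma tev_bel_op_cat l l' x y :
  tev (bel_op (l ++ l')) x y = tev (bel_op l) x y + tev (bel_op l') x y.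
Proof. by rewrite /bel_op map_cat tev_cat. Qed.

(* [bel_prim l] solves [w_x = tev (bel_op l)] and [w_y = tau w_x + tev l]. *)
Definition bel_prim1 (t : int * int * R[i]) (x y : R) : R[i] :=
  if t.1 == (0, 0) then t.2 * y%:C else
  t.2 / ((2 * pi)%:C * 'i * bel_den t.1) * (e2pi (t.1.1%:~R * x + t.1.2%:~R * y) - 1).

Definition bel_prim (l : trig R) (x y : R) : R[i] := \sum_(t <- l) bel_prim1 t x y.

(** The bounds of [k.1 / bel_den k] and [k.2 / bel_den k] from [bel_den1] and [bel_den2], added, and
    doubled for the constant of [cis_bound]. *)
Definition bel_lip : R := 2 * (kap + 1 + nc tau * kap).

Lemma nc_2pi : nc ((2 * pi : R)%:C * 'i) = 2 * pi.
Proof. by rewrite ncM nc_real nc_i mulr1 ger0_norm // mulr_ge0 // pi_ge0. Qed.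

Lemma pi2_gt0 : 0 < 2 * pi :> R.
Proof. by rewrite mulr_gt0 // pi_gt0. Qed.

Lemma bel_lip_ge1 : 1 <= bel_lip.
Proof.
have : 0 <= nc tau * kap by rewrite mulr_ge0 ?nc_ge0 // ltW.
by rewrite /bel_lip; have := kap_gt0; lra.
Qed.

Lemma bel_prim1_lip t x y x' y' :
  nc (bel_prim1 t x' y' - bel_prim1 t x y) <= bel_lip * nc t.2 * (`|x' - x| + `|y' - y|).
Proof.
rewrite /bel_prim1; case: ifPn => [_|t0].
  rewrite -mulrBr -rmorphB ncM nc_real [bel_lip * _]mulrC -[leRHS]mulrA.
  rewrite ler_wpM2l ?nc_ge0 // -[leLHS]mul1r ler_pM ?lerDr //.
  exact: bel_lip_ge1.
have d0 := nc_gt0 (bel_den_neq0 t0).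
have p0 := pi2_gt0.
rewrite -mulrBr opprB addrA subrK ncM ncM ncV ncM nc_2pi.
apply: (le_trans (ler_wpM2l _ (ex_lip _ _))).
  by rewrite divr_ge0 ?nc_ge0 // mulr_ge0 // ltW.
have -> : t.1.1%:~R * x' + t.1.2%:~R * y' - (t.1.1%:~R * x + t.1.2%:~R * y) =
  t.1.1%:~R * (x' - x) + t.1.2%:~R * (y' - y) by ring.
set th := `|_ + _|.
have -> : nc t.2 / (2 * pi * nc (bel_den t.1)) * (2 * (2 * pi * th)) =
  nc t.2 * (2 * th / nc (bel_den t.1)).
  set P : R := 2 * pi in p0 *; set D := nc (bel_den _) in d0 *.
  by field; rewrite !gt_eqF.
rewrite -[leRHS]mulrA [leRHS]mulrCA ler_wpM2l ?nc_ge0 // ler_pdivrMr //.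
rewrite /bel_lip -!mulrA ler_wpM2l // mulrA /th.
apply: (le_trans (ler_normD _ _)); rewrite !normrM.
have h1 := bel_den1 t.1; have h2 := bel_den2 t.1.
have e1 : `|t.1.1%:~R| * `|x' - x| <= kap * nc (bel_den t.1) * `|x' - x| by rewrite ler_wpM2r.
have e2 : `|t.1.2%:~R| * `|y' - y| <= (1 + nc tau * kap) * nc (bel_den t.1) * `|y' - y|.
  by rewrite ler_wpM2r.
have k0 := ltW kap_gt0.
have z1 : 0 <= (1 + nc tau * kap) * nc (bel_den t.1) * `|x' - x|.
  by rewrite !mulr_ge0 ?nc_ge0 // addr_ge0 // mulr_ge0 ?nc_ge0.
have z2 : 0 <= kap * nc (bel_den t.1) * `|y' - y|.
  by rewrite !mulr_ge0 ?nc_ge0.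
by nra.
Qed.

Lemma bel_prim_lip l x y x' y' :
  nc (bel_prim l x' y' - bel_prim l x y) <= bel_lip * tnorm l * (`|x' - x| + `|y' - y|).
Proof.
rewrite /bel_prim /tnorm -sumrB mulr_sumr mulr_suml (le_trans (nc_sum _ _ _)) //.
by apply: ler_sum => t _; exact: bel_prim1_lip.
Qed.

(** The constant depends on the frequency and is not controlled by [tnorm]. The quadratic estimate
    is therefore applied later to one fixed iterate only, the rest being handled by the Lipschitz
    bound. *)
Lemma bel_prim1_diff t : exists2 C, 0 <= C & forall x y a b,
  nc (bel_prim1 t (x + a) (y + b) - bel_prim1 t x y -
    (tev (bel_op [:: t]) x y * a%:C +
     (tau * tev (bel_op [:: t]) x y + tev [:: t] x y) * b%:C)) <=
  C * (`|a| + `|b|) ^+ 2.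
Proof.
rewrite /tev /bel_op /=; have p0 := pi2_gt0.
have [t0|t0] := eqVneq t.1 (0, 0).
  exists 0 => // x y a b; rewrite !big_seq1 /bel_prim1 t0 eqxx /bel_mult /=.
  rewrite !mulr0z !mul0r addr0 ex0 !mulr1 !(mul0r, mulr0, add0r).
  by rewrite rmorphD [X in nc X](_ : _ = 0) ?nc0 //=; ring.
have d0 := nc_gt0 (bel_den_neq0 t0).
pose c : R[i] := t.2 / ((2 * pi)%:C * 'i * bel_den t.1).
exists (nc c * (2 * (2 * pi * (`|t.1.1%:~R| + `|t.1.2%:~R|)) ^+ 2)).
  by rewrite mulr_ge0 ?nc_ge0 // mulr_ge0 // sqr_ge0.
move=> x y a b; rewrite !big_seq1 /bel_prim1 (negPf t0) -/c /=.
set E : R[i] := e2pi (t.1.1%:~R * x + t.1.2%:~R * y).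
pose th : R := t.1.1%:~R * a + t.1.2%:~R * b.
have -> : e2pi (t.1.1%:~R * (x + a) + t.1.2%:~R * (y + b)) = E * e2pi th.
  by rewrite -exD; congr e2pi; rewrite /th; ring.
have -> : c * (E * e2pi th - 1) - c * (E - 1) -
   (bel_mult t.1 * t.2 * E * a%:C + (tau * (bel_mult t.1 * t.2 * E) + t.2 * E) * b%:C) =
   c * (E * (e2pi th - 1 - (2 * pi * th)%:C * 'i)).
  have i0 : (2 * pi : R)%:C * 'i != 0.
    by apply/eqP => h; have := nc_2pi; rewrite h nc0 => h'; rewrite -h' ltxx in p0.
  have dE : (t.1.2%:~R : R)%:C = bel_den t.1 + tau * (t.1.1%:~R : R)%:C by rewrite subrK.
  have -> : (2 * pi * th)%:C * 'i = ((2 * pi)%:C * 'i) *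
      ((t.1.1%:~R : R)%:C * a%:C + (t.1.2%:~R : R)%:C * b%:C) :> R[i].
    by rewrite /th !(rmorphM, rmorphD) /=; ring.
  rewrite dE /c /bel_mult; move: (bel_den_neq0 t0) i0.
  set D := bel_den t.1; set P : R[i] := _ * 'i => D0 i0; field.
  by rewrite D0 i0.
rewrite ncM -[leRHS]mulrA ler_wpM2l ?nc_ge0 // ncM /E nc_ex mul1r /e2pi.
apply: (le_trans (cis_bound2 _)); rewrite -[leRHS]mulrA ler_wpM2l //.
rewrite normrM (gtr0_norm p0) -exprMn.
have thb : `|th| <= (`|t.1.1%:~R| + `|t.1.2%:~R|) * (`|a| + `|b|).
  rewrite (le_trans (ler_normD _ _)) // !normrM mulrDl.
  by apply: lerD; rewrite ler_wpM2l // ?lerDl ?lerDr.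
move: (2 * pi) p0 => P p0.
apply: lerXn2r; rewrite ?nnegrE ?mulr_ge0 ?addr_ge0 ?(ltW p0) //.
by rewrite -[leRHS]mulrA ler_wpM2l ?(ltW p0).
Qed.

Lemma bel_prim_diff l : exists2 C, 0 <= C & forall x y a b,
  nc (bel_prim l (x + a) (y + b) - bel_prim l x y -
    (tev (bel_op l) x y * a%:C +
     (tau * tev (bel_op l) x y + tev l x y) * b%:C)) <=
  C * (`|a| + `|b|) ^+ 2.
Proof.
elim: l => [|t l [C C0 ih]].
  exists 0 => // x y a b; rewrite /bel_prim /tev /bel_op /= !big_nil.
  by rewrite [X in nc X](_ : _ = 0) ?nc0 ?mul0r //; ring.
have [C' C'0 h] := bel_prim1_diff t.
exists (C' + C); first by rewrite addr_ge0.
move=> x y a b; rewrite [leRHS]mulrDl.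
rewrite (le_trans _ (lerD (h x y a b) (ih x y a b))) //.
rewrite (le_trans _ (ncD _ _)) // le_eqVlt; apply/orP; left; apply/eqP; congr nc.
rewrite -cat1s tev_bel_op_cat tev_cat /bel_prim !big_cat /= !big_seq1.
ring.
Qed.

End beltrami.

(** A crude rate [C] is enough to identify the limit; the increments then supply a better rate. In
    [w_diff] the crude constant depends on the point, whereas the increments are proportional to the
    displacement. *)
Lemma geo_lim {R : realType} (z : nat -> R[i]) (l : R[i]) (c C q : R) :
  0 <= q < 1 -> (forall n, nc (z n.+1 - z n) <= c * q ^+ n) ->
  (forall n, nc (z n - l) <= C * q ^+ n) ->
  forall n, nc (z n - l) <= 2 * c / (1 - q) * q ^+ n.
Proof.
move=> q01 h hl; have [l' hl'] := geo_cauchy q01 h.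
suff -> : l = l' by [].
apply: nc_small_eq => e e0; have [n0 /(_ n0 (leqnn _)) hn] :=
  geo_small (C + 2 * c / (1 - q)) q01 e0.
apply: (le_trans (nc_trans (z n0) _ _)); rewrite ncC.
by have := hl n0; have := hl' n0; move: hn; rewrite mulrDl; lra.
Qed.

Lemma nc_lim_le {R : realType} (z : nat -> R[i]) (l : R[i]) (C q B : R) :
  0 <= q < 1 -> (forall n, nc (z n - l) <= C * q ^+ n) ->
  (forall n, nc (z n) <= B) -> nc l <= B.
Proof.
move=> q01 hl hB; apply/ler_addgt0Pr => e e0.
have [n0 /(_ n0 (leqnn _)) hn] := geo_small C q01 e0.
have := ncB (z n0) (z n0 - l); have := hl n0; have := hB n0.
by rewrite subKr; lra.
Qed.

(** * Neumann series for the Beltrami equation with variable coefficient *)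

Section beltrami_solution.
Variables (R : realType) (tau : R[i]) (D : nat -> trig R) (q delta : R).
Hypothesis tau_gt0 : 0 < complex.Im tau.
Hypothesis q01 : 0 < q < 1.
Hypothesis delta0 : 0 < delta.
Hypothesis Dq : forall n, tnorm (D n) <= delta * q ^+ n.

Let kap := (complex.Im tau)^-1.
Hypothesis small : 16 * kap * delta <= q * (1 - q).

(* [bel_iter] solves [H = S (1 + bel_op H)] with [S] the sum of the [D l], one
   term of [S] at a time: it carries the partial sums of [S] and of [H], and the
   last increment of [H]. *)
Fixpoint bel_iter n : trig R * trig R * trig R :=
  if n is m.+1 then
    let: (s, h, d) := bel_iter m in
    let d' := D m.+1 ++ tmul (D m.+1) (bel_op tau h) ++ tmul s (bel_op tau d) in
    (s ++ D m.+1, h ++ d', d')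
  else (D 0%N, D 0%N, D 0%N).

Let s n := (bel_iter n).1.1.
Let h n := (bel_iter n).1.2.
Let d n := (bel_iter n).2.

Let sS n : s n.+1 = s n ++ D n.+1.
Proof. by rewrite /s /=; case: (bel_iter n) => [[]]. Qed.

Let dS n : d n.+1 = D n.+1 ++ tmul (D n.+1) (bel_op tau (h n)) ++ tmul (s n) (bel_op tau (d n)).
Proof. by rewrite /d /s /h /=; case: (bel_iter n) => [[]]. Qed.

Let hS n : h n.+1 = h n ++ d n.+1.
Proof. by rewrite dS /h /s /d /=; case: (bel_iter n) => [[]]. Qed.

Let kap0 : 0 < kap. Proof. by rewrite invr_gt0. Qed.
Let q0 : 0 < q. Proof. by case/andP: q01. Qed.
Let q1 : 0 < 1 - q. Proof. by case/andP: q01 => _; rewrite subr_gt0. Qed.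
Let q01' : 0 <= q < 1. Proof. by case/andP: q01 => /ltW -> ->. Qed.

Let geo n : (1 - q ^+ n.+2) / (1 - q) = (1 - q ^+ n.+1) / (1 - q) + q ^+ n.+1.
Proof. by rewrite [q ^+ n.+2]exprS; field; rewrite gt_eqF. Qed.

Let geo_le n : (1 - q ^+ n) / (1 - q) <= (1 - q)^-1.
Proof.
by rewrite ler_pdivrMr // mulVf ?gt_eqF // gerBl exprn_ge0 // ltW.
Qed.

Let s_norm n : tnorm (s n) <= delta * ((1 - q ^+ n.+1) / (1 - q)).
Proof.
elim: n => [|n ih].
  by rewrite expr1 divff ?gt_eqF // (le_trans (Dq 0)) // expr0.
by rewrite sS tnorm_cat geo mulrDr lerD.
Qed.

Let s_norm' n : tnorm (s n) <= delta / (1 - q).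
Proof. by rewrite (le_trans (s_norm n)) // ler_wpM2l ?geo_le // ltW. Qed.

Let kd : kap * (delta / (1 - q)) <= q / 16.
Proof.
by rewrite mulrA ler_pdivrMr //; move: small; lra.
Qed.

(** Of the three terms of [d n.+1], the first is at most [delta * q^(n+1)] and each of the other two
    at most an eighth of this, by [small]. Hence the factor 2 reproduces itself. *)
Let hd_norm n : tnorm (d n) <= 2 * delta * q ^+ n /\
  tnorm (h n) <= 2 * delta * ((1 - q ^+ n.+1) / (1 - q)).
Proof.
elim: n => [|n [ihd ihh]].
  have := Dq 0; rewrite expr1 divff ?gt_eqF // expr0 => H.
  by split; rewrite /d /h /=; move: delta0; lra.
suff H : tnorm (d n.+1) <= 2 * delta * q ^+ n.+1.
  by split=> //; rewrite hS tnorm_cat geo mulrDr lerD.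
rewrite dS !tnorm_cat !tnorm_mul.
have qn0 : 0 <= q ^+ n by rewrite exprn_ge0 // ltW.
have ih' : tnorm (h n) <= 2 * (delta / (1 - q)).
  by rewrite mulrA (le_trans ihh) // ler_wpM2l ?geo_le // mulr_ge0 // ltW.
have h1 : tnorm (bel_op tau (h n)) <= q / 8.
  rewrite (le_trans (tnorm_bel_op tau_gt0 _)) //.
  have : kap * tnorm (h n) <= kap * (2 * (delta / (1 - q))) by rewrite ler_wpM2l // ltW.
  rewrite -/kap; move: kd; lra.
have h2 : tnorm (bel_op tau (d n)) <= kap * (2 * delta * q ^+ n).
  by rewrite (le_trans (tnorm_bel_op tau_gt0 _)) // ler_wpM2l // ltW.
have D1 := Dq n.+1.
have e1 : tnorm (D n.+1) * tnorm (bel_op tau (h n)) <= delta * q ^+ n.+1 * (q / 8).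
  by rewrite ler_pM ?tnorm_ge0.
have e2 : tnorm (s n) * tnorm (bel_op tau (d n)) <= delta / (1 - q) * (kap * (2 * delta * q ^+ n)).
  by rewrite ler_pM ?tnorm_ge0.
have e3 : delta / (1 - q) * (kap * (2 * delta * q ^+ n)) <= q / 16 * (2 * delta * q ^+ n).
  by rewrite mulrCA mulrA ler_wpM2r ?kd // ?mulr_ge0 ?(ltW delta0).
have e4 : delta * q ^+ n.+1 * (q / 8) <= delta * q ^+ n.+1 * (1 / 8).
  have [_ q11] := andP q01'.
  by rewrite ler_wpM2l ?mulr_ge0 ?exprn_ge0 ?(ltW q0) ?(ltW delta0) //; lra.
have e5 : 0 <= delta * q ^+ n.+1 by rewrite mulr_ge0 ?exprn_ge0 ?(ltW q0) ?(ltW delta0).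
have e6 : q / 16 * (2 * delta * q ^+ n) = delta * q ^+ n.+1 * (1 / 8).
  by rewrite exprS; field.
by lra.
Qed.

Let d_norm n : tnorm (d n) <= 2 * delta * q ^+ n. Proof. by case: (hd_norm n). Qed.

Let h_norm n : tnorm (h n) <= 2 * delta / (1 - q).
Proof.
case: (hd_norm n) => _ /le_trans; apply.
by rewrite ler_wpM2l ?geo_le // mulr_ge0 // ltW.
Qed.

Let dS_norm n : tnorm (d n.+1) <= 2 * delta * q * q ^+ n.
Proof. by rewrite -[leRHS]mulrA -exprS. Qed.

Let s_sum n x y : tev (s n) x y = \sum_(l < n.+1) tev (D l) x y.
Proof.
elim: n => [|n ih]; first by rewrite big_ord1.
by rewrite big_ord_recr /= sS tev_cat ih.
Qed.

(** The fixed point equation holds at every step with the explicit defect [s n * bel_op (d n)],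
    which decays geometrically. *)
Let invariant n x y : tev (h n) x y =
  tev (s n) x y * (1 + tev (bel_op tau (h n)) x y - tev (bel_op tau (d n)) x y).
Proof.
elim: n => [|n ih]; first by rewrite /h /s /d /= addrK mulr1.
rewrite hS sS dS !(tev_cat, tev_bel_op_cat, tev_mul) ih; ring.
Qed.

(** By construction of [bel_prim], the derivatives of [wn n] in [x] and [y] are [Wn n] and
    [tau * Wn n + Hn n]. In the limit [H = S * W] turns the second into [(tau + S) * W]. *)
Let Hn n x y : R[i] := tev (h n) x y.
Let Wn n x y : R[i] := 1 + tev (bel_op tau (h n)) x y.
Let wn n (x y : R) : R[i] := x%:C + tau * y%:C + (bel_prim tau (h n) x y - bel_prim tau (h n) 0 0).

Let HnS x y n : nc (Hn n.+1 x y - Hn n x y) <= 2 * delta * q * q ^+ n.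
Proof. by rewrite /Hn hS tev_cat addrAC subrr add0r (le_trans (nc_tev _ _ _)). Qed.

Let WnS x y n : nc (Wn n.+1 x y - Wn n x y) <= kap * (2 * delta * q) * q ^+ n.
Proof.
rewrite /Wn hS tev_bel_op_cat.
have -> : forall a b c : R[i], a + (b + c) - (a + b) = c by move=> *; ring.
rewrite (le_trans (nc_tev _ _ _)) // (le_trans (tnorm_bel_op tau_gt0 _)) //.
by rewrite -[leRHS]mulrA ler_wpM2l // ltW.
Qed.

Let wnE x y n : wn n.+1 x y - wn n x y =
  bel_prim tau (d n.+1) x y - bel_prim tau (d n.+1) 0 0.
Proof. by rewrite /wn hS /bel_prim !big_cat /=; ring. Qed.

Let wnS x y n : nc (wn n.+1 x y - wn n x y) <=
  bel_lip tau * (`|x| + `|y|) * (2 * delta * q) * q ^+ n.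
Proof.
rewrite wnE (le_trans (bel_prim_lip tau_gt0 _ _ _ _ _)) // !subr0.
rewrite mulrAC -[leRHS]mulrA ler_wpM2l // mulr_ge0 ?addr_ge0 //.
by apply: le_trans (bel_lip_ge1 tau_gt0).
Qed.

Let limH := fun p : R * R => geo_cauchy q01' (HnS p.1 p.2).
Let limW := fun p : R * R => geo_cauchy q01' (WnS p.1 p.2).
Let limw := fun p : R * R => geo_cauchy q01' (wnS p.1 p.2).

Let H x y : R[i] := projT1 (cid (limH (x, y))).
Let W x y : R[i] := projT1 (cid (limW (x, y))).
Let w x y : R[i] := projT1 (cid (limw (x, y))).

Let HP x y n : nc (Hn n x y - H x y) <= 2 * (2 * delta * q) / (1 - q) * q ^+ n.
Proof. exact: (projT2 (cid (limH (x, y)))). Qed.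
Let WP x y n : nc (Wn n x y - W x y) <= 2 * (kap * (2 * delta * q)) / (1 - q) * q ^+ n.
Proof. exact: (projT2 (cid (limW (x, y)))). Qed.
Let wP x y n : nc (wn n x y - w x y) <=
  2 * (bel_lip tau * (`|x| + `|y|) * (2 * delta * q)) / (1 - q) * q ^+ n.
Proof. exact: (projT2 (cid (limw (x, y)))). Qed.

Let w_lip x y x' y' :
  nc (w x' y' - w x y - ((x' - x)%:C + tau * (y' - y)%:C)) <=
  bel_lip tau * (2 * delta / (1 - q)) * (`|x' - x| + `|y' - y|).
Proof.
pose z n : R[i] := wn n x' y' - wn n x y - ((x' - x)%:C + tau * (y' - y)%:C).
pose c (x y : R) : R := 2 * (bel_lip tau * (`|x| + `|y|) * (2 * delta * q)) / (1 - q).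
have := @nc_lim_le R z (w x' y' - w x y - ((x' - x)%:C + tau * (y' - y)%:C))
  (c x' y' + c x y) q _ q01'.
apply=> n.
  have -> : forall a b d e f : R[i], a - b - d - (e - f - d) = (a - e) - (b - f).
    by move=> *; ring.
  by apply: (le_trans (ncB _ _)); rewrite mulrDl; apply: lerD; exact: wP.
have -> : z n = bel_prim tau (h n) x' y' - bel_prim tau (h n) x y.
  by rewrite /z /wn !rmorphB; ring.
rewrite (le_trans (bel_prim_lip tau_gt0 _ _ _ _ _)) // ler_wpM2r ?addr_ge0 //.
by rewrite ler_wpM2l // (le_trans _ (bel_lip_ge1 tau_gt0)).
Qed.

Let W_near x y : nc (W x y - 1) <= kap * (2 * delta / (1 - q)).
Proof.
apply: (@nc_lim_le _ (fun n => Wn n x y - 1) _ _ q _ q01') => n.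
  have -> : forall a b : R[i], a - 1 - (b - 1) = a - b by move=> *; ring.
  exact: WP.
rewrite /Wn addrC addKr (le_trans (nc_tev _ _ _)) // (le_trans (tnorm_bel_op tau_gt0 _)) //.
by rewrite ler_wpM2l // ltW.
Qed.

(** The first-order error of the limit differs from that of the [n]-th iterate by a geometrically
    small multiple of [|a| + |b|]. One iterate is fixed to make this multiple small, and
    [bel_prim_diff] for that iterate gives [r], uniformly in the point. *)
Let w_diff (e : R) : 0 < e -> exists2 r, 0 < r & forall x y a b : R, `|a| + `|b| <= r ->
  nc (w (x + a) (y + b) - w x y - (W x y * a%:C + (tau * W x y + H x y) * b%:C)) <=
  e * (`|a| + `|b|).
Proof.
move=> e0; have e2 : 0 < e / 2 by lra.
pose K := bel_lip tau + kap + nc tau * kap + 1.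
have K0 : 0 <= K.
  have L0 : 0 <= bel_lip tau by rewrite (le_trans _ (bel_lip_ge1 tau_gt0)).
  apply: addr_ge0 => //.
  exact: addr_ge0 (addr_ge0 L0 (ltW kap0)) (mulr_ge0 (nc_ge0 _) (ltW kap0)).
pose Z n x y a b : R[i] := wn n (x + a) (y + b) - wn n x y -
  (Wn n x y * a%:C + (tau * Wn n x y + Hn n x y) * b%:C).
pose Zl x y a b : R[i] := w (x + a) (y + b) - w x y - (W x y * a%:C + (tau * W x y + H x y) * b%:C).
have ZS x y a b n : nc (Z n.+1 x y a b - Z n x y a b) <=
    K * (`|a| + `|b|) * (2 * delta * q) * q ^+ n.
  have -> : Z n.+1 x y a b - Z n x y a b =
    (bel_prim tau (d n.+1) (x + a) (y + b) - bel_prim tau (d n.+1) x y) -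
    (tev (bel_op tau (d n.+1)) x y * (a%:C + tau * b%:C) + tev (d n.+1) x y * b%:C).
    rewrite /Z /wn /Wn /Hn hS tev_cat tev_bel_op_cat /bel_prim !big_cat /=; ring.
  have S0 : 0 <= `|a| + `|b| by rewrite addr_ge0.
  apply: (@le_trans _ _ (K * (`|a| + `|b|) * tnorm (d n.+1))); last first.
    by rewrite -[leRHS]mulrA ler_wpM2l // mulr_ge0.
  have B1 := bel_prim_lip tau_gt0 (d n.+1) x y (x + a) (y + b).
  have -> : K * (`|a| + `|b|) * tnorm (d n.+1) = bel_lip tau * tnorm (d n.+1) * (`|a| + `|b|)
     + (kap * tnorm (d n.+1) * ((`|a| + `|b|) + nc tau * (`|a| + `|b|))
     + tnorm (d n.+1) * (`|a| + `|b|)) by rewrite /K; ring.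
  apply: (le_trans (ncB _ _)); apply: lerD.
    by apply: le_trans B1 _; rewrite ![_ + _ - _]addrAC !subrr !add0r.
  apply: (le_trans (ncD _ _)); rewrite !ncM nc_real; apply: lerD; last first.
    by apply: ler_pM; rewrite ?nc_ge0 ?nc_tev // lerDr.
  apply: ler_pM; rewrite ?nc_ge0 //.
    by rewrite (le_trans (nc_tev _ _ _)) // tnorm_bel_op.
  apply: (le_trans (ncD _ _)); rewrite ncM !nc_real; apply: lerD; rewrite ?lerDl //.
  by rewrite ler_wpM2l ?nc_ge0 // lerDr.
have ZP x y a b n : nc (Z n x y a b - Zl x y a b) <=
    2 * (K * (`|a| + `|b|) * (2 * delta * q)) / (1 - q) * q ^+ n.
  pose c (x y : R) : R := 2 * (bel_lip tau * (`|x| + `|y|) * (2 * delta * q)) / (1 - q).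
  pose cW := 2 * (kap * (2 * delta * q)) / (1 - q).
  pose cH := 2 * (2 * delta * q) / (1 - q).
  apply: (@geo_lim _ _ _ _ (c (x + a) (y + b) + c x y + (cW * `|a| + (nc tau * cW + cH) * `|b|)) q q01' (ZS x y a b)) => m.
  have -> : Z m x y a b - Zl x y a b = (wn m (x + a) (y + b) - w (x + a) (y + b))
     - (wn m x y - w x y) - ((Wn m x y - W x y) * a%:C +
      (tau * (Wn m x y - W x y) + (Hn m x y - H x y)) * b%:C).
    by rewrite /Z /Zl; ring.
  rewrite [leRHS]mulrDl; apply: (le_trans (ncB _ _)); apply: lerD.
    by rewrite [leRHS]mulrDl; apply: (le_trans (ncB _ _)); apply: lerD; exact: wP.
  apply: (le_trans (ncD _ _)); rewrite [leRHS]mulrDl !ncM !nc_real; apply: lerD.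
    by rewrite mulrAC ler_wpM2r // WP.
  rewrite mulrAC ler_wpM2r // (le_trans (ncD _ _)) // mulrDl ncM -mulrA.
  by apply: lerD; [rewrite ler_wpM2l ?nc_ge0 // WP|exact: HP].
have [n0 /(_ n0 (leqnn _)) hn] := geo_small (2 * (K * (2 * delta * q)) / (1 - q)) q01' e2.
have [C C0 hC] := bel_prim_diff tau_gt0 (h n0).
exists (e / 2 / (C + 1)); first by rewrite divr_gt0 // ltr_wpDl.
move=> x y a b ab; have S0 : 0 <= `|a| + `|b| by rewrite addr_ge0.
rewrite -/(Zl x y a b).
have Zn0 : nc (Z n0 x y a b) <= e / 2 * (`|a| + `|b|).
  have -> : Z n0 x y a b = bel_prim tau (h n0) (x + a) (y + b) - bel_prim tau (h n0) x y -
      (tev (bel_op tau (h n0)) x y * a%:C +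
      (tau * tev (bel_op tau (h n0)) x y + tev (h n0) x y) * b%:C).
    by rewrite /Z /wn /Wn /Hn !rmorphD; ring.
  apply: (le_trans (hC x y a b)); rewrite expr2 mulrA ler_wpM2r //.
  rewrite ler_pdivlMr ?ltr_wpDl // in ab; rewrite (le_trans _ ab) // mulrC.
  by rewrite ler_wpM2l // lerDl.
have := ZP x y a b n0; have := ncB (Z n0 x y a b) (Z n0 x y a b - Zl x y a b).
rewrite subKr.
have -> : 2 * (K * (`|a| + `|b|) * (2 * delta * q)) / (1 - q) * q ^+ n0 =
  2 * (K * (2 * delta * q)) / (1 - q) * q ^+ n0 * (`|a| + `|b|) by ring.
have := ler_wpM2r S0 hn; lra.
Qed.

(** The limit of [invariant] at a point where the series of the [D l] sums to [S]. The difference is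
    split into four terms, each at most [r / 4]. *)
Let H_eq x y (S : R[i]) :
  (forall r : R, 0 < r -> exists n0, forall n, (n0 <= n)%N ->
      nc (\sum_(l < n.+1) tev (D l) x y - S) <= r) -> H x y = S * W x y.
Proof.
move=> HS; apply: nc_small_eq => r r0.
(* The division by 3 absorbs the bound [nc (Wn n x y) <= 3]. *)
have [n1 h1] := HS (r / 4 / 3) (ltac:(by rewrite !divr_gt0)).
pose A := 2 * (2 * delta * q) / (1 - q); pose B := 2 * (kap * (2 * delta * q)) / (1 - q).
have r4 : 0 < r / 4 by lra.
have [n2 h2] := geo_small A q01' r4.
have [n3 h3] := geo_small (nc S * B) q01' r4.
have [n4 h4] := geo_small (delta / (1 - q) * (kap * (2 * delta))) q01' r4.
pose n := maxn (maxn n1 n2) (maxn n3 n4).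
have {}h1 := h1 n (ltac:(by rewrite !leq_max leqnn)).
have {}h2 := h2 n (ltac:(by rewrite !leq_max leqnn ?orbT)).
have {}h3 := h3 n (ltac:(by rewrite !leq_max leqnn ?orbT)).
have {}h4 := h4 n (ltac:(by rewrite !leq_max leqnn ?orbT)).
rewrite -s_sum in h1.
have -> : H x y - S * W x y = - (Hn n x y - H x y) + (tev (s n) x y - S) * Wn n x y
   + S * (Wn n x y - W x y) - tev (s n) x y * tev (bel_op tau (d n)) x y.
  by rewrite /Hn invariant /Wn; ring.
have b1 : nc (- (Hn n x y - H x y)) <= r / 4 by rewrite ncN (le_trans (HP _ _ _)).
have b2 : nc ((tev (s n) x y - S) * Wn n x y) <= r / 4.
  have : nc (Wn n x y) <= 3.
    apply: (le_trans (ncD _ _)); rewrite nc1.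
    have : nc (tev (bel_op tau (h n)) x y) <= kap * (2 * delta / (1 - q)).
      rewrite (le_trans (nc_tev _ _ _)) // (le_trans (tnorm_bel_op tau_gt0 _)) //.
      by rewrite ler_wpM2l // ltW.
    by move: kd; case/andP: q01; lra.
  move=> W3; rewrite ncM (le_trans (ler_pM _ _ h1 W3)) ?nc_ge0 //.
  by rewrite divfK.
have b3 : nc (S * (Wn n x y - W x y)) <= r / 4.
  rewrite ncM (le_trans _ h3) // -[leRHS]mulrA ler_wpM2l ?nc_ge0 //; exact: WP.
have b4 : nc (tev (s n) x y * tev (bel_op tau (d n)) x y) <= r / 4.
  rewrite ncM (le_trans _ h4) // -[leRHS]mulrA; apply: ler_pM; rewrite ?nc_ge0 //.
    by rewrite (le_trans (nc_tev _ _ _)) // s_norm'.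
  rewrite (le_trans (nc_tev _ _ _)) // (le_trans (tnorm_bel_op tau_gt0 _)) //.
  by rewrite -[leRHS]mulrA ler_wpM2l // ltW.
apply: (le_trans (ncB _ _)); apply: (le_trans (lerD (ncD _ _) (lexx _))).
apply: (le_trans (lerD (lerD (ncD _ _) (lexx _)) (lexx _))); lra.
Qed.

Lemma beltrami_solve : exists w W H : R -> R -> R[i],
  [/\ forall x y x' y', nc (w x' y' - w x y - ((x' - x)%:C + tau * (y' - y)%:C)) <=
        bel_lip tau * (2 * delta / (1 - q)) * (`|x' - x| + `|y' - y|),
      forall x y, nc (W x y - 1) <= kap * (2 * delta / (1 - q)),
      forall e : R, 0 < e -> exists2 r, 0 < r & forall x y a b : R, `|a| + `|b| <= r ->
        nc (w (x + a) (y + b) - w x y -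
          (W x y * a%:C + (tau * W x y + H x y) * b%:C)) <= e * (`|a| + `|b|) &
      forall x y S, (forall r : R, 0 < r -> exists n0, forall n, (n0 <= n)%N ->
        nc (\sum_(l < n.+1) tev (D l) x y - S) <= r) -> H x y = S * W x y].
Proof. by exists w, W, H; split; [exact: w_lip|exact: W_near|exact: w_diff|exact: H_eq]. Qed.

End beltrami_solution.

(** * Cutoff functions with bounded second differences *)

Definition possq {R : realType} (t : R) : R := Num.max t 0 ^+ 2.

Lemma possq_neg {R : realType} (t : R) : t <= 0 -> possq t = 0.
Proof. by move=> t0; rewrite /possq max_r // expr0n. Qed.

Lemma possq_pos {R : realType} (t : R) : 0 <= t -> possq t = t ^+ 2.
Proof. by move=> t0; rewrite /possq max_l. Qed.

Lemma possq_diff2 {R : realType} (t h : R) : 0 < h ->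
  `|possq (t + h + h) - 2 * possq (t + h) + possq t| <= 2 * h ^+ 2.
Proof.
move=> h0; rewrite ler_norml.
have [t0|t0] := leP 0 t.
  rewrite !possq_pos; [|lra..].
  apply/andP; split; nra.
rewrite (possq_neg (ltW t0)).
have [t1|t1] := leP 0 (t + h).
  rewrite !possq_pos; [|lra..].
  apply/andP; split; nra.
rewrite (possq_neg (ltW t1)).
have [t2|t2] := leP 0 (t + h + h).
  rewrite !possq_pos; [|lra..].
  apply/andP; split; nra.
rewrite (possq_neg (ltW t2)).
apply/andP; split; nra.
Qed.

Lemma possq_lip {R : realType} (s t M : R) : s <= t -> `|s| <= M -> `|t| <= M ->
  `|possq t - possq s| <= 2 * M * (t - s).
Proof.
rewrite !ler_norml => st /andP[s1 s2] /andP[t1 t2].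
have [t0|t0] := leP t 0.
  rewrite !possq_neg; [|lra..].
  apply/andP; split; nra.
rewrite (possq_pos (ltW t0)).
have [s0|s0] := leP s 0.
  rewrite !possq_neg; [|lra..].
  apply/andP; split; nra.
rewrite !possq_pos; [|lra..].
apply/andP; split; nra.
Qed.

(** A quadratic spline with knots 0, 1, 2: half a second difference of the squared positive part. It
    is of class [C^{1,1}], which is all that the second difference estimates require of a cutoff. *)
Definition smoothstep {R : realType} (t : R) : R :=
  (possq t - 2 * possq (t - 1) + possq (t - 2)) / 2.

Lemma smoothstep0 {R : realType} (t : R) : t <= 0 -> smoothstep t = 0.
Proof.
move=> t0; rewrite /smoothstep !possq_neg; [|lra..].
by rewrite mulr0 subr0 addr0 mul0r.
Qed.

Lemma smoothstep1 {R : realType} (t : R) : 2 <= t -> smoothstep t = 1.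
Proof.
move=> t2; rewrite /smoothstep !possq_pos; [|lra..].
by field.
Qed.

Lemma smoothstep01 {R : realType} (t : R) : 0 <= smoothstep t <= 1.
Proof.
have [t0|t0] := leP t 0; first by rewrite smoothstep0 // lexx ler01.
have [t2|t2] := leP 2 t; first by rewrite smoothstep1 // lexx ler01.
rewrite /smoothstep (possq_pos (ltW t0)) (possq_neg (t := t - 2)); last lra.
have [t1|t1] := leP t 1.
  rewrite possq_neg; last lra.
  by apply/andP; split; nra.
rewrite possq_pos; last lra.
by apply/andP; split; nra.
Qed.

(** Rises on [[1/4, 3/8]] and falls on [[5/8, 3/4]]. *)
Definition plateau {R : realType} (t : R) : R :=
  smoothstep (16 * t - 4) - smoothstep (16 * t - 10).

Lemma plateau0 {R : realType} (t : R) : ~~ (4^-1 <= t <= 3 / 4) -> plateau t = 0.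
Proof.
rewrite negb_and -!ltNge => /orP[h|h]; rewrite /plateau.
  by rewrite !smoothstep0 ?subrr //; lra.
by rewrite !smoothstep1 ?subrr //; lra.
Qed.

Lemma plateau1 {R : realType} (t : R) : 3 / 8 <= t <= 5 / 8 -> plateau t = 1.
Proof.
by move=> /andP[h1 h2]; rewrite /plateau smoothstep1 ?smoothstep0 ?subr0 //; lra.
Qed.

Lemma plateau_norm {R : realType} (t : R) : `|plateau t| <= 1.
Proof.
have := smoothstep01 (16 * t - 4); have := smoothstep01 (16 * t - 10).
by rewrite /plateau ler_norml => /andP[? ?] /andP[? ?]; apply/andP; split; lra.
Qed.

(** The six [possq] terms have total weight 4, and each has a second difference of at most
    [2 * (16 * h)^2 = 512 * h^2]. *)
Lemma plateau_diff2 {R : realType} (t h : R) : 0 < h ->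
  `|plateau (t + h + h) - 2 * plateau (t + h) + plateau t| <= 2048 * h ^+ 2.
Proof.
move=> h0; have k0 : 0 < 16 * h by lra.
have D a := possq_diff2 (16 * t - a) k0.
have S a c : 16 * (t + h + h) - a - c = 16 * t - (a + c) + 16 * h + 16 * h by ring.
have S' a c : 16 * (t + h) - a - c = 16 * t - (a + c) + 16 * h by ring.
have T a : 16 * (t + h + h) - a = 16 * t - a + 16 * h + 16 * h by ring.
have T' a : 16 * (t + h) - a = 16 * t - a + 16 * h by ring.
have U (a c : R) : 16 * t - a - c = 16 * t - (a + c) by ring.
have := D 4; have := D (4 + 1); have := D (4 + 2).
have := D 10; have := D (10 + 1); have := D (10 + 2).
rewrite /plateau /smoothstep !S !S' !T !T' !U.
rewrite !ler_norml.
have -> : (16 * h) ^+ 2 = 256 * h ^+ 2 by ring.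
move: (h ^+ 2) => hh; clear.
do 6![move=> /andP[? ?]].
by apply/andP; split; lra.
Qed.

Lemma plateau_lip {R : realType} (s t : R) : 0 <= s <= 1 -> 0 <= t <= 1 ->
  `|plateau t - plateau s| <= 2048 * `|t - s|.
Proof.
wlog st : s t / s <= t => [hw|] s01 t01.
  have [/hw|/ltW ts] := leP s t; first exact.
  by rewrite distrC (distrC t); apply: hw.
move: s01 t01 => /andP[s0 s1] /andP[t0 t1].
have D a : 0 <= a <= 12 -> `|possq (16 * t - a) - possq (16 * s - a)| <= 2 * 16 * (16 * t - 16 * s).
  move=> /andP[a0 a1]; have := @possq_lip R (16 * s - a) (16 * t - a) 16.
  have -> : 16 * t - a - (16 * s - a) = 16 * t - 16 * s by ring.
  by apply; rewrite ?ler_norml; try (apply/andP; split); lra.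
have U (x a c : R) : x - a - c = x - (a + c) by ring.
have := D 4; have := D (4 + 1); have := D (4 + 2).
have := D 10; have := D (10 + 1); have := D (10 + 2).
rewrite /plateau /smoothstep !U (ger0_norm (x := t - s)) ?subr_ge0 // !ler_norml.
do 6![move=> /(_ (ltac:(apply/andP; split; lra))) /andP[? ?]].
by apply/andP; split; lra.
Qed.

(** * Localisation of the coefficient and isothermal coordinates *)

Section isothermal.
Variables (R : realType) (tau : R -> R -> R[i]) (A b : R).
Hypothesis A0 : 0 <= A.
Hypothesis b01 : 0 < b <= 1.
Let I (x : R) := 0 <= x <= 1.
Let t0 : R[i] := tau 2^-1 2^-1.
Hypothesis tau_gt0 : 0 < complex.Im t0.
Hypothesis tau_lip : forall x y x' y', I x -> I y -> I x' -> I y' ->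
  nc (tau x' y' - tau x y) <= A * (`|x' - x| + `|y' - y|).
Hypothesis tau_d1 : forall h x y : R, 0 < h -> I x -> I (x + h + h) -> I y ->
  nc (tau (x + h + h) y - 2 * tau (x + h) y + tau x y) <= A * (h * h `^ b).
Hypothesis tau_d2 : forall h x y : R, 0 < h -> I x -> I y -> I (y + h + h) ->
  nc (tau x (y + h + h) - 2 * tau x (y + h) + tau x y) <= A * (h * h `^ b).

Let half01 : I 2^-1. Proof. by apply/andP; split; lra. Qed.

(* The constant is kept abstract: unfolding the large numeral of [plateau_lip] makes
   conversion explode. *)
Variable K : R.
Hypothesis K256 : 256 <= K.
Hypothesis plateau_lip' : forall s t : R, I s -> I t -> `|plateau t - plateau s| <= K * `|t - s|.
Hypothesis plateau_diff2' : forall t h : R, 0 < h ->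
  `|plateau (t + h + h) - 2 * plateau (t + h) + plateau t| <= K * (h * h).

Variable k : R.
Hypothesis k01 : 0 < k <= 1.

(* Zooming by [k] at the centre of the square makes [tau - t0] small. *)
Let sc (x : R) : R := 2^-1 + k * (x - 2^-1).
Let sig x y : R[i] := tau (sc x) (sc y) - t0.
Let U x y : R[i] := (plateau x)%:C * (plateau y)%:C * sig x y.

Let scI x : I x -> I (sc x).
Proof. by rewrite /I /sc; move: k01 => /andP[? ?] /andP[? ?]; apply/andP; split; nra. Qed.

Let sc_lip x y : `|sc x - sc y| = k * `|x - y|.
Proof.
have -> : sc x - sc y = k * (x - y) by rewrite /sc; ring.
by rewrite normrM gtr0_norm //; case/andP: k01.
Qed.

Let sig_lip x y x' y' : I x -> I y -> I x' -> I y' ->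
  nc (sig x' y' - sig x y) <= A * k * (`|x' - x| + `|y' - y|).
Proof.
move=> *; rewrite /sig opprB addrA subrK (le_trans (tau_lip _ _ _ _)) ?scI //.
by rewrite !sc_lip -mulrDr mulrA.
Qed.

Let sc_half : sc 2^-1 = 2^-1. Proof. by rewrite /sc subrr mulr0 addr0. Qed.

Let sig_le x y : I x -> I y -> nc (sig x y) <= A * k.
Proof.
move=> Ix Iy; have := sig_lip half01 half01 Ix Iy.
rewrite {2}/sig !sc_half subrr subr0 => /le_trans; apply.
rewrite ler_piMr ?mulr_ge0 ?(ltW (proj1 (andP k01))) //.
move: Ix Iy => /andP[? ?] /andP[? ?].
have : `|x - 2^-1| <= 2^-1 by rewrite ler_norml; apply/andP; split; lra.
have : `|y - 2^-1| <= 2^-1 by rewrite ler_norml; apply/andP; split; lra.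
lra.
Qed.

Let powk h : 0 < h -> (k * h) * (k * h) `^ b <= k * (h * h `^ b).
Proof.
move=> h0; have /andP[k0 k1] := k01; have /andP[b0 b1] := b01.
rewrite -mulrA ler_pM2l // ler_pM2l //; apply: ge0_ler_powR.
- exact: ltW.
- by rewrite nnegrE mulr_ge0 // ltW.
- by rewrite nnegrE ltW.
- by rewrite ger_pMl.
Qed.

Let sig_d1 h x y : 0 < h -> I x -> I (x + h + h) -> I y ->
  nc (sig (x + h + h) y - 2 * sig (x + h) y + sig x y) <= A * k * (h * h `^ b).
Proof.
move=> h0 Ix Ixh Iy; have k0 : 0 < k by case/andP: k01.
have -> : sig (x + h + h) y - 2 * sig (x + h) y + sig x y =
  tau (sc x + k * h + k * h) (sc y) - 2 * tau (sc x + k * h) (sc y) + tau (sc x) (sc y).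
  have E1 : sc (x + h + h) = sc x + k * h + k * h by rewrite /sc; ring.
  have E2 : sc (x + h) = sc x + k * h by rewrite /sc; ring.
  by rewrite /sig E1 E2; ring.
have E1 : sc x + k * h + k * h = sc (x + h + h) by rewrite /sc; ring.
rewrite (le_trans (tau_d1 _ _ _ _)) ?E1 ?scI ?mulr_gt0 //.
by rewrite -[leRHS]mulrA ler_wpM2l // powk.
Qed.

Let sig_d2 h x y : 0 < h -> I x -> I y -> I (y + h + h) ->
  nc (sig x (y + h + h) - 2 * sig x (y + h) + sig x y) <= A * k * (h * h `^ b).
Proof.
move=> h0 Ix Iy Iyh; have k0 : 0 < k by case/andP: k01.
have -> : sig x (y + h + h) - 2 * sig x (y + h) + sig x y =
  tau (sc x) (sc y + k * h + k * h) - 2 * tau (sc x) (sc y + k * h) + tau (sc x) (sc y).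
  have E1 : sc (y + h + h) = sc y + k * h + k * h by rewrite /sc; ring.
  have E2 : sc (y + h) = sc y + k * h by rewrite /sc; ring.
  by rewrite /sig E1 E2; ring.
have E1 : sc y + k * h + k * h = sc (y + h + h) by rewrite /sc; ring.
rewrite (le_trans (tau_d2 _ _ _ _)) ?E1 ?scI ?mulr_gt0 //.
by rewrite -[leRHS]mulrA ler_wpM2l // powk.
Qed.

Let Ak0 : 0 <= A * k. Proof. by rewrite mulr_ge0 // ltW //; case/andP: k01. Qed.

Let U_zero x y : ~~ (4^-1 <= x <= 3 / 4) || ~~ (4^-1 <= y <= 3 / 4) -> U x y = 0.
Proof.
by rewrite /U => /orP[h|h]; rewrite (plateau0 h) ?(mul0r, mulr0).
Qed.

Let I_of x : 4^-1 <= x <= 3 / 4 -> I x.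
Proof. by move=> /andP[? ?]; apply/andP; split; lra. Qed.

Let U_case x y : U x y = 0 \/ (4^-1 <= x <= 3 / 4 /\ 4^-1 <= y <= 3 / 4).
Proof.
case: (boolP (4^-1 <= x <= 3 / 4)) => hx; last by left; rewrite U_zero ?hx.
case: (boolP (4^-1 <= y <= 3 / 4)) => hy; last by left; rewrite U_zero ?hy ?orbT.
by right.
Qed.

Let plateau_le (x y : R) : `|plateau x| * `|plateau y| <= 1.
Proof. by rewrite mulr_ile1 ?plateau_norm. Qed.

Let U_le x y : nc (U x y) <= A * k.
Proof.
have [->|[hx hy]] := U_case x y; first by rewrite nc0.
rewrite /U !ncM !nc_real -[leRHS]mul1r ler_pM ?mulr_ge0 ?nc_ge0 ?plateau_le //.
by rewrite sig_le ?I_of.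
Qed.

(* [f+ g+ - 2 f g + f- g-] expands around the middle point. *)
Let prod_diff2 (fp f fm : R) (gp g gm : R[i]) (a c d h hb : R) :
  0 <= a -> 0 <= h <= hb -> h * h <= h * hb -> nc gp <= a -> nc g <= a -> nc gm <= a -> `|f| <= 1 ->
  `|fp - f| <= c * h -> `|fm - f| <= c * h -> `|fp - 2 * f + fm| <= d * (h * h) -> 0 <= c -> 0 <= d ->
  nc (gp - g) <= a * h -> nc (gm - g) <= a * h -> nc (gp - 2 * g + gm) <= a * (h * hb) ->
  nc (fp%:C * gp - 2 * (f%:C * g) + fm%:C * gm) <= a * (1 + d + 2 * c) * (h * hb).
Proof.
move=> a0 /andP[h0 hhb] hh gpa ga gma f1 fp1 fm1 f2 c0 d0 gp1 gm1 g2.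
have -> : fp%:C * gp - 2 * (f%:C * g) + fm%:C * gm =
  f%:C * (gp - 2 * g + gm) + (fp - 2 * f + fm)%:C * g +
  ((fp - f)%:C * (gp - g) + (fm - f)%:C * (gm - g)).
  have -> : fp - 2 * f + fm = (fp - f) + (fm - f) by ring.
  by rewrite !(rmorphB, rmorphD); ring.
have e1 : nc (f%:C * (gp - 2 * g + gm)) <= a * (h * hb).
  by rewrite ncM nc_real -[leRHS]mul1r ler_pM ?nc_ge0.
have e2 : nc ((fp - 2 * f + fm)%:C * g) <= d * (h * hb) * a.
  rewrite ncM nc_real ler_pM ?nc_ge0 // (le_trans f2) // ler_wpM2l //.
have e3 : nc ((fp - f)%:C * (gp - g)) <= c * a * (h * hb).
  rewrite ncM nc_real (le_trans (ler_pM _ _ fp1 gp1)) ?nc_ge0 //.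
  have -> : c * h * (a * h) = c * a * (h * h) by ring.
  by rewrite ler_wpM2l // mulr_ge0.
have e4 : nc ((fm - f)%:C * (gm - g)) <= c * a * (h * hb).
  rewrite ncM nc_real (le_trans (ler_pM _ _ fm1 gm1)) ?nc_ge0 //.
  have -> : c * h * (a * h) = c * a * (h * h) by ring.
  by rewrite ler_wpM2l // mulr_ge0.
apply: (le_trans (ncD _ _)).
have -> : a * (1 + d + 2 * c) * (h * hb) = (a * (h * hb) + d * (h * hb) * a) +
   (c * a * (h * hb) + c * a * (h * hb)) by ring.
by apply: lerD; apply: (le_trans (ncD _ _)); apply: lerD.
Qed.

Let C : R := 1 + K + 2 * K.

Let K0 : 0 <= K. Proof. by move: K256; lra. Qed.

Let C0 : 0 <= C. Proof. by rewrite /C; move: K0; lra. Qed.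

Let hpow (h : R) : 0 < h <= 1 -> h <= h `^ b.
Proof. by move=> h01; apply: ger1_powR => //; case/andP: b01. Qed.

(** Large steps need no regularity: the trivial bound [4 * (A * k)] suffices, because
    [h * h^b >= h^2 >= 1/64] and [C >= 256]. *)
Let big_h (h : R) (z1 z2 z3 : R[i]) : 8^-1 <= h <= 1 -> nc z1 <= A * k -> nc z2 <= A * k ->
  nc z3 <= A * k -> nc (z1 - 2 * z2 + z3) <= A * k * C * (h * h `^ b).
Proof.
move=> /andP[h8 h1] e1 e2 e3.
have h0 : 0 < h by lra.
have hp := hpow (ltac:(by rewrite h0 h1) : 0 < h <= 1).
apply: (@le_trans _ _ (A * k * 4)).
  have n2 : nc (2 * z2) = 2 * nc z2 by rewrite ncM nc_nat.
  by apply: (le_trans (ncD _ _)); have := ncB z1 (2 * z2); rewrite n2; lra.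
rewrite -[leRHS]mulrA ler_wpM2l //.
have h64 : 64^-1 <= h * h `^ b by nra.
apply: (@le_trans _ _ (256 * 64^-1)); first lra.
by apply: ler_pM; rewrite // /C; move: K256; lra.
Qed.

Let U_d1 (h x y : R) : 0 < h <= 1 ->
  nc (U (x + h + h) y - 2 * U (x + h) y + U x y) <= A * k * C * (h * h `^ b).
Proof.
move=> h01; have /andP[h0 h1] := h01; have hp := hpow h01.
have [h8|h8] := leP 8^-1 h; first by apply: big_h; rewrite ?U_le ?h8.
have hh0 : 0 <= A * k * C * (h * h `^ b) by apply: mulr_ge0; rewrite ?(mulr_ge0 Ak0 C0) // mulr_ge0 ?powR_ge0 // ltW.
have main : 4^-1 <= y <= 3 / 4 -> I x -> I (x + h + h) ->
    nc (U (x + h + h) y - 2 * U (x + h) y + U x y) <= A * k * C * (h * h `^ b).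
  move=> /I_of Iy Ix Ixh.
  have Ixm : I (x + h) by move: Ix Ixh => /andP[? ?] /andP[? ?]; apply/andP; split; lra.
  have -> : U (x + h + h) y - 2 * U (x + h) y + U x y = (plateau y)%:C *
    ((plateau (x + h + h))%:C * sig (x + h + h) y - 2 * ((plateau (x + h))%:C * sig (x + h) y) +
     (plateau x)%:C * sig x y) by rewrite /U; ring.
  rewrite ncM nc_real -[leRHS]mul1r ler_pM ?nc_ge0 ?plateau_norm //.
  have E1 : `|x + h + h - (x + h)| = h by rewrite addrC addKr gtr0_norm.
  have E2 : `|x - (x + h)| = h by rewrite opprD addNKr normrN gtr0_norm.
  apply: prod_diff2; rewrite ?sig_le ?plateau_norm ?(ltW h0) ?hp ?K0 //.
  - by rewrite ler_pM2l.
  - by rewrite (le_trans (plateau_lip' _ _)) ?E1.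
  - by rewrite (le_trans (plateau_lip' _ _)) ?E2.
  - exact: plateau_diff2'.
  - by rewrite (le_trans (sig_lip _ _ _ _)) // E1 subrr normr0 addr0.
  - by rewrite (le_trans (sig_lip _ _ _ _)) // E2 subrr normr0 addr0.
  - exact: sig_d1.
(* Since [h < 1/8], as soon as one of the three points lies in the support the whole step lies in
   the unit interval, where [tau] is controlled. Otherwise all three values are 0. *)
have [e1|[/andP[x1 x2] hy]] := U_case (x + h + h) y; last first.
  by apply: main => //; apply/andP; split; lra.
have [e2|[/andP[x1 x2] hy]] := U_case (x + h) y; last first.
  by apply: main => //; apply/andP; split; lra.
have [e3|[/andP[x1 x2] hy]] := U_case x y; last first.
  by apply: main => //; apply/andP; split; lra.
by rewrite e1 e2 e3 mulr0 subrr addr0 nc0.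
Qed.

Let U_d2 (h x y : R) : 0 < h <= 1 ->
  nc (U x (y + h + h) - 2 * U x (y + h) + U x y) <= A * k * C * (h * h `^ b).
Proof.
move=> h01; have /andP[h0 h1] := h01; have hp := hpow h01.
have [h8|h8] := leP 8^-1 h; first by apply: big_h; rewrite ?U_le ?h8.
have hh0 : 0 <= A * k * C * (h * h `^ b) by apply: mulr_ge0; rewrite ?(mulr_ge0 Ak0 C0) // mulr_ge0 ?powR_ge0 // ltW.
have main : 4^-1 <= x <= 3 / 4 -> I y -> I (y + h + h) ->
    nc (U x (y + h + h) - 2 * U x (y + h) + U x y) <= A * k * C * (h * h `^ b).
  move=> /I_of Ix Iy Iyh.
  have Iym : I (y + h) by move: Iy Iyh => /andP[? ?] /andP[? ?]; apply/andP; split; lra.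
  have -> : U x (y + h + h) - 2 * U x (y + h) + U x y = (plateau x)%:C *
    ((plateau (y + h + h))%:C * sig x (y + h + h) - 2 * ((plateau (y + h))%:C * sig x (y + h)) +
     (plateau y)%:C * sig x y) by rewrite /U; ring.
  rewrite ncM nc_real -[leRHS]mul1r ler_pM ?nc_ge0 ?plateau_norm //.
  have E1 : `|y + h + h - (y + h)| = h by rewrite addrC addKr gtr0_norm.
  have E2 : `|y - (y + h)| = h by rewrite opprD addNKr normrN gtr0_norm.
  apply: prod_diff2; rewrite ?sig_le ?plateau_norm ?(ltW h0) ?hp ?K0 //.
  - by rewrite ler_pM2l.
  - by rewrite (le_trans (plateau_lip' _ _)) ?E1.
  - by rewrite (le_trans (plateau_lip' _ _)) ?E2.
  - exact: plateau_diff2'.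
  - by rewrite (le_trans (sig_lip _ _ _ _)) // E1 subrr normr0 add0r.
  - by rewrite (le_trans (sig_lip _ _ _ _)) // E2 subrr normr0 add0r.
  - exact: sig_d2.
have [e1|[hx /andP[y1 y2]]] := U_case x (y + h + h); last first.
  by apply: main => //; apply/andP; split; lra.
have [e2|[hx /andP[y1 y2]]] := U_case x (y + h); last first.
  by apply: main => //; apply/andP; split; lra.
have [e3|[hx /andP[y1 y2]]] := U_case x y; last first.
  by apply: main => //; apply/andP; split; lra.
by rewrite e1 e2 e3 mulr0 subrr addr0 nc0.
Qed.

Let U_lip x y x' y' : nc (U x' y' - U x y) <= A * k * C * (`|x' - x| + `|y' - y|).
Proof.
have S0 : 0 <= `|x' - x| + `|y' - y| by rewrite addr_ge0.
have far : 4^-1 <= `|x' - x| + `|y' - y| ->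
    nc (U x' y' - U x y) <= A * k * C * (`|x' - x| + `|y' - y|).
  move=> S4; apply: (le_trans (ncB _ _)); have := U_le x y; have := U_le x' y'.
  have : A * k * (1 / 4 * 8) <= A * k * C * (`|x' - x| + `|y' - y|).
    rewrite -[leRHS]mulrA ler_wpM2l // /C.
    by have := ler_wpM2r S0 K256; lra.
  lra.
have near : I x -> I y -> I x' -> I y' ->
    nc (U x' y' - U x y) <= A * k * C * (`|x' - x| + `|y' - y|).
  move=> Ix Iy Ix' Iy'.
  have -> : U x' y' - U x y = (plateau x')%:C * (plateau y')%:C * (sig x' y' - sig x y) +
    ((plateau x' - plateau x)%:C * (plateau y')%:C * sig x y +
    (plateau x)%:C * (plateau y' - plateau y)%:C * sig x y).
    by rewrite /U !rmorphB; ring.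
  have l1 := plateau_lip' Ix Ix'; have l2 := plateau_lip' Iy Iy'.
  have Ss := sig_le Ix Iy.
  have e1 : nc ((plateau x')%:C * (plateau y')%:C * (sig x' y' - sig x y)) <= 1 * (A * k * (`|x' - x| + `|y' - y|)).
    by rewrite !ncM !nc_real ler_pM ?mulr_ge0 ?nc_ge0 ?plateau_le // sig_lip.
  have e2 : nc ((plateau x' - plateau x)%:C * (plateau y')%:C * sig x y) <= K * `|x' - x| * 1 * (A * k).
    by rewrite !ncM !nc_real ler_pM ?mulr_ge0 ?nc_ge0 // ler_pM ?plateau_norm.
  have e3 : nc ((plateau x)%:C * (plateau y' - plateau y)%:C * sig x y) <= 1 * (K * `|y' - y|) * (A * k).
    by rewrite !ncM !nc_real ler_pM ?mulr_ge0 ?nc_ge0 // ler_pM ?plateau_norm.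
  have z1 : 0 <= A * k * `|x' - x| by rewrite mulr_ge0.
  have z2 : 0 <= A * k * `|y' - y| by rewrite mulr_ge0.
  apply: (le_trans (ncD _ _)); have := ncD ((plateau x' - plateau x)%:C * (plateau y')%:C * sig x y)
    ((plateau x)%:C * (plateau y' - plateau y)%:C * sig x y).
  have -> : A * k * C * (`|x' - x| + `|y' - y|) = A * k * (`|x' - x| + `|y' - y|) +
    3 * K * (A * k * `|x' - x|) + 3 * K * (A * k * `|y' - y|) by rewrite /C; ring.
  have := mulr_ge0 K0 z1; have := mulr_ge0 K0 z2; lra.
have [fr|nr] := leP 4^-1 (`|x' - x| + `|y' - y|); first exact: far.
have nx : `|x' - x| < 4^-1 by have := normr_ge0 (y' - y); lra.
have ny : `|y' - y| < 4^-1 by have := normr_ge0 (x' - x); lra.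
move: nx ny; rewrite !ltr_norml => /andP[? ?] /andP[? ?].
have [e1|[/andP[? ?] /andP[? ?]]] := U_case x y; last first.
  by apply: near; apply/andP; split; lra.
have [e2|[/andP[? ?] /andP[? ?]]] := U_case x' y'; last first.
  by apply: near; apply/andP; split; lra.
by rewrite e1 e2 subrr nc0 mulr_ge0 // mulr_ge0.
Qed.

Let U_sig x y : 3 / 8 <= x <= 5 / 8 -> 3 / 8 <= y <= 5 / 8 -> U x y = sig x y.
Proof. by move=> hx hy; rewrite /U !plateau1 // !mul1r. Qed.

Let L := bel_lip t0.
Let q := 2^-1 `^ b.

(** The Beltrami equation with the original coefficient survives only on the central square, where
    the cutoffs are 1. The comparison with the linear map holds on the whole plane, and this is what
    will make [w] a bijection. *)
Lemma isothermal_scaled : 0 < A -> 64 * (A * k * C) <= q * (1 - q) / (16 * L ^+ 2) ->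
  exists (w W : R -> R -> R[i]) (eta : R),
  [/\ 0 < eta,
      forall x y x' y', nc (w x' y' - w x y - ((x' - x)%:C + t0 * (y' - y)%:C)) <=
        eta * (`|x' - x| + `|y' - y|),
      forall a c : R, 2 * eta * (`|a| + `|c|) <= nc (a%:C + t0 * c%:C),
      forall x y, nc (W x y - 1) <= 2^-1 &
      forall e : R, 0 < e -> exists2 r : R, 0 < r & forall x y a c : R,
        3 / 8 <= x <= 5 / 8 -> 3 / 8 <= y <= 5 / 8 -> `|a| + `|c| <= r ->
        nc (w (x + a) (y + c) - w x y - W x y * (a%:C + tau (sc x) (sc y) * c%:C)) <=
          e * (`|a| + `|c|)].
Proof.
move=> Apos small; have k0 : 0 < k by case/andP: k01.
have e0 : 0 < A * k * C by rewrite !mulr_gt0 // /C; move: K256; lra.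
have b0 : 0 < b by case/andP: b01.
have U_le' x y : nc (U x y) <= A * k * C.
  by rewrite (le_trans (U_le x y)) // ler_peMr // /C; move: K256; lra.
have [D [D1 D2]] := trig_expansion e0 b0 U_le' U_zero U_d1 U_d2 U_lip.
have q0 : 0 < q by rewrite powR_gt0.
have q1 : q < 1.
  have -> : 1 = 1 `^ b by rewrite powR1.
  by rewrite /q gt0_ltr_powR ?nnegrE ?invr_ge0 // invf_lt1 // ltr1n.
have q01 : 0 < q < 1 by rewrite q0.
pose delta := 64 * (A * k * C); have delta0 : 0 < delta by rewrite mulr_gt0.
have L1 : 1 <= L := bel_lip_ge1 tau_gt0.
pose kap := (complex.Im t0)^-1; have kap0 : 0 < kap by rewrite invr_gt0.
have kL : 2 * kap <= L.
  have : 0 <= nc t0 * kap by rewrite mulr_ge0 ?nc_ge0 // ltW.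
  by rewrite /L /bel_lip -/kap; lra.
have L0 : 0 < L by lra.
have p1 : 0 < 1 - q by rewrite subr_gt0.
(* One factor [L] comes from the choice [eta = L * (2 * delta / (1 - q))], the other from inverting
   the linear part: [2 * (|a| + |c|) <= L * nc (a + t0 * c)]. *)
have sm1 : L ^+ 2 * (2 * delta / (1 - q)) <= q / 8.
  have LL : 0 < 16 * L ^+ 2 by rewrite mulr_gt0 // exprn_gt0.
  move: small; rewrite ler_pdivlMr // -/delta mulrA ler_pdivrMr // => sm.
  by lra.
have kap1 : 2 * kap <= L ^+ 2 by rewrite (le_trans kL) // expr2 ler_peMl // ltW.
have sm2 : kap * (2 * delta / (1 - q)) <= 2^-1.
  have d0 : 0 <= 2 * delta / (1 - q) by rewrite divr_ge0 ?mulr_ge0 // ltW.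
  have := ler_wpM2r d0 kap1.
  by move: sm1 q1; lra.
have sm3 : 16 * kap * delta <= q * (1 - q).
  have := ler_wpM2r (ltW delta0) kap1.
  have := mulr_gt0 q0 p1.
  move: sm1; rewrite mulrA ler_pdivrMr //; lra.
have [w [W [H [H1 H2 H3 H4]]]] := beltrami_solve tau_gt0 q01 delta0 D1 sm3.
exists w, W, (L * (2 * delta / (1 - q))); split=> //.
- by rewrite mulr_gt0 // divr_gt0 // mulr_gt0.
- move=> a c.
  have h1 : `|c| <= kap * nc (a%:C + t0 * c%:C).
    rewrite /kap mulrC ler_pdivlMr //; apply: le_trans (nc_Im _).
    have -> : complex.Im (a%:C + t0 * c%:C) = complex.Im t0 * c.
      by case: (t0) => u v /=; rewrite mulr0 add0r add0r.
    by rewrite normrM (gtr0_norm tau_gt0) mulrC.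
  have h2 : `|a| <= nc (a%:C + t0 * c%:C) + nc t0 * `|c|.
    rewrite -!nc_real -ncM -[X in nc X <= _](addrK (t0 * c%:C)); exact: ncB.
  have h3 : 2 * (`|a| + `|c|) <= L * nc (a%:C + t0 * c%:C).
    have : nc t0 * `|c| <= nc t0 * (kap * nc (a%:C + t0 * c%:C)).
      by rewrite ler_wpM2l ?nc_ge0.
    by rewrite /L /bel_lip -/kap; lra.
  set S := `|a| + `|c| in h3 *; set M := nc _ in h3 *.
  have d0 : 0 <= L * (2 * delta / (1 - q)) by rewrite mulr_ge0 ?(ltW L0) // divr_ge0 ?mulr_ge0 // ltW.
  have := ler_wpM2l d0 h3.
  have M0 : 0 <= M by exact: nc_ge0.
  have := ler_wpM2r M0 sm1.
  have : q / 8 * M <= 1 * M by rewrite ler_wpM2r //; lra.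
  rewrite expr2; lra.
- by move=> x y; rewrite (le_trans (H2 x y)).
- move=> e eps0; have [r r0 Hr] := H3 _ eps0; exists r => // x y a c hx hy ac.
  have -> : W x y * (a%:C + tau (sc x) (sc y) * c%:C) =
     W x y * a%:C + (t0 * W x y + H x y) * c%:C.
    rewrite (H4 x y (sig x y)) /sig; first by ring.
    rewrite -/(sig x y) -U_sig //; apply: D2.
      by move: hx => /andP[? ?]; apply/andP; split; lra.
    by move: hy => /andP[? ?]; apply/andP; split; lra.
  exact: Hr.
Qed.

End isothermal.

(** * Perturbations of an invertible linear map of the plane *)

Section near_linear.
Variables (R : realType) (w : R -> R -> R[i]) (t0 : R[i]) (eta : R).
Hypothesis t0_gt0 : 0 < complex.Im t0.
Hypothesis eta0 : 0 < eta.
Hypothesis w_near : forall x y x' y',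
  nc (w x' y' - w x y - ((x' - x)%:C + t0 * (y' - y)%:C)) <= eta * (`|x' - x| + `|y' - y|).
Hypothesis lin_ge : forall a c : R, 2 * eta * (`|a| + `|c|) <= nc (a%:C + t0 * c%:C).

Lemma near_linear_lower x y x' y' :
  eta * (`|x' - x| + `|y' - y|) <= nc (w x' y' - w x y).
Proof.
have := w_near x y x' y'; have := lin_ge (x' - x) (y' - y).
set l := _ + t0 * _; set d := _ - w x y.
have := ncB d (d - l); rewrite subKr; lra.
Qed.

Lemma near_linear_upper x y x' y' :
  nc (w x' y' - w x y) <= (eta + 1 + nc t0) * (`|x' - x| + `|y' - y|).
Proof.
have := w_near x y x' y'.
set l := _ + t0 * _; set d := _ - w x y.
have h : nc l <= `|x' - x| + nc t0 * `|y' - y|.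
  by apply: (le_trans (ncD _ _)); rewrite ncM !nc_real.
have h2 : 0 <= nc t0 * `|x' - x| by rewrite mulr_ge0 ?nc_ge0.
have := ncD (d - l) l; rewrite subrK.
have := normr_ge0 (y' - y); lra.
Qed.

(** A Newton iteration with the fixed derivative [(a, c) -> a + t0 * c]: each step solves the linear
    equation for the current residual, and [w_near] with [lin_ge] leaves at most half of it. *)
Lemma near_linear_surj z : exists x y, w x y = z.
Proof.
pose iy (v : R[i]) : R := complex.Im v / complex.Im t0.
pose ix (v : R[i]) : R := complex.Re v - complex.Re t0 * iy v.
have il v : (ix v)%:C + t0 * (iy v)%:C = v.
  rewrite /ix /iy; move: t0_gt0; case: t0 => a b /= b0; case: v => c d /=.
  apply/eqP; rewrite eq_complex /= !(mulr0, subr0, add0r, addr0) subrK.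
  have bn : b != 0 by rewrite gt_eqF.
  by rewrite eqxx mulrCA divff // mulr1 eqxx.
pose step (p : R * R) := (p.1 + ix (z - w p.1 p.2), p.2 + iy (z - w p.1 p.2)).
pose p n := iter n step (0, 0).
pose v n : R[i] := z - w (p n).1 (p n).2.
have S n : (p n.+1).1 - (p n).1 = ix (v n) /\ (p n.+1).2 - (p n).2 = iy (v n).
  have -> : p n.+1 = step (p n) by [].
  by rewrite /step /= -/(v n); split; rewrite addrAC subrr add0r.
have bound n : 2 * eta * (`|ix (v n)| + `|iy (v n)|) <= nc (v n).
  by have := lin_ge (ix (v n)) (iy (v n)); rewrite il.
have vS n : nc (v n.+1) <= 2^-1 * nc (v n).
  have [S1 S2] := S n.
  have := w_near (p n).1 (p n).2 (p n.+1).1 (p n.+1).2; rewrite S1 S2 il.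
  have -> : w (p n.+1).1 (p n.+1).2 - w (p n).1 (p n).2 - v n = - v n.+1.
    by rewrite /v; ring.
  by rewrite ncN; have := bound n; lra.
have vn n : nc (v n) <= nc (v 0%N) * 2^-1 ^+ n.
  elim: n => [|n ih]; first by rewrite expr0 mulr1.
  by rewrite exprS; have := vS n; lra.
have h01 : 0 <= (2^-1 : R) < 1 by apply/andP; split; lra.
pose c := nc (v 0%N) / (2 * eta).
have cE n : c * 2^-1 ^+ n = nc (v 0%N) * 2^-1 ^+ n / (2 * eta) by rewrite /c; ring.
have e20 : 0 < 2 * eta by rewrite mulr_gt0.
have [|x hx] := @geo_cauchy_real R (fun n => (p n).1) c _ h01.
  move=> n; rewrite (proj1 (S n)) cE ler_pdivlMr // (le_trans _ (vn n)) //.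
  rewrite (le_trans _ (bound n)) // mulrC ler_wpM2l ?(ltW e20) // lerDl //.
have [|y hy] := @geo_cauchy_real R (fun n => (p n).2) c _ h01.
  move=> n; rewrite (proj2 (S n)) cE ler_pdivlMr // (le_trans _ (vn n)) //.
  by rewrite (le_trans _ (bound n)) // mulrC ler_wpM2l ?(ltW e20) // lerDr.
exists x, y; apply/esym/nc_small_eq => e e0.
pose K := (eta + 1 + nc t0) * (c / (1 - 2^-1) + c / (1 - 2^-1)) + nc (v 0%N).
have [n /(_ n (leqnn _)) hn] := geo_small K h01 e0.
apply: (le_trans (nc_trans (w (p n).1 (p n).2) _ _)).
rewrite -/(v n) (le_trans _ hn) // /K mulrDl addrC; apply: lerD; last exact: vn.
apply: (le_trans (near_linear_upper _ _ _ _)); rewrite -mulrA ler_wpM2l //.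
  by rewrite !addr_ge0 ?nc_ge0 // ltW.
by rewrite mulrDl; apply: lerD; rewrite mulrAC.
Qed.

Lemma near_linear_inverse : exists o1 o2 : R[i] -> R,
  [/\ forall z, w (o1 z) (o2 z) = z,
      forall x y, o1 (w x y) = x /\ o2 (w x y) = y &
      forall z z', eta * (`|o1 z' - o1 z| + `|o2 z' - o2 z|) <= nc (z' - z)].
Proof.
have [z|o ho] := choice (P := fun z (p : R * R) => w p.1 p.2 = z).
  by have [x [y h]] := near_linear_surj z; exists (x, y).
exists (fun z => (o z).1), (fun z => (o z).2); split=> [//||].
  move=> x y; have := near_linear_lower x y (o (w x y)).1 (o (w x y)).2.
  rewrite ho subrr nc0 => h.
  have : `|(o (w x y)).1 - x| + `|(o (w x y)).2 - y| <= 0.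
    by rewrite -(pmulr_rle0 _ eta0).
  move=> {}h; split; apply/eqP; rewrite -subr_eq0 -normr_le0.
    by have := normr_ge0 ((o (w x y)).2 - y); lra.
  by have := normr_ge0 ((o (w x y)).1 - x); lra.
by move=> z z'; have := near_linear_lower (o z).1 (o z).2 (o z').1 (o z').2; rewrite !ho.
Qed.

End near_linear.

(** The differentials of [F] and [w] are multiples of the same form [a + T * c], so [F] as a
    function of [w] has the complex derivative [G / W]. The disc of radius [eta / 16] about [b]
    stays within [eta / 8] of the centre, hence inside [J] in both coordinates, and [eta / 64] is
    the quarter of the radius required by [holomorphic_tame]. *)
Lemma chart_tame {R : realType} (w W F G T : R -> R -> R[i]) (o1 o2 : R[i] -> R)
    (eta B Gm : R) (J : R -> Prop := fun x => 3 / 8 <= x <= 5 / 8) :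
  0 < eta ->
  (forall z, w (o1 z) (o2 z) = z) ->
  (forall x y, o1 (w x y) = x /\ o2 (w x y) = y) ->
  (forall z z', eta * (`|o1 z' - o1 z| + `|o2 z' - o2 z|) <= nc (z' - z)) ->
  (forall x y, nc (W x y - 1) <= 2^-1) ->
  (forall e : R, 0 < e -> exists2 r : R, 0 < r & forall x y a c : R,
     J x -> J y -> `|a| + `|c| <= r ->
     nc (w (x + a) (y + c) - w x y - W x y * (a%:C + T x y * c%:C)) <= e * (`|a| + `|c|)) ->
  (forall e : R, 0 < e -> exists2 r : R, 0 < r & forall x y a c : R,
     J x -> J y -> J (x + a) -> J (y + c) -> `|a| + `|c| <= r ->
     nc (F (x + a) (y + c) - F x y - G x y * (a%:C + T x y * c%:C)) <= e * (`|a| + `|c|)) ->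
  (forall x y, J x -> J y -> nc (G x y) <= Gm) ->
  (forall x y, J x -> J y -> nc (F x y) <= B) ->
  forall b v, nc (b - w 2^-1 2^-1) <= eta / 16 -> nc v <= eta / 64 ->
  tame (2 * B) 2 (fun t => complex.Re (F (o1 (b + t%:C * v)) (o2 (b + t%:C * v)))).
Proof.
move=> eta0 wo ow lip W1 wd Fd GB FB b v hb hv.
have r0 : 0 < eta / 16 by lra.
have inJ z : nc (z - b) <= eta / 16 -> J (o1 z) /\ J (o2 z).
  move=> hz; have := lip (w 2^-1 2^-1) z; have [-> ->] := ow 2^-1 2^-1.
  have := nc_trans b z (w 2^-1 2^-1) => h1 h2.
  have : `|o1 z - 2^-1| + `|o2 z - 2^-1| <= 8^-1.
    rewrite -(ler_pM2l eta0); lra.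
  have := normr_ge0 (o1 z - 2^-1); have := normr_ge0 (o2 z - 2^-1) => n1 n2 h.
  have k1 : `|o1 z - 2^-1| <= 8^-1 by lra.
  have k2 : `|o2 z - 2^-1| <= 8^-1 by lra.
  rewrite /J; move: k1 k2; rewrite !ler_norml; clear => /andP[? ?] /andP[? ?].
  by split; apply/andP; split; lra.
have Gm0 : 0 <= Gm.
  have [|J1 J2] := inJ b; first by rewrite subrr nc0 ltW.
  exact: le_trans (nc_ge0 _) (GB _ _ J1 J2).
pose Phi z : R[i] := F (o1 z) (o2 z).
pose Psi z : R[i] := G (o1 z) (o2 z) / W (o1 z) (o2 z).
have W2 x y : 2^-1 <= nc (W x y).
  have := W1 x y; have := ncB (W x y) (W x y - 1); rewrite subKr nc1; lra.
apply: (@holomorphic_tame R Phi Psi b (eta / 16) B r0).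
- by move=> z /inJ[J1 J2]; exact: FB.
(* The errors of [F] and of [w], the latter multiplied by [G / W] of modulus at most [2 * Gm], add
   up to [e * eta] times the displacement, which [lip] converts into [e * nc (z' - z)]. *)
- move=> e e0; pose e1 := e * eta / (1 + 2 * Gm).
  have g0 : 0 < 1 + 2 * Gm by lra.
  have e10 : 0 < e1 by rewrite divr_gt0 // mulr_gt0.
  have [r1 r10 h1] := wd _ e10; have [r2 r20 h2] := Fd _ e10.
  exists (eta * Num.min r1 r2); first by rewrite mulr_gt0 // lt_min r10.
  move=> z z' /inJ[J1 J2] /inJ[J1' J2'] hz.
  set a := o1 z' - o1 z; set c := o2 z' - o2 z.
  have Ea : o1 z' = o1 z + a by rewrite addrC subrK.
  have Ec : o2 z' = o2 z + c by rewrite addrC subrK.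
  have S := lip z z'; rewrite -/a -/c in S.
  have Sr : `|a| + `|c| <= Num.min r1 r2.
    by rewrite -(ler_pM2l eta0) (le_trans S).
  have S1 : `|a| + `|c| <= r1 by rewrite (le_trans Sr) // ge_min lexx.
  have S2 : `|a| + `|c| <= r2 by rewrite (le_trans Sr) // ge_min lexx orbT.
  have {}h1 := h1 _ _ _ _ J1 J2 S1; rewrite Ea Ec in J1' J2'.
  have {}h2 := h2 _ _ _ _ J1 J2 J1' J2' S2.
  rewrite -Ea -Ec in h1 h2; rewrite !wo in h1.
  have W0 : W (o1 z) (o2 z) != 0.
    by apply/eqP => h; have := W2 (o1 z) (o2 z); rewrite h nc0; lra.
  have -> : Phi z' - Phi z - Psi z * (z' - z) =
    (F (o1 z') (o2 z') - F (o1 z) (o2 z) - G (o1 z) (o2 z) * (a%:C + T (o1 z) (o2 z) * c%:C)) -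
    G (o1 z) (o2 z) / W (o1 z) (o2 z) *
      (z' - z - W (o1 z) (o2 z) * (a%:C + T (o1 z) (o2 z) * c%:C)).
    by rewrite /Phi /Psi; field.
  have GW : nc (G (o1 z) (o2 z) / W (o1 z) (o2 z)) <= 2 * Gm.
    rewrite ncM ncV ler_pdivrMr; last by apply: lt_le_trans (W2 _ _); lra.
    by have := GB _ _ J1 J2; have := W2 (o1 z) (o2 z); nra.
  apply: (le_trans (ncB _ _)); rewrite ncM.
  have s0 : 0 <= e1 * (`|a| + `|c|) by rewrite mulr_ge0 ?addr_ge0 // ltW.
  have k1 := ler_pM (nc_ge0 _) (nc_ge0 _) GW h1.
  have k2 : e1 * (1 + 2 * Gm) = e * eta by rewrite /e1 divfK // gt_eqF.
  have k3 : e * (eta * (`|a| + `|c|)) <= e * nc (z' - z) by rewrite ler_pM2l.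
  have k4 : e1 * (`|a| + `|c|) + 2 * Gm * (e1 * (`|a| + `|c|)) = e * (eta * (`|a| + `|c|)).
    by rewrite [RHS]mulrA -k2; ring.
  lra.
- by move: hv; lra.
Qed.

(** * Hoelder classes on the unit square and the Poincare lemma *)

Section square_class.
Variables (R : realType) (b : R).
Hypothesis b01 : 0 < b <= 1.

Definition unitI (x : R) := 0 <= x <= 1.
Let I := unitI.

(* Hoelder continuity of exponent [b] on the unit square. *)
Definition hol (f : R -> R -> R) := exists2 M, 0 <= M & forall x y x' y',
  I x -> I y -> I x' -> I y' -> `|f x' y' - f x y| <= M * (`|x' - x| `^ b + `|y' - y| `^ b).

Definition px (f : R -> R -> R) x y : R := 'D_1 (fun t => f t y) x.
Definition py (f : R -> R -> R) x y : R := 'D_1 (f x) y.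

Definition C1 (f : R -> R -> R) :=
  (forall x y, I x -> I y -> is_derive x 1 (fun t => f t y) (px f x y) /\
                             is_derive y 1 (f x) (py f x y)) /\
  hol (px f) /\ hol (py f).

Let I0 : I 0. Proof. by apply/andP; split; lra. Qed.

Let Idist x x' : I x -> I x' -> `|x' - x| <= 1.
Proof.
by move=> /andP[? ?] /andP[? ?]; rewrite ler_norml; apply/andP; split; lra.
Qed.

Let le_pow x x' : I x -> I x' -> `|x' - x| <= `|x' - x| `^ b.
Proof.
move=> Ix Ix'; have [->|n0] := eqVneq x' x.
  by rewrite subrr normr0 powR_ge0.
apply: ger1_powR; last by case/andP: b01.
by rewrite normr_gt0 subr_eq0 n0 Idist.
Qed.

Let pow1 x x' : I x -> I x' -> `|x' - x| `^ b <= 1.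
Proof.
move=> Ix Ix'; have -> : 1 = 1 `^ b by rewrite powR1.
apply: ge0_ler_powR; rewrite ?nnegrE ?Idist //.
by case/andP: b01 => /ltW.
Qed.

Lemma hol_ext f g : (forall x y, I x -> I y -> f x y = g x y) -> hol f -> hol g.
Proof. by move=> fg [M M0 h]; exists M => // *; rewrite -!fg // h. Qed.

Lemma hol_bounded f : hol f -> exists2 B, 0 < B & forall x y, I x -> I y -> `|f x y| <= B.
Proof.
move=> [M M0 h]; exists (`|f 0 0| + M * 2 + 1); first by have := normr_ge0 (f 0 0); lra.
move=> x y Ix Iy; have := h 0 0 x y I0 I0 Ix Iy.
have d2 : `|x - 0| `^ b + `|y - 0| `^ b <= 2 by have := pow1 I0 Ix; have := pow1 I0 Iy; lra.
have := ler_wpM2l M0 d2.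
have := ler_normD (f x y - f 0 0) (f 0 0); rewrite subrK; lra.
Qed.

Lemma hol_cst c : hol (fun _ _ => c).
Proof. by exists 0 => // *; rewrite subrr normr0 mul0r. Qed.

Lemma holD f g : hol f -> hol g -> hol (fun x y => f x y + g x y).
Proof.
move=> [M M0 h] [K K0 k]; exists (M + K); first by rewrite addr_ge0.
move=> x y x' y' Ix Iy Ix' Iy'; rewrite opprD addrACA mulrDl.
by apply: (le_trans (ler_normD _ _)); rewrite lerD ?h ?k.
Qed.

Lemma holM f g : hol f -> hol g -> hol (fun x y => f x y * g x y).
Proof.
move=> hf hg; have [A A0 hA] := hol_bounded hf; have [B B0 hB] := hol_bounded hg.
move: hf hg => [M M0 h] [K K0 k].
exists (A * K + M * B); first by rewrite addr_ge0 // mulr_ge0 // ltW.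
move=> x y x' y' Ix Iy Ix' Iy'.
have -> : f x' y' * g x' y' - f x y * g x y =
  f x' y' * (g x' y' - g x y) + (f x' y' - f x y) * g x y by ring.
apply: (le_trans (ler_normD _ _)); rewrite !normrM mulrDl.
apply: lerD.
  by rewrite -mulrA ler_pM ?hA ?k.
by rewrite mulrAC ler_pM ?hB ?h.
Qed.

Lemma holN f : hol f -> hol (fun x y => - f x y).
Proof.
move=> /(holM (hol_cst (-1))); apply: hol_ext => x y _ _.
by rewrite mulN1r.
Qed.

Lemma holV f c : 0 < c -> (forall x y, I x -> I y -> c <= f x y) -> hol f ->
  hol (fun x y => (f x y)^-1).
Proof.
move=> c0 fc [M M0 h]; exists (M / (c * c)); first by rewrite divr_ge0 // mulr_ge0 // ltW.
move=> x y x' y' Ix Iy Ix' Iy'.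
have f0 := fc _ _ Ix Iy; have f0' := fc _ _ Ix' Iy'.
have p0 := lt_le_trans c0 f0; have p0' := lt_le_trans c0 f0'.
have -> : (f x' y')^-1 - (f x y)^-1 = - (f x' y' - f x y) / (f x' y' * f x y).
  by field; rewrite !gt_eqF.
rewrite normrM normrN normfV (gtr0_norm (mulr_gt0 p0' p0)) mulrAC.
apply: ler_pM; rewrite ?invr_ge0 ?(ltW (mulr_gt0 _ _)) ?h //.
by rewrite lef_pV2 ?posrE ?mulr_gt0 // ler_pM ?(ltW c0).
Qed.

Lemma hol_sqrt f c : 0 < c -> (forall x y, I x -> I y -> c <= f x y) -> hol f ->
  hol (fun x y => Num.sqrt (f x y)).
Proof.
move=> c0 fc [M M0 h]; have s0 : 0 < Num.sqrt c by rewrite sqrtr_gt0.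
exists (M / Num.sqrt c); first by rewrite divr_ge0 // ltW.
move=> x y x' y' Ix Iy Ix' Iy'.
have f0 := fc _ _ Ix Iy; have f0' := fc _ _ Ix' Iy'.
have p0 := lt_le_trans c0 f0; have p0' := lt_le_trans c0 f0'.
have k1 : Num.sqrt c <= Num.sqrt (f x y) by rewrite ler_wsqrtr.
have k2 := sqrtr_ge0 (f x' y').
have E : (Num.sqrt (f x' y') - Num.sqrt (f x y)) * (Num.sqrt (f x' y') + Num.sqrt (f x y)) =
   f x' y' - f x y.
  by rewrite -subr_sqr !sqr_sqrtr // ltW.
have hh := h _ _ _ _ Ix Iy Ix' Iy'; rewrite -E normrM in hh.
rewrite mulrAC ler_pdivlMr // (le_trans _ hh) // ler_wpM2l //.
by rewrite ger0_norm ?addr_ge0 ?sqrtr_ge0 //; lra.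
Qed.

Lemma C1_intro f f1 f2 :
  (forall x y, I x -> I y -> is_derive x 1 (fun t => f t y) (f1 x y) /\
                             is_derive y 1 (f x) (f2 x y)) ->
  hol f1 -> hol f2 -> C1 f.
Proof.
move=> df h1 h2; have E1 x y : I x -> I y -> f1 x y = px f x y.
  by move=> Ix Iy; have [d1 _] := df x y Ix Iy; rewrite /px derive_val.
have E2 x y : I x -> I y -> f2 x y = py f x y.
  by move=> Ix Iy; have [_ d2] := df x y Ix Iy; rewrite /py derive_val.
split; last by split; [exact: hol_ext h1|exact: hol_ext h2].
by move=> x y Ix Iy; rewrite -E1 // -E2 //; exact: df.
Qed.

Lemma between_I s x x' : I x -> I x' -> Num.min x x' <= s <= Num.max x x' -> I s.
Proof.
move=> /andP[a1 a2] /andP[b1 b2] /andP[c1 c2]; apply/andP; split.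
  by apply: le_trans c1; rewrite le_min a1.
by apply: (le_trans c2); rewrite ge_max a2.
Qed.

Lemma C1_lip f : C1 f -> exists2 A, 0 <= A & forall x y x' y', I x -> I y -> I x' -> I y' ->
  `|f x' y' - f x y| <= A * (`|x' - x| + `|y' - y|).
Proof.
move=> [df [/hol_bounded[A A0 hA] /hol_bounded[B B0 hB]]].
exists (A + B); first by rewrite addr_ge0 // ltW.
move=> x y x' y' Ix Iy Ix' Iy'.
have e1 : `|f x' y - f x y| <= A * `|x' - x|.
  apply: (@mvt_bound R (fun t => f t y) (px f ^~ y)) => s /(between_I Ix Ix') Is.
  by split; [exact: (proj1 (df _ _ Is Iy))|exact: hA].
have e2 : `|f x' y' - f x' y| <= B * `|y' - y|.
  apply: (@mvt_bound R (f x') (py f x')) => s /(between_I Iy Iy') Is.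
  by split; [exact: (proj2 (df _ _ Ix' Is))|exact: hB].
rewrite -(subrKA (f x' y)) (le_trans (ler_normD _ _)) //.
have := mulr_ge0 (ltW A0) (normr_ge0 (y' - y)).
have := mulr_ge0 (ltW B0) (normr_ge0 (x' - x)); lra.
Qed.

Lemma C1_hol f : C1 f -> hol f.
Proof.
move=> /C1_lip[A A0 h]; exists A => // x y x' y' Ix Iy Ix' Iy'.
rewrite (le_trans (h _ _ _ _ _ _ _ _)) // ler_wpM2l // lerD ?le_pow //.
Qed.

Lemma C1_cst c : C1 (fun _ _ => c).
Proof.
apply: (@C1_intro _ (fun _ _ => 0) (fun _ _ => 0)); [|exact: hol_cst..].
by move=> x y _ _; split; exact: is_derive_cst.
Qed.

Lemma C1D f g : C1 f -> C1 g -> C1 (fun x y => f x y + g x y).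
Proof.
move=> [df [f1 f2]] [dg [g1 g2]].
apply: (C1_intro _ (holD f1 g1) (holD f2 g2)) => x y Ix Iy.
have [a1 a2] := df x y Ix Iy; have [c1 c2] := dg x y Ix Iy.
by split; apply: is_deriveD.
Qed.

Lemma C1M f g : C1 f -> C1 g -> C1 (fun x y => f x y * g x y).
Proof.
move=> Cf Cg; have hf := C1_hol Cf; have hg := C1_hol Cg.
move: Cf Cg => [df [f1 f2]] [dg [g1 g2]].
apply: (C1_intro _ (holD (holM hf g1) (holM hg f1)) (holD (holM hf g2) (holM hg f2))) => x y Ix Iy.
have [a1 a2] := df x y Ix Iy; have [c1 c2] := dg x y Ix Iy.
by split; apply: is_deriveM.
Qed.

Lemma C1N f : C1 f -> C1 (fun x y => - f x y).
Proof.
move=> [df [f1 f2]].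
apply: (C1_intro _ (holN f1) (holN f2)) => x y Ix Iy.
have [a1 a2] := df x y Ix Iy.
by split; apply: is_deriveN.
Qed.

Lemma C1V f c : 0 < c -> (forall x y, I x -> I y -> c <= f x y) -> C1 f ->
  C1 (fun x y => (f x y)^-1).
Proof.
move=> c0 fc Cf; have hV := holV c0 fc (C1_hol Cf).
move: Cf => [df [f1 f2]].
have hVV := holN (holM hV hV).
apply: (C1_intro _ (holM hVV f1) (holM hVV f2)) => x y Ix Iy.
have [a1 a2] := df x y Ix Iy.
have f0 : f x y != 0 by rewrite gt_eqF // (lt_le_trans c0) // fc.
have E (d : R) : - (f x y) ^- 2 *: d = - ((f x y)^-1 * (f x y)^-1) * d.
  by rewrite -invfM -expr2.
rewrite -!E; split; last exact: is_deriveV.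
exact: (@is_deriveV R (fun t => f t y)).
Qed.

Lemma C1_sqrt f c : 0 < c -> (forall x y, I x -> I y -> c <= f x y) -> C1 f ->
  C1 (fun x y => Num.sqrt (f x y)).
Proof.
move=> c0 fc Cf; have hs := hol_sqrt c0 fc (C1_hol Cf).
have s0 : 0 < 2 * Num.sqrt c by rewrite mulr_gt0 // sqrtr_gt0.
have hV : hol (fun x y => (2 * Num.sqrt (f x y))^-1).
  apply: (holV s0); last by apply: holM => //; exact: hol_cst.
  by move=> x y Ix Iy; rewrite ler_wpM2l // ler_wsqrtr // fc.
move: Cf => [df [f1 f2]].
apply: (C1_intro _ (holM hV f1) (holM hV f2)) => x y Ix Iy.
have [a1 a2] := df x y Ix Iy.
have f0 : 0 < f x y by rewrite (lt_le_trans c0) // fc.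
have ds := is_derive1_sqrt f0.
split; last exact: (@is_derive1_comp R Num.sqrt (f x)).
exact: (@is_derive1_comp R Num.sqrt (fun t => f t y)).
Qed.

(** The second difference is the increment over [h] of [f (s + h) y - f s y], whose derivative in
    [s] is at most [M * h^b] by Hoelder continuity. *)
Lemma C1_diff2x f : C1 f -> exists2 A, 0 <= A & forall h x y : R, 0 < h -> I x -> I (x + h + h) ->
  I y -> `|f (x + h + h) y - 2 * f (x + h) y + f x y| <= A * (h * h `^ b).
Proof.
move=> [df [[M M0 hM] _]]; exists M => // h x y h0 Ix Ixh Iy.
have := @mvt_bound R (fun s => f (s + h) y - f s y)
  (fun s => px f (s + h) y - px f s y) (M * h `^ b) x (x + h).
have xh : x <= x + h by rewrite lerDl ltW.
rewrite (min_l xh) (max_r xh) => H.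
have -> : f (x + h + h) y - 2 * f (x + h) y + f x y =
  f (x + h + h) y - f (x + h) y - (f (x + h) y - f x y) by ring.
apply: (le_trans (H _)); last first.
  by rewrite (addrC x) addrK gtr0_norm // mulrAC -mulrA.
move=> s /andP[s1 s2].
have Is : I s by move: Ix Ixh => /andP[? ?] /andP[? ?]; apply/andP; split; lra.
have Ish : I (s + h) by move: Ix Ixh => /andP[? ?] /andP[? ?]; apply/andP; split; lra.
split.
  apply: is_deriveB; last exact: (proj1 (df _ _ Is Iy)).
  have d1 := proj1 (df _ _ Ish Iy).
  have d2 : is_derive s 1 (fun t => t + h) (1 : R).
    by rewrite -[X in is_derive _ _ _ X]addr0; apply: is_deriveD.
  have := @is_derive1_comp R (fun t => f t y) (fun t => t + h) s _ _ d1 d2.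
  by rewrite mulr1.
rewrite (le_trans (hM _ _ _ _ Is Iy Ish Iy)) // (addrC s) addrK gtr0_norm //.
by rewrite subrr normr0 powR0 ?addr0 // gt_eqF //; case/andP: b01.
Qed.

Lemma C1_swap f : C1 f -> C1 (fun x y => f y x).
Proof.
have hs g : hol g -> hol (fun x y => g y x).
  move=> [M M0 h]; exists M => // x y x' y' *.
  by rewrite (le_trans (h _ _ _ _ _ _ _ _)) // addrC.
move=> [df [f1 f2]]; apply: (C1_intro _ (hs _ f2) (hs _ f1)) => x y Ix Iy.
by have [] := df y x Iy Ix.
Qed.

Lemma C1_diff2y f : C1 f -> exists2 A, 0 <= A & forall h x y : R, 0 < h -> I x -> I y ->
  I (y + h + h) -> `|f x (y + h + h) - 2 * f x (y + h) + f x y| <= A * (h * h `^ b).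
Proof.
move=> /C1_swap/C1_diff2x[A A0 h]; exists A => // k x y k0 Ix Iy Iyk.
exact: (h k y x).
Qed.

(** Differentiability with a remainder uniform in the base point, as [chart_tame] needs. *)
Definition strong_diff (J : R -> Prop) (f f1 f2 : R -> R -> R) :=
  exists2 M, 0 <= M & forall x y a c, J x -> J y -> J (x + a) -> J (y + c) ->
  `|f (x + a) (y + c) - f x y - (f1 x y * a + f2 x y * c)| <=
  M * (`|a| + `|c|) * (`|a| `^ b + `|c| `^ b).

Lemma is_derive_mulc (c s : R) : is_derive s 1 (fun t : R => c * t) c.
Proof.
have := @is_deriveZ R R R id c s 1 1 (is_derive_id s 1).
by rewrite /GRing.scale /= mulr1.
Qed.

Lemma between_dist (s x x' : R) : Num.min x x' <= s <= Num.max x x' -> `|s - x| <= `|x' - x|.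
Proof.
have [xx|xx] := leP x x' => /andP[h1 h2].
  by rewrite !ger0_norm ?subr_ge0 // lerD2r.
by rewrite !ler0_norm ?subr_le0 ?(ltW xx) // lerN2 lerD2r.
Qed.

Let ge0_pow (s t : R) : `|s| <= `|t| -> `|s| `^ b <= `|t| `^ b.
Proof. by move=> st; apply: ge0_ler_powR; rewrite ?nnegrE //; case/andP: b01 => /ltW. Qed.

Let pow0 : 0 `^ b = 0 :> R.
Proof. by rewrite powR0 // gt_eqF //; case/andP: b01. Qed.

Lemma C1_strong_diff f : C1 f -> strong_diff I f (px f) (py f).
Proof.
move=> [df [[M M0 hM] [K K0 hK]]]; exists (M + K); first by rewrite addr_ge0.
move=> x y a c Ix Iy Ixa Iyc.
have e1 : `|f (x + a) y - f x y - px f x y * a| <= M * `|a| `^ b * `|a|.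
  have := @mvt_bound R (fun t => f t y - px f x y * t) (fun t => px f t y - px f x y)
    (M * `|a| `^ b) x (x + a).
  have -> : f (x + a) y - px f x y * (x + a) - (f x y - px f x y * x) =
    f (x + a) y - f x y - px f x y * a by ring.
  have xa : x + a - x = a by rewrite (addrC x) addrK.
  rewrite xa; apply => s hs; have Is := between_I Ix Ixa hs; split.
    by apply: is_deriveB; [exact: (proj1 (df _ _ Is Iy))|exact: is_derive_mulc].
  rewrite (le_trans (hM _ _ _ _ Ix Iy Is Iy)) // subrr normr0 pow0 addr0.
  by rewrite ler_wpM2l // ge0_pow // -xa; exact: between_dist.
have e2 : `|f (x + a) (y + c) - f (x + a) y - py f x y * c| <=
    K * (`|a| `^ b + `|c| `^ b) * `|c|.
  have := @mvt_bound R (fun t => f (x + a) t - py f x y * t)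
    (fun t => py f (x + a) t - py f x y) (K * (`|a| `^ b + `|c| `^ b)) y (y + c).
  have -> : f (x + a) (y + c) - py f x y * (y + c) - (f (x + a) y - py f x y * y) =
    f (x + a) (y + c) - f (x + a) y - py f x y * c by ring.
  have xa : x + a - x = a by rewrite (addrC x) addrK.
  have yc : y + c - y = c by rewrite (addrC y) addrK.
  rewrite yc; apply => s hs; have Is := between_I Iy Iyc hs; split.
    by apply: is_deriveB; [exact: (proj2 (df _ _ Ixa Is))|exact: is_derive_mulc].
  rewrite (le_trans (hK _ _ _ _ Ix Iy Ixa Is)) // xa.
  by rewrite ler_wpM2l // lerD2l ge0_pow // -yc; exact: between_dist.
have -> : f (x + a) (y + c) - f x y - (px f x y * a + py f x y * c) =
  (f (x + a) y - f x y - px f x y * a) +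
  (f (x + a) (y + c) - f (x + a) y - py f x y * c) by ring.
apply: (le_trans (ler_normD _ _)).
have p1 := powR_ge0 `|a| b; have p2 := powR_ge0 `|c| b.
have n1 := normr_ge0 a; have n2 := normr_ge0 c.
set A := `|a| in e1 e2 p1 n1 *; set C := `|c| in e1 e2 p2 n2 *.
set P := A `^ b in e1 e2 p1 *; set Q := C `^ b in e1 e2 p2 *.
have z1 : 0 <= M * (A * Q) by rewrite !mulr_ge0.
have z2 : 0 <= M * (C * (P + Q)) by rewrite !mulr_ge0 // addr_ge0.
have z3 : 0 <= K * (A * (P + Q)) by rewrite !mulr_ge0 // addr_ge0.
have -> : (M + K) * (A + C) * (P + Q) = M * P * A + M * (A * Q) + M * (C * (P + Q)) +
   (K * (P + Q) * C + K * (A * (P + Q))) by ring.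
lra.
Qed.

(** The integral from 0 is differentiated at interior points only; hence the smaller interval [Jq]
    in [poincare]. *)
Lemma primitive (f : R -> R) : (forall t, I t -> {for t, continuous f}) ->
  exists F : R -> R, forall t : R, 0 < t < 1 -> is_derive t 1 F (f t).
Proof.
move=> fc; pose mu := @lebesgue_measure R.
have fi : mu.-integrable `[0, 1] (EFin \o f).
  apply: continuous_compact_integrable; first exact: segment_compact.
  apply/continuous_in_subspaceT => t; rewrite inE /= in_itv /= => t01.
  exact: fc.
exists (fun x => (\int[mu]_(t in [set` `[0, x]]) f t)%R) => t /andP[t0 t1].
have It : I t by rewrite /I /unitI !ltW.
have [d1 d2] := @continuous_FTC1_closed R f 0 t 1 t1 fi t0 (fc t It).
by rewrite derive1E in d2; exact: DeriveDef d1 d2.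
Qed.

Let Jq (x : R) := 4^-1 <= x <= 3 / 4.

(** The potential integrates [f] along the line [y = 1/4], then [g] vertically. It is shown directly
    to be strongly differentiable, which avoids differentiation under the integral sign. *)
Lemma poincare f g : C1 f -> C1 g ->
  (forall x y, I x -> I y -> px g x y = py f x y) ->
  exists v, strong_diff Jq v f g.
Proof.
move=> Cf Cg fg; have cont y h : I y -> C1 h -> forall x, I x -> {for x, continuous (fun t => h t y)}.
  move=> Iy [dh _] x Ix; apply: differentiable_continuous; apply/derivable1_diffP.
  by have [[]] := dh x y Ix Iy.
have cont' x h : I x -> C1 h -> forall y, I y -> {for y, continuous (h x)}.
  move=> Ix [dh _] y Iy; apply: differentiable_continuous; apply/derivable1_diffP.
  by have [_ []] := dh x y Ix Iy.
have I4 : I 4^-1 by apply/andP; split; lra.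
have [A dA] := primitive (cont _ _ I4 Cf).
have [B dB] : exists B : R -> R -> R, forall x, I x -> forall y : R, 0 < y < 1 -> is_derive y 1 (B x) (g x y).
  have H x : exists B : R -> R, I x -> forall y : R, 0 < y < 1 -> is_derive y 1 B (g x y).
    have [Ix|nIx] := pselect (I x); last by exists (fun=> 0).
    by have [B hB] := primitive (cont' _ _ Ix Cg); exists B.
  by have [B hB] := choice H; exists B.
have [M M0 hM] := C1_hol Cf; have [K K0 hK] := C1_hol Cg.
move: (Cg) => [dg [[L L0 hL] _]]; have [df _] := Cf.
exists (fun x y => A x + (B x y - B x 4^-1)); exists (M + K + L).
  by rewrite !addr_ge0.
move=> x y a c Jx Jy Jxa Jyc.
have JI s : Jq s -> I s by move=> /andP[? ?]; apply/andP; split; lra.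
have Jo s : Jq s -> 0 < s < 1 by move=> /andP[? ?]; apply/andP; split; lra.
have J4 : Jq 4^-1 by apply/andP; split; lra.
have Jb s p r : Jq p -> Jq r -> Num.min p r <= s <= Num.max p r -> Jq s.
  move=> /andP[a1 a2] /andP[b1 b2] /andP[c1 c2]; apply/andP; split.
    by apply: le_trans c1; rewrite le_min a1.
  by apply: (le_trans c2); rewrite ge_max a2.
have xa : x + a - x = a by rewrite (addrC x) addrK.
have yc : y + c - y = c by rewrite (addrC y) addrK.
have e1 : `|A (x + a) - A x - f x 4^-1 * a| <= M * `|a| `^ b * `|a|.
  have := @mvt_bound R (fun t => A t - f x 4^-1 * t) (fun t => f t 4^-1 - f x 4^-1)
    (M * `|a| `^ b) x (x + a).
  have -> : A (x + a) - f x 4^-1 * (x + a) - (A x - f x 4^-1 * x) =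
    A (x + a) - A x - f x 4^-1 * a by ring.
  rewrite xa; apply => s hs; have Js := Jb _ _ _ Jx Jxa hs; split.
    by apply: is_deriveB; [exact: dA (Jo _ Js)|exact: is_derive_mulc].
  rewrite (le_trans (hM _ _ _ _ (JI _ Jx) I4 (JI _ Js) I4)) // subrr normr0 pow0 addr0.
  by rewrite ler_wpM2l // ge0_pow // -xa; exact: between_dist.
have e2 : `|B (x + a) (y + c) - B (x + a) y - g x y * c| <=
    K * (`|a| `^ b + `|c| `^ b) * `|c|.
  have := @mvt_bound R (fun t => B (x + a) t - g x y * t)
    (fun t => g (x + a) t - g x y) (K * (`|a| `^ b + `|c| `^ b)) y (y + c).
  have -> : B (x + a) (y + c) - g x y * (y + c) - (B (x + a) y - g x y * y) =
    B (x + a) (y + c) - B (x + a) y - g x y * c by ring.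
  rewrite yc; apply => s hs; have Js := Jb _ _ _ Jy Jyc hs; split.
    by apply: is_deriveB; [exact: dB (JI _ Jxa) _ (Jo _ Js)|exact: is_derive_mulc].
  rewrite (le_trans (hK _ _ _ _ (JI _ Jx) (JI _ Jy) (JI _ Jxa) (JI _ Js))) // xa.
  by rewrite ler_wpM2l // lerD2l ge0_pow // -yc; exact: between_dist.
(* The mean value theorem in [t] for [B (x + a) t - B x t - f x t * a]. Its derivative is a
   first-order error of [g] in [x], because [py f = px g], and a second use of the theorem bounds
   that error. *)
have e3 : `|B (x + a) y - B x y - (B (x + a) 4^-1 - B x 4^-1) - (f x y - f x 4^-1) * a| <=
    L * `|a| `^ b * `|a|.
  have H := @mvt_bound R (fun t => B (x + a) t - B x t - f x t * a)
    (fun t => g (x + a) t - g x t - py f x t * a) (L * `|a| `^ b * `|a|) 4^-1 y.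
  have -> : B (x + a) y - B x y - (B (x + a) 4^-1 - B x 4^-1) - (f x y - f x 4^-1) * a =
    B (x + a) y - B x y - f x y * a - (B (x + a) 4^-1 - B x 4^-1 - f x 4^-1 * a) by ring.
  apply: (le_trans (H _)); last first.
    rewrite ler_piMr ?mulr_ge0 ?powR_ge0 //.
    by move: Jy => /andP[? ?]; rewrite ler_norml; apply/andP; split; lra.
  move=> s hs; have Js := Jb _ _ _ J4 Jy hs; have Is := JI _ Js; split.
    apply: is_deriveB; first by apply: is_deriveB; apply: dB; rewrite ?JI ?Jo.
    have ds := proj2 (df _ _ (JI _ Jx) Is).
    have := @is_deriveZ R R R (f x) a s 1 (py f x s) ds.
    have -> : (fun t => f x t * a) = a \*: f x by apply/funext => t; rewrite mulrC.
    by rewrite /GRing.scale /= mulrC.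
  have := @mvt_bound R (fun t => g t s - py f x s * t) (fun t => px g t s - py f x s)
    (L * `|a| `^ b) x (x + a).
  have -> : g (x + a) s - py f x s * (x + a) - (g x s - py f x s * x) =
    g (x + a) s - g x s - py f x s * a by ring.
  rewrite xa; apply => r hr; have Jr := Jb _ _ _ Jx Jxa hr; split.
    apply: is_deriveB; last exact: is_derive_mulc.
    exact: (proj1 (dg _ _ (JI _ Jr) Is)).
  rewrite -fg ?JI // (le_trans (hL _ _ _ _ (JI _ Jx) Is (JI _ Jr) Is)) //.
  rewrite subrr normr0 pow0 addr0 ler_wpM2l // ge0_pow // -xa; exact: between_dist.
have -> : A (x + a) + (B (x + a) (y + c) - B (x + a) 4^-1) - (A x + (B x y - B x 4^-1)) -
   (f x y * a + g x y * c) = (A (x + a) - A x - f x 4^-1 * a) +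
   (B (x + a) (y + c) - B (x + a) y - g x y * c) +
   (B (x + a) y - B x y - (B (x + a) 4^-1 - B x 4^-1) - (f x y - f x 4^-1) * a) by ring.
apply: (le_trans (ler_normD _ _)); apply: (le_trans (lerD (ler_normD _ _) (lexx _))).
have p1 := powR_ge0 `|a| b; have p2 := powR_ge0 `|c| b.
have n1 := normr_ge0 a; have n2 := normr_ge0 c.
set S := `|a| in e1 e2 e3 p1 n1 *; set T := `|c| in e1 e2 e3 p2 n2 *.
set P := S `^ b in e1 e2 e3 p1 *; set Q := T `^ b in e1 e2 e3 p2 *.
have z1 : 0 <= (M + L) * (S * Q) by rewrite !mulr_ge0 // addr_ge0.
have z2 : 0 <= (M + L) * (T * (P + Q)) by rewrite !mulr_ge0 // addr_ge0.
have z3 : 0 <= K * (S * (P + Q)) by rewrite !mulr_ge0 // addr_ge0.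
have -> : (M + K + L) * (S + T) * (P + Q) = M * P * S + L * P * S + (M + L) * (S * Q) +
  (M + L) * (T * (P + Q)) + (K * (P + Q) * T + K * (S * (P + Q))) by ring.
lra.
Qed.

End square_class.

Lemma strong_diff_eps {R : realType} (b : R) (J : R -> Prop) f f1 f2 (e : R) : 0 < b ->
  strong_diff b J f f1 f2 -> 0 < e ->
  exists2 r : R, 0 < r & forall x y a c : R, J x -> J y -> J (x + a) -> J (y + c) ->
    `|a| + `|c| <= r ->
    `|f (x + a) (y + c) - f x y - (f1 x y * a + f2 x y * c)| <= e * (`|a| + `|c|).
Proof.
move=> b0 [M M0 h] e0; pose d := e / (2 * (M + 1)).
have M1 : 0 < M + 1 by rewrite ltr_wpDl.
have d0 : 0 < d by rewrite divr_gt0 // mulr_gt0.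
exists (d `^ b^-1); first by rewrite powR_gt0.
move=> x y a c Jx Jy Jxa Jyc ac; apply: (le_trans (h _ _ _ _ Jx Jy Jxa Jyc)).
have S0 : 0 <= `|a| + `|c| by rewrite addr_ge0.
have pw (s : R) : 0 <= s -> s <= d `^ b^-1 -> s `^ b <= d.
  move=> s0 sd; have -> : d = (d `^ b^-1) `^ b.
    by rewrite -powRrM mulVf ?gt_eqF // powRr1 // ltW.
  by apply: ge0_ler_powR; rewrite ?nnegrE ?powR_ge0 ?(ltW b0).
have h1 : `|a| `^ b <= d by apply: pw => //; rewrite (le_trans _ ac) // lerDl.
have h2 : `|c| `^ b <= d by apply: pw => //; rewrite (le_trans _ ac) // lerDr.
rewrite mulrAC; apply: ler_wpM2r => //.
apply: (@le_trans _ _ ((M + 1) * (2 * d))).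
  by apply: ler_pM; rewrite ?addr_ge0 ?powR_ge0 //; lra.
by rewrite /d le_eqVlt; apply/orP; left; apply/eqP; field; rewrite gt_eqF.
Qed.

(** * Conjugate functions for a metric on the unit square *)

Section conjugate.
Variables (R : realType) (b : R).
Hypothesis b01 : 0 < b <= 1.
Variables (g11 g12 g22 : R -> R -> R) (m : R).
Hypothesis m0 : 0 < m.
Let I := @unitI R.
Let det x y := g11 x y * g22 x y - g12 x y * g12 x y.
Hypothesis g11_ge : forall x y, I x -> I y -> m <= g11 x y.
Hypothesis det_ge : forall x y, I x -> I y -> m <= det x y.
Hypothesis Cg11 : C1 b g11.
Hypothesis Cg12 : C1 b g12.
Hypothesis Cg22 : C1 b g22.

Definition metric_sqrt x y := Num.sqrt (det x y).
(* The isothermal coordinates [w] of the metric satisfy [w_y = metric_tau * w_x]. *)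
Definition metric_tau x y : R[i] :=
  (g12 x y / g11 x y) +i* (metric_sqrt x y / g11 x y).
(** With [flux2], the components of the vector [sqrt det * g^-1 * grad u], the inverse being written
    with the adjugate. Its divergence is the Laplace-Beltrami operator up to a nonvanishing
    factor. *)
Definition flux1 (u : R -> R -> R) x y :=
  (g22 x y * px u x y - g12 x y * py u x y) * (metric_sqrt x y)^-1.
Definition flux2 (u : R -> R -> R) x y :=
  (g11 x y * py u x y - g12 x y * px u x y) * (metric_sqrt x y)^-1.

Let Cdet : C1 b det.
Proof. exact: C1D (C1M b01 Cg11 Cg22) (C1N b01 (C1M b01 Cg12 Cg12)). Qed.

Let Csqrt : C1 b metric_sqrt. Proof. exact: (@C1_sqrt R b b01 det m m0 det_ge Cdet). Qed.

Let sqrt_ge x y : I x -> I y -> Num.sqrt m <= metric_sqrt x y.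
Proof. by move=> Ix Iy; rewrite ler_wsqrtr // det_ge. Qed.

Let sm0 : 0 < Num.sqrt m. Proof. by rewrite sqrtr_gt0. Qed.

Let CVsqrt : C1 b (fun x y => (metric_sqrt x y)^-1).
Proof. exact: (@C1V R b b01 metric_sqrt _ sm0 sqrt_ge Csqrt). Qed.

Let CVg11 : C1 b (fun x y => (g11 x y)^-1).
Proof. exact: (@C1V R b b01 g11 _ m0 g11_ge Cg11). Qed.

Lemma C1_flux1 u : C1 b (px u) -> C1 b (py u) -> C1 b (flux1 u).
Proof.
move=> Cx Cy; have h1 := C1M b01 Cg22 Cx; have h2 := C1N b01 (C1M b01 Cg12 Cy).
exact: (C1M b01 (C1D h1 h2) CVsqrt).
Qed.

Lemma C1_flux2 u : C1 b (px u) -> C1 b (py u) -> C1 b (flux2 u).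
Proof.
move=> Cx Cy; have h1 := C1M b01 Cg11 Cy; have h2 := C1N b01 (C1M b01 Cg12 Cx).
exact: (C1M b01 (C1D h1 h2) CVsqrt).
Qed.

Let J (x : R) := 3 / 8 <= x <= 5 / 8.

Let JI x : J x -> I x. Proof. by move=> /andP[? ?]; apply/andP; split; lra. Qed.

(** The equation says that [- flux2 dx + flux1 dy] is closed, so that it has a potential [v]. The
    complex identity between the derivatives rests on [metric_sqrt] squared being the
    determinant. *)
Lemma conjugate u : C1 b u -> C1 b (px u) -> C1 b (py u) ->
  (forall x y, I x -> I y -> px (flux1 u) x y + py (flux2 u) x y = 0) ->
  exists F G : R -> R -> R[i], exists B : R,
  [/\ forall x y, complex.Re (F x y) = u x y,
      forall x y, J x -> J y -> nc (F x y) <= B,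
      forall x y, J x -> J y -> nc (G x y) <= B &
      forall e : R, 0 < e -> exists2 r : R, 0 < r & forall x y a c : R,
        J x -> J y -> J (x + a) -> J (y + c) -> `|a| + `|c| <= r ->
        nc (F (x + a) (y + c) - F x y - G x y * (a%:C + metric_tau x y * c%:C)) <=
        e * (`|a| + `|c|)].
Proof.
move=> Cu Cx Cy Lap; have b0 : 0 < b by case/andP: b01.
have Cf1 := C1_flux1 Cx Cy; have Cf2 := C1N b01 (C1_flux2 Cx Cy).
have [x y Ix Iy|v hv] := poincare b01 Cf2 Cf1.
  have [d2 _] := C1_flux2 Cx Cy; have [_ d2'] := d2 x y Ix Iy.
  have -> : py (fun x y => - flux2 u x y) x y = - py (flux2 u) x y.
    by rewrite /py deriveN //; exact: ex_derive.
  by apply/eqP; rewrite -addr_eq0 Lap.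
have hu := C1_strong_diff b01 Cu.
(* [v] is the conjugate function: [F] satisfies the same Beltrami equation as
   the isothermal coordinate. *)
pose F x y : R[i] := u x y +i* v x y.
pose G x y : R[i] := px u x y +i* - flux2 u x y.
have [B1 B10 hB1] := hol_bounded b01 (C1_hol b01 Cu).
have [B3 B30 hB3] := hol_bounded b01 (C1_hol b01 Cx).
have [B4 B40 hB4] := hol_bounded b01 (C1_hol b01 Cf2).
(* Nothing is known of [v] but its expansion; taken from the centre of the square to an arbitrary
   point, it gives a bound. *)
have [B2 hB2] : exists B2 : R, forall x y, J x -> J y -> `|v x y| <= B2.
  have J2 : J 2^-1 by apply/andP; split; lra.
  have [r r0 hr] := strong_diff_eps b0 hv ltr01.
  move: hv => [M M0 hM].
  have [B5 B50 hB5] := hol_bounded b01 (C1_hol b01 Cf1).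
  exists (`|v 2^-1 2^-1| + M * 2 * 2 + B4 + B5) => x y Jx Jy.
  have Jq s : J s -> 4^-1 <= s <= 3 / 4 by move=> /andP[? ?]; apply/andP; split; lra.
  have := hM 2^-1 2^-1 (x - 2^-1) (y - 2^-1); rewrite ![2^-1 + _]addrC !subrK.
  move=> /(_ (Jq _ J2) (Jq _ J2) (Jq _ Jx) (Jq _ Jy)).
  have n1 s : J s -> `|s - 2^-1| <= 1 by move=> /andP[? ?]; rewrite ler_norml; apply/andP; split; lra.
  have p1 s : J s -> `|s - 2^-1| `^ b <= 1.
    move=> Js; apply: (@le_trans _ _ (1 `^ b)); last by rewrite powR1.
    by apply: ge0_ler_powR; rewrite ?nnegrE //; [exact: ltW|exact: n1].
  have h1 : M * (`|x - 2^-1| + `|y - 2^-1|) * (`|x - 2^-1| `^ b + `|y - 2^-1| `^ b) <= M * 2 * 2.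
    apply: ler_pM; rewrite ?mulr_ge0 ?addr_ge0 ?powR_ge0 //.
      by rewrite ler_wpM2l //; have := n1 _ Jx; have := n1 _ Jy; lra.
    by have := p1 _ Jx; have := p1 _ Jy; lra.
  move=> h2; have {h1 h2} h3 := le_trans h2 h1.
  have k1 : `|- flux2 u 2^-1 2^-1 * (x - 2^-1)| <= B4.
    rewrite normrM -[leRHS]mulr1 ler_pM ?n1 //; exact: hB4 (JI J2) (JI J2).
  have k2 : `|flux1 u 2^-1 2^-1 * (y - 2^-1)| <= B5.
    rewrite normrM -[leRHS]mulr1 ler_pM ?n1 //; exact: hB5 (JI J2) (JI J2).
  move: h3 k1 k2; set p := - flux2 u 2^-1 2^-1 * _; set q := flux1 u 2^-1 2^-1 * _.
  set z := v 2^-1 2^-1.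
  have := ler_norm z; have := ler_norm (- z); rewrite normrN.
  rewrite !ler_norml => ? ? /andP[? ?] /andP[? ?] /andP[? ?].
  by apply/andP; split; lra.
exists F, G, (Num.max (B1 + B2) (B3 + B4)); split=> //.
- move=> x y Jx Jy; rewrite le_max; apply/orP; left.
  apply: (le_trans (nc_le _)); apply: lerD; last exact: hB2.
  exact: hB1 (JI Jx) (JI Jy).
- move=> x y Jx Jy; rewrite le_max; apply/orP; right.
  apply: (le_trans (nc_le _)); apply: lerD.
    exact: hB3 (JI Jx) (JI Jy).
  exact: hB4 (JI Jx) (JI Jy).
move=> e e0; have e2 : 0 < e / 2 by lra.
have [r1 r10 h1] := strong_diff_eps b0 hu e2.
have [r2 r20 h2] := strong_diff_eps b0 hv e2.
exists (Num.min r1 r2); first by rewrite lt_min r10.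
move=> x y a c Jx Jy Jxa Jyc ac.
have {}h1 := h1 x y a c (JI Jx) (JI Jy) (JI Jxa) (JI Jyc)
  (ltac:(by rewrite (le_trans ac) // ge_min lexx)).
have Jq s : J s -> 4^-1 <= s <= 3 / 4 by move=> /andP[? ?]; apply/andP; split; lra.
have {}h2 := h2 x y a c (Jq _ Jx) (Jq _ Jy) (Jq _ Jxa) (Jq _ Jyc)
  (ltac:(by rewrite (le_trans ac) // ge_min lexx orbT)).
have s0 : metric_sqrt x y != 0.
  by rewrite gt_eqF // (lt_le_trans sm0) // sqrt_ge //; exact: JI.
have g0 : g11 x y != 0 by rewrite gt_eqF // (lt_le_trans m0) // g11_ge //; exact: JI.
have ss : metric_sqrt x y * metric_sqrt x y = g11 x y * g22 x y - g12 x y * g12 x y.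
  by rewrite -expr2 sqr_sqrtr // ltW // (lt_le_trans m0) // det_ge //; exact: JI.
have E : F (x + a) (y + c) - F x y - G x y * (a%:C + metric_tau x y * c%:C) =
  (u (x + a) (y + c) - u x y - (px u x y * a + py u x y * c)) +i*
  (v (x + a) (y + c) - v x y - (- flux2 u x y * a + flux1 u x y * c)).
  have ee : metric_sqrt x y * metric_sqrt x y = metric_sqrt x y ^+ 2 by rewrite expr2.
  rewrite /F /G /metric_tau; apply/eqP; rewrite eq_complex /=; apply/andP; split; apply/eqP.
    rewrite /flux2; move: (metric_sqrt x y) s0 => s s0'.
    by field; rewrite s0' g0.
  rewrite /flux1 /flux2; move: (metric_sqrt x y) s0 ss => s s0' ss.
  (* Eliminating [g22] by the determinant relation leaves a rational identity. *)
  have g22E : g22 x y = (s * s + g12 x y * g12 x y) / g11 x y.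
    by rewrite ss subrK mulrC mulKf.
  by rewrite g22E; field; rewrite s0' g0.
rewrite E (le_trans (nc_le _)) //= (_ : e * (`|a| + `|c|) = e / 2 * (`|a| + `|c|) + e / 2 * (`|a| + `|c|)).
  exact: lerD.
by field.
Qed.

Lemma metric_tau_C1 : exists2 A, 0 < A &
  [/\ forall x y x' y', I x -> I y -> I x' -> I y' ->
        nc (metric_tau x' y' - metric_tau x y) <= A * (`|x' - x| + `|y' - y|),
      forall h x y : R, 0 < h -> I x -> I (x + h + h) -> I y ->
        nc (metric_tau (x + h + h) y - 2 * metric_tau (x + h) y + metric_tau x y) <=
        A * (h * h `^ b) &
      forall h x y : R, 0 < h -> I x -> I y -> I (y + h + h) ->
        nc (metric_tau x (y + h + h) - 2 * metric_tau x (y + h) + metric_tau x y) <=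
        A * (h * h `^ b)].
Proof.
have Cr : C1 b (fun x y => g12 x y / g11 x y) by exact: (C1M b01 Cg12 CVg11).
have Ci : C1 b (fun x y => metric_sqrt x y / g11 x y) by exact: (C1M b01 Csqrt CVg11).
have [A1 A10 h1] := C1_lip b01 Cr; have [A2 A20 h2] := C1_lip b01 Ci.
have [A3 A30 h3] := C1_diff2x b01 Cr; have [A4 A40 h4] := C1_diff2x b01 Ci.
have [A5 A50 h5] := C1_diff2y b01 Cr; have [A6 A60 h6] := C1_diff2y b01 Ci.
exists (A1 + A2 + A3 + A4 + A5 + A6 + 1); first by lra.
split.
- move=> x y x' y' Ix Iy Ix' Iy'; apply: (le_trans (nc_le _)); rewrite ReB ImB /=.
  have := h1 _ _ _ _ Ix Iy Ix' Iy'; have := h2 _ _ _ _ Ix Iy Ix' Iy'.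
  set S := `|x' - x| + _; have S0 : 0 <= S by rewrite addr_ge0.
  have -> : (A1 + A2 + A3 + A4 + A5 + A6 + 1) * S = A1 * S + A2 * S + (A3 + A4 + A5 + A6 + 1) * S by ring.
  have : 0 <= (A3 + A4 + A5 + A6 + 1) * S by rewrite mulr_ge0 // !addr_ge0.
  lra.
- move=> h x y hp Ix Ixh Iy; apply: (le_trans (nc_le _)).
  have -> : metric_tau (x + h + h) y - 2 * metric_tau (x + h) y + metric_tau x y =
    (g12 (x + h + h) y / g11 (x + h + h) y - 2 * (g12 (x + h) y / g11 (x + h) y) + g12 x y / g11 x y) +i*
    (metric_sqrt (x + h + h) y / g11 (x + h + h) y - 2 * (metric_sqrt (x + h) y / g11 (x + h) y) + metric_sqrt x y / g11 x y).
    by rewrite !mulr_natl !mulr2n; apply/eqP; rewrite eq_complex /= !eqxx.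
  rewrite /=; have := h3 _ _ _ hp Ix Ixh Iy; have := h4 _ _ _ hp Ix Ixh Iy.
  set S := h * _; have S0 : 0 <= S by rewrite mulr_ge0 ?powR_ge0 // ltW.
  have -> : (A1 + A2 + A3 + A4 + A5 + A6 + 1) * S = A3 * S + A4 * S + (A1 + A2 + A5 + A6 + 1) * S by ring.
  have : 0 <= (A1 + A2 + A5 + A6 + 1) * S by rewrite mulr_ge0 // !addr_ge0.
  lra.
- move=> h x y hp Ix Iy Iyh; apply: (le_trans (nc_le _)).
  have -> : metric_tau x (y + h + h) - 2 * metric_tau x (y + h) + metric_tau x y =
    (g12 x (y + h + h) / g11 x (y + h + h) - 2 * (g12 x (y + h) / g11 x (y + h)) + g12 x y / g11 x y) +i*
    (metric_sqrt x (y + h + h) / g11 x (y + h + h) - 2 * (metric_sqrt x (y + h) / g11 x (y + h)) + metric_sqrt x y / g11 x y).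
    by rewrite !mulr_natl !mulr2n; apply/eqP; rewrite eq_complex /= !eqxx.
  rewrite /=; have := h5 _ _ _ hp Ix Iy Iyh; have := h6 _ _ _ hp Ix Iy Iyh.
  set S := h * _; have S0 : 0 <= S by rewrite mulr_ge0 ?powR_ge0 // ltW.
  have -> : (A1 + A2 + A3 + A4 + A5 + A6 + 1) * S = A5 * S + A6 * S + (A1 + A2 + A3 + A4 + 1) * S by ring.
  have : 0 <= (A1 + A2 + A3 + A4 + 1) * S by rewrite mulr_ge0 // !addr_ge0.
  lra.
Qed.

Lemma unit_chart : exists (w : R -> R -> R[i]) (o1 o2 : R[i] -> R) (k eta L : R),
  [/\ [/\ 0 < k <= 1, 0 < eta & 0 <= L],
      forall z, w (o1 z) (o2 z) = z,
      forall x y, o1 (w x y) = x /\ o2 (w x y) = y,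
      (forall z z', eta * (`|o1 z' - o1 z| + `|o2 z' - o2 z|) <= nc (z' - z)) /\
      (forall x y x' y', nc (w x' y' - w x y) <= L * (`|x' - x| + `|y' - y|)) &
      forall u, C1 b u -> C1 b (px u) -> C1 b (py u) ->
        (forall x y, I x -> I y -> px (flux1 u) x y + py (flux2 u) x y = 0) ->
        exists B, forall c v, nc (c - w 2^-1 2^-1) <= eta / 16 -> nc v <= eta / 64 ->
        tame B 2 (fun t => u (2^-1 + k * (o1 (c + t%:C * v) - 2^-1))
                             (2^-1 + k * (o2 (c + t%:C * v) - 2^-1)))].
Proof.
have [A A0 [T1 T2 T3]] := metric_tau_C1.
have b0 : 0 < b by case/andP: b01.
have I2 : I 2^-1 by apply/andP; split; lra.
have tau0 : 0 < complex.Im (metric_tau 2^-1 2^-1).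
  apply: divr_gt0; first exact: lt_le_trans sm0 (sqrt_ge I2 I2).
  exact: lt_le_trans m0 (g11_ge I2 I2).
pose q : R := 2^-1 `^ b; pose K : R := 2048.
have K256 : 256 <= K by rewrite ler_nat.
have q0 : 0 < q by rewrite powR_gt0.
have q1 : q < 1.
  have -> : 1 = 1 `^ b by rewrite powR1.
  by rewrite /q gt0_ltr_powR ?nnegrE ?invr_ge0 // invf_lt1 // ltr1n.
have bl : forall s t : R, I s -> I t -> `|plateau t - plateau s| <= K * `|t - s|.
  by move=> s t; exact: plateau_lip.
have bd : forall t h : R, 0 < h -> `|plateau (t + h + h) - 2 * plateau (t + h) + plateau t| <= K * (h * h).
  by move=> t h h0; rewrite -expr2 plateau_diff2.
clearbody K.
set L0 := bel_lip (metric_tau 2^-1 2^-1).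
have L00 : 0 < L0 by rewrite (lt_le_trans _ (bel_lip_ge1 tau0)).
pose e := q * (1 - q) / (16 * L0 ^+ 2).
have qq0 : 0 < q * (1 - q) by rewrite mulr_gt0 // subr_gt0.
have L2 : 0 < 16 * L0 ^+ 2 by rewrite mulr_gt0 // exprn_gt0.
have e0 : 0 < e by rewrite divr_gt0.
pose C := 1 + K + 2 * K.
have C0 : 0 < C by rewrite /C; lra.
have AC0 : 0 < 64 * (A * C) by rewrite !mulr_gt0.
(* The zoom required by the smallness hypothesis of [isothermal_scaled]. *)
pose k := Num.min 1 (e / (64 * (A * C))).
have k01 : 0 < k <= 1 by rewrite lt_min ltr01 divr_gt0 //= ge_min lexx.
have small : 64 * (A * k * C) <= e.
  have -> : 64 * (A * k * C) = k * (64 * (A * C)) by ring.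
  by rewrite -ler_pdivlMr // ge_min lexx orbT.
have [w [W [et [et0 w1 w2 w3 w4]]]] :=
  isothermal_scaled (ltW A0) b01 tau0 T1 T2 T3 K256 bl bd k01 A0 small.
have [z1 [z2 [z3 z4 z5]]] := near_linear_inverse tau0 et0 w1 w2.
exists w, z1, z2, k, et, (et + 1 + nc (metric_tau 2^-1 2^-1)); split=> //.
- by split=> //; rewrite !addr_ge0 ?nc_ge0 // ltW.
- by split=> // x y x' y'; exact: (near_linear_upper w1).
move=> u Cu Cx Cy Lap; have [F [G [B [FRe FB GB Fd]]]] := conjugate Cu Cx Cy Lap.
pose sc (x : R) : R := 2^-1 + k * (x - 2^-1).
have /andP[k0 k1] := k01.
have Jsc x : J x -> J (sc x).
  move=> /andP[? ?]; apply/andP; rewrite /sc; split; nra.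
exists (2 * B) => c v hc hv.
have B0 : 0 <= B.
  by apply: le_trans (nc_ge0 _) (FB 2^-1 2^-1 _ _); apply/andP; split; lra.
(* The function is read through the same zoom as the coefficient; by the chain rule its derivative
   acquires the factor [k]. *)
have := @chart_tame R w W (fun x y => F (sc x) (sc y)) (fun x y => k%:C * G (sc x) (sc y))
  (fun x y => metric_tau (sc x) (sc y)) z1 z2 et B B et0 z3 z4 z5 w3 w4 _ _ _ c v hc hv.
move=> H; apply: tame_ext (H _ _ _); first by move=> t _; rewrite FRe.
- move=> r r0; have [d d0 hd] := Fd r r0; exists d => // x y a p Jx Jy Jxa Jyp ap.
  have E1 : sc (x + a) = sc x + k * a by rewrite /sc; ring.
  have E2 : sc (y + p) = sc y + k * p by rewrite /sc; ring.
  have kap : `|k * a| + `|k * p| = k * (`|a| + `|p|).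
    by rewrite !normrM gtr0_norm // -mulrDr.
  have S0 : 0 <= `|a| + `|p| by rewrite addr_ge0.
  have kS : k * (`|a| + `|p|) <= `|a| + `|p| by rewrite ler_piMl.
  have := hd (sc x) (sc y) (k * a) (k * p) (Jsc _ Jx) (Jsc _ Jy).
  rewrite -E1 -E2 kap => /(_ (Jsc _ Jxa) (Jsc _ Jyp) (le_trans kS ap)).
  have -> : k%:C * G (sc x) (sc y) * (a%:C + metric_tau (sc x) (sc y) * p%:C) =
    G (sc x) (sc y) * ((k * a)%:C + metric_tau (sc x) (sc y) * (k * p)%:C).
    by rewrite !rmorphM /=; ring.
  move=> /le_trans; apply; rewrite ler_wpM2l // ltW //.
- move=> x y Jx Jy; rewrite ncM nc_real gtr0_norm // -[leRHS]mul1r.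
  by rewrite ler_pM ?nc_ge0 ?(ltW k0) // GB ?Jsc.
- by move=> x y Jx Jy; rewrite FB ?Jsc.
Qed.

End conjugate.

(** * Transport of the metric and of the equation to the unit square *)

Lemma is_deriveP {R : realType} {V : normedModType R} (f : V -> R) (x v : V) (l : R) :
  is_derive x v f l <-> forall e : R, 0 < e -> exists2 d : R, 0 < d & forall h : R,
    h != 0 -> `|h| < d -> `|h^-1 * (f (h *: v + x) - f x) - l| <= e.
Proof.
have E : (forall e : R, 0 < e -> exists2 d : R, 0 < d & forall h : R,
    h != 0 -> `|h| < d -> `|h^-1 * (f (h *: v + x) - f x) - l| <= e) <->
  (fun h => h^-1 *: ((f \o shift x) (h *: v) - f x)) @ 0^' --> l.
  split=> [H|/cvgrPdist_le H e e0].
    apply/cvgrPdist_le => e /H[d d0 hd]; near=> h.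
    rewrite distrC; apply: hd.
      by near: h; exact: nbhs_dnbhs_neq.
    near: h; apply: dnbhs0_lt => //.
  have := H e e0; rewrite near_withinE => -[d /= d0 hd].
  exists d => // h h0 hlt; rewrite distrC; apply: hd => //=.
  by rewrite sub0r normrN.
split=> [[d dl]|/E h]; first by apply/E; rewrite -dl; exact: d.
by apply: DeriveDef; [apply/cvg_ex; exists l|exact: cvg_lim].
Unshelve. all: by end_near. Qed.

(** An equivalence, because derivatives are transported both ways: regularity from the plane to the
    square, and the divergence of the fluxes back to the plane. *)
Lemma is_derive_line {R : realType} {V : normedModType R} (f : V -> R) (x v : V)
    (s a l : R) : s != 0 ->
  is_derive x v f l <-> is_derive a 1 (fun t => f (x + (s * (t - a)) *: v)) (s * l).
Proof.
move=> s0; have key (h : R) : (h : R^o) *: (1 : R^o) + a - a = h.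
  by rewrite /GRing.scale /= mulr1 addrK.
split=> /is_deriveP H; apply/is_deriveP => e e0.
  have [d d0 hd] := H (e / `|s|) (ltac:(by rewrite divr_gt0 // normr_gt0)).
  exists (d / `|s|); first by rewrite divr_gt0 // normr_gt0.
  move=> h h0 hlt; rewrite key subrr mulr0 scale0r addr0.
  have sh0 : s * h != 0 by rewrite mulf_neq0.
  have := hd (s * h) sh0; rewrite normrM mulrC -ltr_pdivlMr ?normr_gt0 // => /(_ hlt).
  rewrite ler_pdivlMr ?normr_gt0 // -normrM [x + _]addrC => /(le_trans _); apply.
  by rewrite le_eqVlt; apply/orP; left; apply/eqP; congr `|_|; field; rewrite h0 s0.
have [d d0 hd] := H (e * `|s|) (ltac:(by rewrite mulr_gt0 // normr_gt0)).
exists (d * `|s|); first by rewrite mulr_gt0 // normr_gt0.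
move=> h h0 hlt; have sh0 : h / s != 0 by rewrite mulf_neq0 // invr_neq0.
have := hd (h / s) sh0; rewrite key normrM normfV ltr_pdivrMr ?normr_gt0 // => /(_ hlt).
rewrite subrr mulr0 scale0r addr0 [s * _]mulrC divfK // -ler_pdivrMr ?normr_gt0 //.
rewrite -normfV -normrM [x + _]addrC => /(le_trans _); apply.
by rewrite le_eqVlt; apply/orP; left; apply/eqP; congr `|_|; field; rewrite h0 s0.
Qed.

Lemma sum_ord2 {V : nmodType} (F : 'I_2 -> V) : \sum_i F i = F 0 + F 1.
Proof. by rewrite !big_ord_recl big_ord0 addr0; congr (_ + F _); exact: val_inj. Qed.

Lemma coord_le_norm {R : realType} n (v : 'rV[R]_n) i : `|v 0 i| <= `|v|.
Proof.
rewrite [leRHS]mx_normrE; exact: (le_bigmax _ (fun k : 'I_1 * 'I_n => `|v k.1 k.2|) (0, i)).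
Qed.

Lemma norm_le_coord {R : realType} n (v : 'rV[R]_n) (c : R) : 0 <= c ->
  (forall i, `|v 0 i| <= c) -> `|v| <= c.
Proof.
move=> c0 h; rewrite [leLHS]mx_normrE; apply/bigmax_leP; split=> // -[i j] _ /=.
by rewrite (ord1 i).
Qed.

Section pullback.
Variables (R : realType) (x0 : 'rV[R]_2) (s : R).
Hypothesis s0 : 0 < s.

(* The unit square is mapped onto the square of centre [x0] and side [s]. *)
Definition square_map (a c : R) : 'rV[R]_2 :=
  \row_j (x0 0 j + s * ((if j == 0 then a else c) - 2^-1)).

Definition pull (f : 'rV[R]_2 -> R) (a c : R) : R := f (square_map a c).

Lemma square_mapx a c t :
  square_map t c = square_map a c + (s * (t - a)) *: delta_mx 0 0.
Proof.
apply/rowP => j; rewrite !mxE; case: eqP => [->|/eqP j0] /=.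
  by rewrite mulr1; ring.
by rewrite mulr0 addr0.
Qed.

Lemma square_mapy a c t :
  square_map a t = square_map a c + (s * (t - c)) *: delta_mx 0 1.
Proof.
apply/rowP => j; rewrite !mxE; case: (eqVneq j 0) => [->|j0] /=.
  by rewrite mulr0 addr0.
have -> : j = 1 by case: j j0 => [[|[|//]]] //= i _; exact: val_inj.
by rewrite mulr1; ring.
Qed.

Lemma pullx f a c l : is_derive (square_map a c) (delta_mx 0 0) f l <->
  is_derive a 1 (fun t => pull f t c) (s * l).
Proof.
rewrite (is_derive_line f (square_map a c) (delta_mx 0 0) a l (lt0r_neq0 s0)).
by rewrite (_ : (fun t => pull f t c) = fun t => f (square_map a c + (s * (t - a)) *: delta_mx 0 0)) //;
  apply/funext => t; rewrite /pull (square_mapx a).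
Qed.

Lemma pully f a c l : is_derive (square_map a c) (delta_mx 0 1) f l <->
  is_derive c 1 (pull f a) (s * l).
Proof.
rewrite (is_derive_line f (square_map a c) (delta_mx 0 1) c l (lt0r_neq0 s0)).
by rewrite (_ : pull f a = fun t => f (square_map a c + (s * (t - c)) *: delta_mx 0 1)) //;
  apply/funext => t; rewrite /pull (square_mapy _ c).
Qed.

Lemma square_map_dist a c a' c' i : (square_map a c - square_map a' c') 0 i =
  s * (if i == 0 then a - a' else c - c').
Proof. by rewrite !mxE; case: ifP => _; ring. Qed.

Lemma square_map_norm a c a' c' :
  `|square_map a c - square_map a' c'| <= s * (`|a - a'| + `|c - c'|).
Proof.
apply: norm_le_coord => [|i]; first by rewrite mulr_ge0 ?addr_ge0 // ltW.
rewrite square_map_dist normrM gtr0_norm // ler_wpM2l ?(ltW s0) //.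
by case: ifP => _; rewrite ?lerDl ?lerDr.
Qed.

Hypothesis s1 : s <= 1.
Variables (Omega : set 'rV[R]_2) (alpha b : R).
Hypothesis alpha0 : 0 < alpha.
Hypothesis bE : b = Num.min alpha 1.
Hypothesis Oopen : open Omega.
Hypothesis sO : forall y, `|y - x0| <= s / 2 -> Omega y.

Let I := @unitI R.

Let b01 : 0 < b <= 1.
Proof. by rewrite bE lt_min alpha0 ltr01 ge_min lexx orbT. Qed.

Let inK a c : I a -> I c -> `|square_map a c - x0| <= s / 2.
Proof.
move=> /andP[a0 a1] /andP[c0 c1]; apply: norm_le_coord => [|i].
  by rewrite divr_ge0 // ltW.
rewrite !mxE addrAC subrr add0r normrM gtr0_norm // ler_wpM2l ?(ltW s0) //.
by case: ifP => _; rewrite ler_norml; apply/andP; split; lra.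
Qed.

Lemma square_map_in a c : I a -> I c -> Omega (square_map a c).
Proof. by move=> Ia Ic; apply: sO; exact: inK. Qed.

Let K := [set y : 'rV[R]_2 | forall i, `[x0 0 i - s / 2, x0 0 i + s / 2]%classic (y 0 i)].

Let Kcompact : compact K.
Proof.
apply: (@rV_compact R 2 (fun i => `[x0 0 i - s / 2, x0 0 i + s / 2]%classic)) => i.
exact: segment_compact.
Qed.

Let KO : K `<=` Omega.
Proof.
move=> y hy; apply: sO; apply: norm_le_coord => [|i]; first by rewrite divr_ge0 // ltW.
have := hy i; rewrite /= in_itv /= !mxE => /andP[? ?].
by rewrite ler_norml; apply/andP; split; lra.
Qed.

Let inK' a c : I a -> I c -> K (square_map a c).
Proof.
move=> Ia Ic i; have := le_trans (coord_le_norm _ i) (inK Ia Ic).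
by rewrite !mxE /= in_itv /= ler_norml => /andP[? ?]; apply/andP; split; lra.
Qed.

(** Distances inside the unit square are at most 1, so lowering the exponent from [alpha] to
    [b = min alpha 1] only increases the power. This admits every [alpha > 0], although [b <= 1] is
    needed for [C1] functions to be Hoelder. *)
Let dist_pow a c a' c' : I a -> I c -> I a' -> I c' ->
  `|square_map a' c' - square_map a c| `^ alpha <= `|a' - a| `^ b + `|c' - c| `^ b.
Proof.
move=> Ia Ic Ia' Ic'; pose m := Num.max `|a' - a| `|c' - c|.
have d1 p p' : I p -> I p' -> `|p' - p| <= 1.
  by move=> /andP[? ?] /andP[? ?]; rewrite ler_norml; apply/andP; split; lra.
have m1 : m <= 1 by rewrite ge_max !d1.
have m0 : 0 <= m by rewrite le_max normr_ge0.
have Dm : `|square_map a' c' - square_map a c| <= m.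
  apply: norm_le_coord => // i; rewrite square_map_dist normrM gtr0_norm //.
  rewrite (@le_trans _ _ (s * m)) ?ler_piMl // ler_wpM2l ?(ltW s0) //.
  by case: ifP => _; rewrite le_max lexx ?orbT.
apply: (@le_trans _ _ (m `^ alpha)).
  by apply: ge0_ler_powR; rewrite ?nnegrE // ltW.
apply: (@le_trans _ _ (m `^ b)).
  have [->|mn0] := eqVneq m 0.
    by rewrite !powR0 // gt_eqF //; case/andP: b01.
  apply: ger_powR; first by rewrite lt_neqAle eq_sym mn0 m0.
  by rewrite bE ge_min lexx.
rewrite /m; have [_|_] := leP `|a' - a| `|c' - c|; first by rewrite lerDr powR_ge0.
by rewrite lerDl powR_ge0.
Qed.

Lemma pull_hol f : locally_holder Omega alpha f -> hol b (pull f).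
Proof.
move=> /(_ K Kcompact KO)[M hM]; exists `|M| => // x y x' y' Ix Iy Ix' Iy'.
rewrite (le_trans (hM _ _ (inK' Ix' Iy') (inK' Ix Iy))) //.
rewrite (le_trans (ler_wpM2r _ (ler_norm M))) ?powR_ge0 //.
by rewrite ler_wpM2l // dist_pow.
Qed.

Let near_x a c : I a -> I c -> \forall t \near a, Omega (square_map t c).
Proof.
move=> Ia Ic; have : nbhs (square_map a c) Omega.
  by apply: open_nbhs_nbhs; split=> //; exact: square_map_in.
move=> /nbhs_ballP[e /= e0 he].
near=> t; apply: he; rewrite mx_norm_ball /ball_ /=.
apply: (le_lt_trans (square_map_norm _ _ _ _)); rewrite subrr normr0 addr0.
rewrite (@le_lt_trans _ _ `|a - t|) //; last by rewrite ler_piMl.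
Unshelve. all: by end_near. Qed.

Let near_y a c : I a -> I c -> \forall t \near c, Omega (square_map a t).
Proof.
move=> Ia Ic; have : nbhs (square_map a c) Omega.
  by apply: open_nbhs_nbhs; split=> //; exact: square_map_in.
move=> /nbhs_ballP[e /= e0 he].
near=> t; apply: he; rewrite mx_norm_ball /ball_ /=.
apply: (le_lt_trans (square_map_norm _ _ _ _)); rewrite subrr normr0 add0r.
rewrite (@le_lt_trans _ _ `|c - t|) //; last by rewrite ler_piMl.
Unshelve. all: by end_near. Qed.

(** Derivatives are two-sided even at the boundary of the closed square, so the functions must agree
    on neighbourhoods. The openness of [Omega] provides these through [near_x] and [near_y]. *)
Lemma C1_near f g : (forall a c, I a -> I c -> (\forall t \near a, f t c = g t c) /\
    (\forall t \near c, f a t = g a t)) -> C1 b f -> C1 b g.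
Proof.
move=> fg [df [f1 f2]]; apply: (C1_intro _ f1 f2) => x y Ix Iy.
have [n1 n2] := fg x y Ix Iy; have [d1 d2] := df x y Ix Iy.
by split; [apply: near_eq_is_derive d1|apply: near_eq_is_derive d2].
Qed.

Let is_partial f a c i : (forall x, Omega x -> derivable f x (delta_mx 0 i)) ->
  Omega (square_map a c) ->
  is_derive (square_map a c) (delta_mx 0 i) f (pull (partial i f) a c).
Proof. by move=> df Oac; apply: DeriveDef => //; exact: df. Qed.

Lemma pull_px f a c : (forall x, Omega x -> derivable f x (delta_mx 0 0)) ->
  Omega (square_map a c) -> px (pull f) a c = s * pull (partial 0 f) a c.
Proof. by move=> df Oac; have /pullx d := is_partial df Oac; rewrite /px derive_val. Qed.

Lemma pull_py f a c : (forall x, Omega x -> derivable f x (delta_mx 0 1)) ->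
  Omega (square_map a c) -> py (pull f) a c = s * pull (partial 1 f) a c.
Proof. by move=> df Oac; have /pully d := is_partial df Oac; rewrite /py derive_val. Qed.

Let pull_C1_gen f : (forall i x, Omega x -> derivable f x (delta_mx 0 i)) ->
  hol b (pull (partial 0 f)) -> hol b (pull (partial 1 f)) -> C1 b (pull f).
Proof.
move=> df h0 h1.
apply: (C1_intro _ (holM b01 (hol_cst b s) h0) (holM b01 (hol_cst b s) h1)) => x y Ix Iy.
have Oxy := square_map_in Ix Iy.
split; first exact: (proj1 (pullx _ _ _ _) (is_partial (df 0) Oxy)).
exact: (proj1 (pully _ _ _ _) (is_partial (df 1) Oxy)).
Qed.

Lemma pull_C1 f : holder_class Omega 1 alpha f -> C1 b (pull f).
Proof.
move=> [_ H]; apply: pull_C1_gen; first by move=> i; case: (H i).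
  exact: pull_hol (proj2 (proj2 (H 0))).
exact: pull_hol (proj2 (proj2 (H 1))).
Qed.

Lemma pull_C2 u : holder_class Omega 2 alpha u ->
  [/\ C1 b (pull u), C1 b (px (pull u)) & C1 b (py (pull u))].
Proof.
move=> [_ H].
have C0 := pull_C1 (proj2 (H 0)); have C1' := pull_C1 (proj2 (H 1)).
have du i x : Omega x -> derivable u x (delta_mx 0 i) by case: (H i) => + _; exact.
split; first exact: pull_C1_gen du (C1_hol b01 C0) (C1_hol b01 C1').
  apply: C1_near (C1M b01 (C1_cst b s) C0) => a c Ia Ic.
  split; [near=> t|near=> t]; rewrite pull_px //; [exact: du|near: t; exact: near_x|exact: du|near: t; exact: near_y].
apply: C1_near (C1M b01 (C1_cst b s) C1') => a c Ia Ic.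
split; [near=> t|near=> t]; rewrite pull_py //; [exact: du|near: t; exact: near_x|exact: du|near: t; exact: near_y].
Unshelve. all: by end_near. Qed.

Variable g : 'rV[R]_2 -> 'M[R]_2.
Variable m : R.
Hypothesis m0 : 0 < m.
Hypothesis gsym : forall x, Omega x -> g x 1 0 = g x 0 1.
Let det x := g x 0 0 * g x 1 1 - g x 0 1 * g x 0 1.
Hypothesis gdet : forall x, Omega x -> 0 < det x.
Hypothesis g00_ge : forall x, `|x - x0| <= s / 2 -> m <= g x 0 0.
Hypothesis det_ge : forall x, `|x - x0| <= s / 2 -> m <= det x.
Hypothesis gC1 : metric_holder_class Omega 1 alpha g.

Let g11 := pull (fun x => g x 0 0).
Let g12 := pull (fun x => g x 0 1).
Let g22 := pull (fun x => g x 1 1).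

Lemma det_mx22 (A : 'M[R]_2) : \det A = A 0 0 * A 1 1 - A 0 1 * A 1 0.
Proof.
rewrite (expand_det_row _ 0) !big_ord_recl big_ord0 addr0 /cofactor !det_mx11 !mxE /=.
have -> : (0 + 0)%N = 0%N by []; have -> : (0 + fintype.bump 0 0)%N = 1%N by [].
rewrite expr0 mul1r expr1 mulN1r mulrN.
by congr (_ * A _ _ - A _ _ * A _ _); exact: val_inj.
Qed.

Lemma invmx22 (A : 'M[R]_2) : \det A != 0 ->
  [/\ invmx A 0 0 = A 1 1 / \det A, invmx A 0 1 = - A 0 1 / \det A,
      invmx A 1 0 = - A 1 0 / \det A & invmx A 1 1 = A 0 0 / \det A].
Proof.
move=> d0; pose B : 'M[R]_2 := \matrix_(i, j) (if i == 0 then if j == 0 then A 1 1 else - A 0 1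
  else if j == 0 then - A 1 0 else A 0 0).
have uA : A \in unitmx by rewrite unitmxE unitfE.
have AB : A *m ((\det A)^-1 *: B) = 1%:M.
  rewrite -scalemxAr; apply/matrixP => i j; rewrite !mxE sum_ord2 !mxE /=.
  rewrite det_mx22 in d0 *.
  have ne1 (k : 'I_2) : k != 0 -> k = 1.
    by case: k => [[|[|//]]] //= k _; exact: val_inj.
  case: (eqVneq i 0) => [i0|/ne1 i0]; case: (eqVneq j 0) => [j0|/ne1 j0];
    rewrite ?i0 ?j0 ?eqxx /=.
  - by field.
  - by ring.
  - by ring.
  - by field.
have -> : invmx A = (\det A)^-1 *: B by rewrite -[LHS]mulmx1 -AB mulmxA mulVmx // mul1mx.
by rewrite !mxE /=; split; rewrite mulrC.
Qed.

Let detE x : Omega x -> \det (g x) = det x.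
Proof. by move=> Ox; rewrite det_mx22 gsym. Qed.

Let Q (u : 'rV[R]_2 -> R) (i : 'I_2) (y : 'rV[R]_2) : R :=
  \sum_(j < 2) Num.sqrt (\det (g y)) * invmx (g y) i j * partial j u y.

Let QE u y : Omega y ->
  Q u 0 y = (g y 1 1 * partial 0 u y - g y 0 1 * partial 1 u y) / Num.sqrt (det y) /\
  Q u 1 y = (g y 0 0 * partial 1 u y - g y 0 1 * partial 0 u y) / Num.sqrt (det y).
Proof.
move=> Oy; have d0 := gdet Oy; have s0' : 0 < Num.sqrt (det y) by rewrite sqrtr_gt0.
have [|i00 i01 i10 i11] := @invmx22 (g y); first by rewrite detE // gt_eqF.
have dE : det y = Num.sqrt (det y) * Num.sqrt (det y) by rewrite -expr2 sqr_sqrtr // ltW.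
rewrite /Q !sum_ord2 i00 i01 i10 i11 detE // gsym //.
have E k : Num.sqrt (det y) * (k / det y) = k / Num.sqrt (det y).
  by rewrite {2}dE; field; rewrite gt_eqF.
by rewrite !E; split; ring.
Qed.

Let Qpull u a c : holder_class Omega 2 alpha u -> Omega (square_map a c) ->
  flux1 g11 g12 g22 (pull u) a c = s * pull (Q u 0) a c /\
  flux2 g11 g12 g22 (pull u) a c = s * pull (Q u 1) a c.
Proof.
move=> [_ H] Oac; have du i x : Omega x -> derivable u x (delta_mx 0 i) by case: (H i) => + _; exact.
rewrite /flux1 /flux2 pull_px ?pull_py //; try exact: du.
have [q0 q1] := QE u Oac; rewrite /pull q0 q1 /metric_sqrt.
by split; rewrite /g11 /g12 /g22 /pull /det; ring.
Qed.

Let mI a c : I a -> I c -> m <= g11 a c.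
Proof. by move=> Ia Ic; apply: g00_ge; exact: inK. Qed.

Let mD a c : I a -> I c -> m <= g11 a c * g22 a c - g12 a c * g12 a c.
Proof. by move=> Ia Ic; exact: (det_ge (inK Ia Ic)). Qed.

Let Cg11 : C1 b g11. Proof. exact: (pull_C1 (gC1 0 0)). Qed.
Let Cg12 : C1 b g12. Proof. exact: (pull_C1 (gC1 0 1)). Qed.
Let Cg22 : C1 b g22. Proof. exact: (pull_C1 (gC1 1 1)). Qed.

(** The derivative of [f] is [s^-1 * l]; it is written with an extra [s * s^-1] to match the form
    [s * _] required by [pullx] and [pully]. *)
Let unscale_derive (f : R -> R) (x l : R) :
  is_derive x 1 (fun t => s * f t) l -> is_derive x 1 f (s * (s^-1 * (s^-1 * l))).
Proof.
move=> d; have := @is_deriveZ R R R _ s^-1 x 1 l d.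
have -> : s^-1 \*: (fun t => s * f t) = f.
  by apply/funext => t; rewrite /= /GRing.scale /= mulKf // gt_eqF.
by rewrite mulVKf // gt_eqF.
Qed.

(** Each differentiation on the square contributes a factor [s], one in the flux and one in the
    divergence. The pulled-back divergence is thus [s^2] times the original one, and vanishes with
    it. *)
Lemma laplace_flux u : holder_class Omega 2 alpha u ->
  (forall x, Omega x -> laplace_beltrami g u x = 0) ->
  forall a c, I a -> I c -> px (flux1 g11 g12 g22 (pull u)) a c +
    py (flux2 g11 g12 g22 (pull u)) a c = 0.
Proof.
move=> Hu Lap a c Ia Ic; have [Cu Cx Cy] := pull_C2 Hu.
have [df1 _] := C1_flux1 b01 m0 mD Cg11 Cg12 Cg22 Cx Cy.
have [df2 _] := C1_flux2 b01 m0 mD Cg11 Cg12 Cg22 Cx Cy.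
have d1 := proj1 (df1 a c Ia Ic); have d2 := proj2 (df2 a c Ia Ic).
have {}d1 : is_derive a 1 (fun t => s * pull (Q u 0) t c) (px (flux1 g11 g12 g22 (pull u)) a c).
  apply: near_eq_is_derive d1; near=> t.
  by apply: (proj1 (Qpull Hu _)); near: t; exact: near_x.
have {}d2 : is_derive c 1 (fun t => s * pull (Q u 1) a t) (py (flux2 g11 g12 g22 (pull u)) a c).
  apply: near_eq_is_derive d2; near=> t.
  by apply: (proj2 (Qpull Hu _)); near: t; exact: near_y.
have [_ e1] := proj2 (pullx _ _ _ _) (unscale_derive d1).
have [_ e2] := proj2 (pully _ _ _ _) (unscale_derive d2).
have Oac := square_map_in Ia Ic.
have := Lap _ Oac; rewrite /laplace_beltrami.
have D0 : Num.sqrt (\det (g (square_map a c))) != 0.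
  by rewrite gt_eqF // sqrtr_gt0 detE // gdet.
move/eqP; rewrite mulf_eq0 oppr_eq0 invr_eq0 (negPf D0) /= => /eqP.
rewrite sum_ord2 -!/(Q u _) /partial e1 e2 -!mulrDr => /eqP.
by rewrite !mulf_eq0 !invr_eq0 (gt_eqF s0) /= => /eqP.
Unshelve. all: by end_near. Qed.

Lemma chart_at : exists (Z : 'rV[R]_2 -> R[i]) (om : R[i] -> 'rV[R]_2) (r L : R),
  [/\ 0 < r, 0 <= L,
      (forall x, om (Z x) = x) /\ (forall z, Z (om z) = z),
      (forall z z', `|om z' - om z| <= L * nc (z' - z)) /\
      (forall x x', nc (Z x' - Z x) <= L * `|x' - x|) &
      forall u, holder_class Omega 2 alpha u ->
        (forall x, Omega x -> laplace_beltrami g u x = 0) ->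
        exists B, forall c v, nc (c - Z x0) <= r -> nc v <= r ->
        tame B 2 (fun t => u (om (c + t%:C * v)))].
Proof.
have [w [p1 [p2 [k [h [L [[k01 h0 L0] h1 h2 [h3 h4] h5]]]]]]] :=
  unit_chart b01 m0 mI mD Cg11 Cg12 Cg22.
have /andP[k0 k1] := k01.
pose om z := square_map (2^-1 + k * (p1 z - 2^-1)) (2^-1 + k * (p2 z - 2^-1)).
pose c1 (x : 'rV[R]_2) := 2^-1 + (x 0 0 - x0 0 0) / (s * k).
pose c2 (x : 'rV[R]_2) := 2^-1 + (x 0 1 - x0 0 1) / (s * k).
have sk0 : 0 < s * k by rewrite mulr_gt0.
have cE (x y : R) : 2^-1 + k * (2^-1 + (x - y) / (s * k) - 2^-1) = 2^-1 + (x - y) / s.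
  by field; rewrite !gt_eqF.
(* One constant for both directions: [1 / h] serves [om], and [2 * L / (s * k)] serves its
   inverse. *)
exists (fun x => w (c1 x) (c2 x)), om, (h / 64), (1 / h + 2 * L / (s * k)); split.
- by rewrite divr_gt0.
- by rewrite addr_ge0 ?divr_ge0 ?mulr_ge0 // ltW.
- split=> [x|z].
    rewrite /om; have [-> ->] := h2 (c1 x) (c2 x); rewrite /c1 /c2 !cE.
    apply/rowP => j; rewrite !mxE; case: (eqVneq j 0) => [->|j0].
      by field; rewrite gt_eqF.
    have -> : j = 1 by case: j j0 => [[|[|//]]] //= i _; exact: val_inj.
    by field; rewrite gt_eqF.
  rewrite /c1 /c2 /om !mxE /= -[RHS]h1; congr w.
    by field; rewrite !gt_eqF.
  by field; rewrite !gt_eqF.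
- split=> [z z'|x x'].
    apply: (le_trans (square_map_norm _ _ _ _)).
    have kE (x y : R) : 2^-1 + k * (x - 2^-1) - (2^-1 + k * (y - 2^-1)) = k * (x - y) by ring.
    rewrite !kE !normrM gtr0_norm // -mulrDr mulrA mulrDl.
    have hh := h3 z z'; have S0 : 0 <= `|p1 z' - p1 z| + `|p2 z' - p2 z| by rewrite addr_ge0.
    set S := _ + _ in hh S0 *.
    have e1 : S <= 1 / h * nc (z' - z) by rewrite mulrC mulrA mulr1 ler_pdivlMr // mulrC.
    have e2 : s * k * S <= S by rewrite ler_piMl // mulr_ile1 // ltW.
    have e3 : 0 <= 2 * L / (s * k) * nc (z' - z).
      by rewrite mulr_ge0 ?nc_ge0 // divr_ge0 ?(ltW sk0) // mulr_ge0.
    lra.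
  apply: (le_trans (h4 _ _ _ _)).
  have ce (p q z : R) : 2^-1 + (p - z) / (s * k) - (2^-1 + (q - z) / (s * k)) = (p - q) / (s * k).
    by ring.
  rewrite /c1 /c2 !ce !normrM normfV (gtr0_norm sk0) -mulrDl.
  have n0 := coord_le_norm (x' - x) 0; have n1 := coord_le_norm (x' - x) 1.
  rewrite !mxE in n0 n1.
  have e1 : L * ((`|x' 0 0 - x 0 0| + `|x' 0 1 - x 0 1|) / (s * k)) <= 2 * L / (s * k) * `|x' - x|.
    have -> : 2 * L / (s * k) * `|x' - x| = L * ((2 * `|x' - x|) / (s * k)) by ring.
    rewrite ler_wpM2l // ler_wpM2r ?invr_ge0 ?(ltW sk0) //; lra.
  have e2 : 0 <= 1 / h * `|x' - x| by rewrite mulr_ge0 // divr_ge0 // ltW.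
  by rewrite mulrDl; lra.
- move=> u Hu Lap; have [Cu Cx Cy] := pull_C2 Hu.
  have [B hB] := h5 _ Cu Cx Cy (laplace_flux Hu Lap); exists B => c v hc hv.
  apply: hB => //; move: hc; rewrite /c1 /c2 !subrr !mul0r !addr0; lra.
Qed.

End pullback.

(* Absolute summability and composition with real analytic functions *)
#[local] Existing Instance totally_filter.

Lemma sum_fsubset {R : realType} {I : choiceType} (A0 A : {fset I}) (x : I -> R) : (A0 `<=` A)%fset ->
  \sum_(i <- A) x i = \sum_(i <- A0) x i + \sum_(i <- A | i \notin A0) x i.
Proof.
move=> /fsubsetP sA; rewrite (bigID (mem A0)) /= big_fset_condE; congr (_ + _).
by apply: eq_fbigl => i; rewrite !inE /= andb_idl //; exact: sA.
Qed.

(* Unconditional summability is absolute summability: among the terms outside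
   [A0], those of each sign form a finite sum that is small by the Cauchy
   criterion. *)
Lemma totally_tail {R : realType} {I : choiceType} (x : I -> R) (l : R) :
  partial_sum x @ totally --> l -> forall e : R, 0 < e -> exists A0 : {fset I},
    forall A : {fset I}, (A0 `<=` A)%fset -> \sum_(i <- A | i \notin A0) `|x i| <= e.
Proof.
move=> xl e e0; have e4 : 0 < e / 4 by lra.
have /cvgrPdist_le /(_ _ e4)[A0 _ hA0] := xl.
have hS (A : {fset I}) : (A0 `<=` A)%fset -> `|l - \sum_(i <- A) x i| <= e / 4.
  by move=> sA; rewrite big_seq_fsetE; exact: (hA0 A sA).
exists A0 => A sA.
have hT P : `|\sum_(i <- A | (i \notin A0) && P i) x i| <= e / 2.
  pose T := [fset i | i in A & (i \notin A0) && P i]%fset.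
  have sT : (A0 `<=` A0 `|` T)%fset by exact: fsubsetUl.
  have -> : \sum_(i <- A | (i \notin A0) && P i) x i =
      \sum_(i <- (A0 `|` T)%fset) x i - \sum_(i <- A0) x i.
    rewrite (sum_fsubset _ sT) addrAC subrr add0r [LHS]big_fset_condE [RHS]big_fset_condE; apply: eq_fbigl => i.
    by rewrite !inE /=; case: (i \in A0); rewrite ?andbF ?andbT //= andbC.
  have h1 := hS _ sT; have h2 := hS _ (fsubset_refl A0).
  move: h1 h2; rewrite !ler_norml => /andP[? ?] /andP[? ?]; apply/andP; split; lra.
rewrite (bigID (fun i => 0 <= x i)) /=.
have h1 := hT (fun i => 0 <= x i); have h2 := hT (fun i => ~~ (0 <= x i)).
have -> : \sum_(i <- A | (i \notin A0) && (0 <= x i)) `|x i| =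
    \sum_(i <- A | (i \notin A0) && (0 <= x i)) x i.
  by apply: eq_bigr => i /andP[_ h]; rewrite ger0_norm.
have -> : \sum_(i <- A | (i \notin A0) && ~~ (0 <= x i)) `|x i| =
    - \sum_(i <- A | (i \notin A0) && ~~ (0 <= x i)) x i.
  by rewrite -sumrN; apply: eq_bigr => i /andP[_]; rewrite -ltNge => h; rewrite ltr0_norm.
move: h1 h2; rewrite !ler_norml => /andP[? ?] /andP[? ?]; lra.
Qed.

(** The point with all increments equal to [s] still lies in the ball where the series converges,
    and absolute convergence there dominates every monomial in functions of norm at most [s]. The
    finite partial sums are therefore tame with one bound and converge uniformly. *)
Lemma tame_real_analytic {R : realType} {d : nat} (q : 'rV[R]_d -> R) (a : 'rV[R]_d) :
  real_analytic q -> exists2 s : R, 0 < s & exists B : R,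
    forall (h : 'I_d -> R -> R) (r : R), 0 <= r -> (forall i, tame s r (h i)) ->
    tame B r (fun t => q (a + \row_i h i t)).
Proof.
move=> /(_ a)[c /nbhs_ballP[rho /= rho0 hq]]; pose s := rho / 2.
have s0 : 0 < s by rewrite /s; lra.
pose mono (y : 'I_d -> R) k := c k * \prod_(i < d) y i ^+ k i.
have cvg_mono (y : 'I_d -> R) : (forall i, `|y i| <= s) ->
    partial_sum (mono y) @ totally --> q (a + \row_i y i).
  move=> ys; have -> : mono y = fun k => c k * \prod_(i < d) (a + \row_i y i - a) 0 i ^+ k i.
    apply/funext => k; congr (_ * _); apply: eq_bigr => i _.
    by rewrite [a + _]addrC addrK mxE.
  apply: hq; rewrite mx_norm_ball /ball_ /= opprD addNKr normrN.
  apply: (@le_lt_trans _ _ s); last by rewrite /s; lra.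
  by apply: norm_le_coord => [|i]; [exact: ltW|rewrite mxE].
pose w := mono (fun=> s).
have wl : partial_sum w @ totally --> q (a + \row_i s).
  by apply: cvg_mono => i; rewrite gtr0_norm.
have mono_le y k : (forall i, `|y i| <= s) -> `|mono y k| <= `|w k|.
  move=> ys; rewrite !normrM ler_wpM2l // !normr_prod; apply: ler_prod => i _.
  by rewrite !normrX exprn_ge0 //= lerXn2r ?nnegrE // (gtr0_norm s0).
have [A1 hA1] := totally_tail wl ltr01.
(* The fixed set [A1], outside of which the sums are at most 1, gives a bound independent of the
   precision [e]. *)
exists s => //; exists (\sum_(k <- A1) `|w k| + 1) => h r r0 hs.
apply: tame_lim => e e0; have [A0 hA0] := totally_tail wl e0.
pose A := (A0 `|` A1)%fset.
exists (fun t => \sum_(k <- A) mono (fun i => h i t) k).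
  apply: (@tame_le _ (\sum_(k <- A) `|c k| * \prod_(i < d) s ^+ k i)); last first.
    apply: tame_sum => // k _; apply: tameM => //; first exact: tame_cst.
    by apply: tame_prod => // i _; exact: tameX.
  have sA1 : (A1 `<=` A)%fset by exact: fsubsetUr.
  rewrite (sum_fsubset _ sA1) lerD //.
    apply: ler_sum => k _; rewrite normrM ler_wpM2l //.
    by rewrite ger0_norm // prodr_ge0 // => i _; rewrite exprn_ge0 // ltW.
  apply: le_trans (hA1 _ sA1); apply: ler_sum => k _; rewrite normrM ler_wpM2l //.
  by rewrite ger0_norm // prodr_ge0 // => i _; rewrite exprn_ge0 // ltW.
move=> t tr; pose y i := h i t.
have ys i : `|y i| <= s by exact: tame_bound (hs i) tr.
apply/ler_addgt0Pr => e' e'0.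
have /cvgrPdist_le /(_ _ e'0)[A2 _ hA2] := cvg_mono y ys.
have sA : (A `<=` A `|` A2)%fset by exact: fsubsetUl.
have h1 : `|q (a + \row_i y i) - \sum_(k <- (A `|` A2)%fset) mono y k| <= e'.
  by rewrite big_seq_fsetE; apply: hA2; exact: fsubsetUr.
have h2 : `|\sum_(k <- (A `|` A2)%fset) mono y k - \sum_(k <- A) mono y k| <= e.
  rewrite (sum_fsubset _ sA) addrAC subrr add0r (le_trans (ler_norm_sum _ _ _)) //.
  have sA0 : (A0 `<=` A `|` A2)%fset by rewrite /A -fsetUA fsubsetUl.
  apply: le_trans (hA0 _ sA0).
  rewrite [leLHS]big_mkcond [leRHS]big_mkcond; apply: ler_sum => k _.
  rewrite /A inE negb_or; case: (k \in A0) => //=.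
  by case: ifP => _; rewrite ?mono_le.
apply: le_trans (ler_distD (\sum_(k <- (A `|` A2)%fset) mono y k) _ _) _.
by rewrite [leRHS]addrC lerD.
Qed.

(** * Isothermal charts near every point *)

Lemma metric22_pos {R : realType} (Omega : set 'rV[R]_2) (g : 'rV[R]_2 -> 'M[R]_2) x :
  riemannian_metric Omega g -> Omega x ->
  [/\ g x 1 0 = g x 0 1, 0 < g x 0 0 & 0 < g x 0 0 * g x 1 1 - g x 0 1 * g x 0 1].
Proof.
move=> H /H[gT gpos]; have sym : g x 1 0 = g x 0 1 by rewrite -{1}gT mxE.
have e1 : lift ord0 ord0 = 1 :> 'I_2 by exact: val_inj.
have quad (v : 'rV[R]_2) : (v *m g x *m v^T) 0 0 =
    v 0 0 * v 0 0 * g x 0 0 + 2 * v 0 0 * v 0 1 * g x 0 1 + v 0 1 * v 0 1 * g x 1 1.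
  rewrite mxE big_ord_recl big_ord_recl big_ord0 !mxE !big_ord_recl !big_ord0 e1 sym.
  ring.
have g00 : 0 < g x 0 0.
  have := gpos (delta_mx 0 0); rewrite quad !mxE /= => h.
  suff : 0 < 1 * 1 * g x 0 0 + 2 * 1 * 0 * g x 0 1 + 0 * 0 * g x 1 1 by lra.
  apply: h; apply/eqP => /matrixP /(_ 0 0) /eqP; rewrite !mxE /= oner_eq0 //.
split=> //.
(* On this vector the quadratic form equals [g00] times the determinant. *)
pose v : 'rV[R]_2 := \row_j (if j == 0 then - g x 0 1 else g x 0 0).
have v0 : v != 0.
  by apply/eqP => /matrixP /(_ 0 1) /eqP; rewrite !mxE /= gt_eqF.
have := gpos v v0; rewrite quad !mxE /= => h.
have {}h : 0 < g x 0 0 * (g x 0 0 * g x 1 1 - g x 0 1 * g x 0 1).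
  by apply: lt_le_trans h _; rewrite le_eqVlt; apply/orP; left; apply/eqP; ring.
by rewrite pmulr_rgt0 in h.
Qed.

Section local_chart.
Variables (R : realType) (Omega : set 'rV[R]_2) (alpha : R) (g : 'rV[R]_2 -> 'M[R]_2).
Hypothesis Oopen : open Omega.
Hypothesis alpha0 : 0 < alpha.
Hypothesis gpos : riemannian_metric Omega g.
Hypothesis gC1 : metric_holder_class Omega 1 alpha g.

Definition harmonic (u : 'rV[R]_2 -> R) :=
  holder_class Omega 2 alpha u /\ forall x, Omega x -> laplace_beltrami g u x = 0.

Lemma local_chart x0 : Omega x0 ->
  exists (Z : 'rV[R]_2 -> R[i]) (om : R[i] -> 'rV[R]_2) (r L : R),
  [/\ 0 < r, 0 <= L,
      (forall x, om (Z x) = x) /\ (forall z, Z (om z) = z),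
      (forall z z', `|om z' - om z| <= L * nc (z' - z)) /\
      (forall x x', nc (Z x' - Z x) <= L * `|x' - x|) &
      forall u, harmonic u ->
        exists B, forall c v, nc (c - Z x0) <= r -> nc v <= r ->
        tame B 2 (fun t => u (om (c + t%:C * v)))].
Proof.
move=> Ox0; have [_ p0 d0] := metric22_pos gpos Ox0.
have cont i j : {for x0, continuous (fun x => g x i j)}.
  by apply: (proj1 (gC1 i j)); rewrite inE.
pose det x := g x 0 0 * g x 1 1 - g x 0 1 * g x 0 1.
have cdet : {for x0, continuous det}.
  have c00 := cont 0 0; have c11 := cont 1 1; have c01 := cont 0 1.
  exact: (cvgB (cvgM c00 c11) (cvgM c01 c01)).
pose m := Num.min (g x0 0 0 / 2) (det x0 / 2).
have m0 : 0 < m by rewrite lt_min !divr_gt0.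
have : \forall y \near x0, [/\ Omega y, m <= g y 0 0 & m <= det y].
  near=> y; split.
  - by near: y; apply: open_nbhs_nbhs; split.
  - near: y; apply: (cvgr_ge _ (cont 0 0)); rewrite /m gt_min; apply/orP; left; lra.
  - near: y; apply: (cvgr_ge _ cdet); rewrite /m gt_min; apply/orP; right.
    by rewrite /det in d0 *; lra.
move=> /nbhs_ballP[e /= e0 he]; pose s := Num.min 1 e.
have s0 : 0 < s by rewrite lt_min ltr01.
have s1 : s <= 1 by rewrite ge_min lexx.
have near_ok y : `|y - x0| <= s / 2 -> [/\ Omega y, m <= g y 0 0 & m <= det y].
  move=> hy; apply: he; rewrite mx_norm_ball /ball_ /= distrC (le_lt_trans hy) //.
  have : s <= e by rewrite ge_min lexx orbT.
  lra.
have sO y : `|y - x0| <= s / 2 -> Omega y by case/near_ok.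
have sG y : `|y - x0| <= s / 2 -> m <= g y 0 0 by case/near_ok.
have sD y : `|y - x0| <= s / 2 -> m <= det y by case/near_ok.
have gs y : Omega y -> g y 1 0 = g y 0 1 by case/(metric22_pos gpos).
have gd y : Omega y -> 0 < det y by case/(metric22_pos gpos).
have [Z [om [r [L [h1 h2 h3 h4 h5]]]]] :=
  chart_at s0 s1 alpha0 erefl Oopen sO m0 gs gd sG sD gC1.
by exists Z, om, r, L; split=> // u [Hu Lu]; exact: h5.
Unshelve. all: by end_near. Qed.

End local_chart.

(** * Functions analytic along the segments of a chart *)

Section tame_lines.
Variables (R : realType) (om : R[i] -> 'rV[R]_2) (z0 : R[i]).

(** The bound is uniform over all short segments near [z0]. The radius 2 puts the endpoint [t = 1]
    strictly inside the interval of expansion, so that vanishing propagates up to it. *)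
Definition tame_lines_by (B d : R) (h : 'rV[R]_2 -> R) :=
  forall c v, nc (c - z0) <= d -> nc v <= d -> tame B 2 (fun t => h (om (c + t%:C * v))).

Definition tame_lines (h : 'rV[R]_2 -> R) :=
  exists B d : R, 0 < d /\ tame_lines_by B d h.

Lemma tame_lines_ext f h : f =1 h -> tame_lines f -> tame_lines h.
Proof. by move=> /funext ->. Qed.

Lemma tame_lines_cst (a : R) : tame_lines (fun=> a).
Proof. by exists `|a|, 1; split=> // c v _ _; exact: tame_cst. Qed.

Let tame_lines2 f h (op : R -> R -> R) (opB : R -> R -> R) :
  (forall B B' c v, tame B 2 (fun t => f (om (c + t%:C * v))) ->
     tame B' 2 (fun t => h (om (c + t%:C * v))) ->
     tame (opB B B') 2 (fun t => op (f (om (c + t%:C * v))) (h (om (c + t%:C * v))))) ->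
  tame_lines f -> tame_lines h -> tame_lines (fun x => op (f x) (h x)).
Proof.
move=> H [B [d [d0 hf]]] [B' [d' [d'0 hh]]].
exists (opB B B'), (Num.min d d'); split; first by rewrite lt_min d0.
move=> c v; rewrite !le_min => /andP[c1 c2] /andP[v1 v2].
by apply: H; [exact: hf|exact: hh].
Qed.

Lemma tame_linesD f h : tame_lines f -> tame_lines h -> tame_lines (fun x => f x + h x).
Proof. by apply: (tame_lines2 (opB := +%R)) => B B' c v; exact: tameD. Qed.

Lemma tame_linesM f h : tame_lines f -> tame_lines h -> tame_lines (fun x => f x * h x).
Proof. by apply: (tame_lines2 (opB := *%R)) => B B' c v; exact: tameM. Qed.

Lemma tame_linesB f h : tame_lines f -> tame_lines h -> tame_lines (fun x => f x - h x).
Proof.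
move=> Hf Hh; apply: tame_lines_ext (tame_linesD Hf (tame_linesM (tame_lines_cst (-1)) Hh)) => x.
by rewrite mulN1r.
Qed.

(* Shrinking a line towards a point of the chart makes the majorant of
   [h - h (om z0)] small, see [tame_shrink]. *)
Lemma tame_lines_small h : tame_lines h -> forall e : R, 0 < e ->
  exists2 d : R, 0 < d & tame_lines_by e d (fun x => h x - h (om z0)).
Proof.
move=> [B [d [d0 H]]] e e0.
have B0 : 0 <= B.
  apply: (tame_ge0 (r := 2)) => //; apply: (H z0 0); first by rewrite subrr nc0 ltW.
  by rewrite nc0 ltW.
pose k := Num.min 1 (e / (2 * (B + 1))).
have k0 : 0 < k by rewrite lt_min ltr01 divr_gt0 //; lra.
have k1 : k <= 1 by rewrite ge_min lexx.
have kB : k * B <= e / 2.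
  rewrite (@le_trans _ _ (e / (2 * (B + 1)) * B)) // ?ler_wpM2r // ?ge_min ?lexx ?orbT //.
  rewrite invfM mulrA -[leRHS]mulr1 -mulrA ler_wpM2l ?ltW //; first lra.
  by rewrite mulrC ltr_pdivrMr; lra.
have shrink (v : R[i]) : nc v <= k * d -> nc (v / k%:C) <= d.
  by rewrite ncM ncV nc_real gtr0_norm // ler_pdivrMr // mulrC.
have unshrink (v : R[i]) (t : R) : (k * t)%:C * (v / k%:C) = t%:C * v.
  have kC : k%:C != 0 :> R[i] by rewrite eq_complex /= gt_eqF.
  by rewrite rmorphM /=; move: kC; set K : R[i] := k%:C; move=> kC; field.
have k01 : 0 <= k <= 1 by rewrite ltW.
have kd : k * d <= d by rewrite ler_piMl // ltW.
have step c (v : R[i]) : nc (c - z0) <= k * d -> nc v <= k * d ->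
    tame (`|h (om c) - h (om z0)| + k * B) 2 (fun t => h (om (c + t%:C * v)) - h (om z0)).
  move=> hc hv; have h2 : 0 <= 2 :> R by [].
  have := @tame_shrink R B 2 k (h (om z0)) _ h2 k01 (H c _ (le_trans hc kd) (shrink v hv)).
  rewrite /= mul0r addr0; apply: tame_ext => t _.
  by rewrite unshrink.
exists (k * d); first by rewrite mulr_gt0.
move=> c v hc hv; apply: tame_le (step c v hc hv).
have hz : nc (z0 - z0) <= k * d by rewrite subrr nc0 mulr_ge0 // ltW.
(* The remaining constant term, the value at [om c] minus that at [om z0], is controlled by the same
   estimate on the segment from [z0] to [c], evaluated at its endpoint. *)
have := @tame_bound _ _ _ _ 1 (step z0 (c - z0) hz hc).
rewrite subrr normr0 add0r normr1 => /(_ ltac:(lra)).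
have -> : z0 + 1%:C * (c - z0) = c by rewrite rmorph1 mul1r addrC subrK.
lra.
Qed.

(** The series of [q] is centred at the values at [om z0]. Only the deviations from these values
    must have norm at most [s], and [tame_lines_small] achieves this near [z0]. *)
Lemma tame_lines_analytic d (q : 'rV[R]_d -> R) (u : 'I_d -> 'rV[R]_2 -> R) :
  real_analytic q -> (forall i, tame_lines (u i)) -> tame_lines (fun x => q (\row_i u i x)).
Proof.
move=> Aq Hu; have [s s0 [B HB]] := tame_real_analytic (\row_i u i (om z0)) Aq.
have /choice [r hr] i : exists r : R, 0 < r /\ tame_lines_by s r (fun x => u i x - u i (om z0)).
  by have [r r0 hr] := tame_lines_small (Hu i) s0; exists r.
pose rho := \big[Num.min/1]_(i < d) r i.
have rho0 : 0 < rho by apply: (big_ind (fun x : R => 0 < x)) => // [x y x0 y0|i _]; [rewrite lt_min x0|case: (hr i)].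
exists B, rho; split=> // c v hc hv.
have hi i : tame s 2 (fun t => u i (om (c + t%:C * v)) - u i (om z0)).
  have rr : rho <= r i by exact: bigmin_le_cond.
  by apply: (proj2 (hr i)); [exact: le_trans hc rr|exact: le_trans hv rr].
have h2 : 0 <= 2 :> R by [].
apply: tame_ext (HB _ _ h2 hi) => t _; congr q; apply/rowP => i.
by rewrite !mxE addrC subrK.
Qed.

End tame_lines.

(** * Vanishing to infinite order and propagation of zeros *)

Definition flat {R : realType} (h : 'rV[R]_2 -> R) (x0 : 'rV[R]_2) :=
  forall n, exists M : R, \forall x \near x0, `|h x| <= M * `|x - x0| ^+ n.

Lemma flat_re_im {R : realType} (h : 'rV[R]_2 -> R[i]) x0 :
  vanishes_to_infinite_order h x0 ->
  flat (fun x => complex.Re (h x)) x0 /\ flat (fun x => complex.Im (h x)) x0.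
Proof.
move=> H; split=> n; have [M hM] := H n; exists M; near=> x.
  have : `|h x| <= (M * `|x - x0| ^+ n)%:C by near: x.
  by move=> hx; apply: (@le_trans _ _ (nc (h x))); [exact: nc_Re|rewrite -lecR].
have : `|h x| <= (M * `|x - x0| ^+ n)%:C by near: x.
by move=> hx; apply: (@le_trans _ _ (nc (h x))); [exact: nc_Im|rewrite -lecR].
Unshelve. all: by end_near. Qed.

(** Every point [x] is reached from the flat point [y] by a segment of the chart. The radius [d]
    depends on [x0] alone and not on [y], and this makes the set of zeros closed in
    [flat_connected]. *)
Lemma tame_lines_flat {R : realType} (Z : 'rV[R]_2 -> R[i]) (om : R[i] -> 'rV[R]_2)
    (L : R) (x0 : 'rV[R]_2) (h : 'rV[R]_2 -> R) : 0 <= L ->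
  (forall x, om (Z x) = x) ->
  (forall z z', `|om z' - om z| <= L * nc (z' - z)) ->
  (forall x x', nc (Z x' - Z x) <= L * `|x' - x|) ->
  tame_lines om (Z x0) h ->
  exists2 d : R, 0 < d & forall y, `|y - x0| < d -> flat h y ->
    forall x, `|x - x0| < d -> h x = 0.
Proof.
move=> L0 omZ om_lip Z_lip [B [d [d0 H]]].
have L1 : 0 < 2 * (L + 1) by lra.
(* Two points of the ball are less than [2 * e] apart, so [2 * (L * e) <= d] keeps the direction [v]
   admissible. *)
pose e := d / (2 * (L + 1)); have e0 : 0 < e by rewrite divr_gt0.
have eL : 2 * (L * e) <= d.
  have -> : 2 * (L * e) = (2 * L) / (2 * (L + 1)) * d by rewrite /e; ring.
  by rewrite ler_piMl ?(ltW d0) // ler_pdivrMr //; lra.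
exists e => // y hy fy x hx; pose v := Z x - Z y.
have Lle (p q : 'rV[R]_2) k : `|q - p| <= k -> nc (Z q - Z p) <= L * k.
  by move=> hk; rewrite (le_trans (Z_lip p q)) // ler_wpM2l.
have hc : nc (Z y - Z x0) <= d.
  rewrite (le_trans (Lle x0 y e (ltW hy))) //; have : 0 <= L * e by rewrite mulr_ge0 // ltW.
  lra.
have hv : nc v <= d.
  rewrite (le_trans (Lle y x (2 * e) _)) //; last lra.
  rewrite -(subrK x0 x) -addrA (le_trans (ler_normD _ _)) // (distrC x0 y); lra.
have T := H _ _ hc hv.
pose f t := h (om (Z y + t%:C * v)).
have f1 : h x = f 1 by rewrite /f rmorph1 mul1r addrC subrK omZ.
rewrite f1; apply: (tame_flat (r := 2) (d := 1) (C := B)) => //; last first.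
  by rewrite normr1 ltr01 /=; lra.
move=> n; have [M] := fy n; move=> /nbhs_ballP[rho /= rho0 hrho].
pose D := L * nc v; have D0 : 0 <= D by rewrite mulr_ge0 ?nc_ge0.
pose k := rho / (D + 1); have k0 : 0 < k by rewrite divr_gt0 //; lra.
have dist t : `|om (Z y + t%:C * v) - y| <= D * `|t|.
  rewrite -{2}[y]omZ (le_trans (om_lip _ _)) // addrAC subrr add0r ncM nc_real.
  by rewrite /D -mulrA (mulrC `|t|).
(* The first summand serves [|t| < k], where flatness applies. For [|t| >= k] the bound [B] is at
   most [B * (|t| / k)^n]. Thus all orders share the radius 1. *)
exists (`|M| * D ^+ n + B / k ^+ n) => t /andP[t0 t1].
have B0 : 0 <= B by apply: (tame_ge0 (r := 2)) T.
have s1 : 0 <= `|M| * D ^+ n * `|t| ^+ n by rewrite !mulr_ge0 ?exprn_ge0.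
have s2 : 0 <= B / k ^+ n * `|t| ^+ n.
  by rewrite mulr_ge0 ?exprn_ge0 // divr_ge0 // exprn_ge0 // ltW.
rewrite mulrDl; have [tk|tk] := ltP `|t| k.
  apply: (@le_trans _ _ (`|M| * D ^+ n * `|t| ^+ n)); last lra.
  have hb : ball y rho (om (Z y + t%:C * v)).
    rewrite mx_norm_ball /ball_ /= distrC (le_lt_trans (dist t)) //.
    have h1 : D * `|t| <= (D + 1) * `|t| by rewrite ler_wpM2r //; lra.
    rewrite (le_lt_trans h1) // mulrC -ltr_pdivlMr //; lra.
  rewrite (le_trans (hrho _ hb)) // -mulrA -exprMn.
  rewrite (@le_trans _ _ (`|M| * `|om (Z y + t%:C * v) - y| ^+ n)) //.
    by rewrite ler_wpM2r ?exprn_ge0 // ler_norm.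
  rewrite ler_wpM2l //.
  by rewrite lerXn2r ?nnegrE // mulr_ge0.
apply: (@le_trans _ _ B); first by apply: (tame_bound T); lra.
rewrite (@le_trans _ _ (B / k ^+ n * `|t| ^+ n)) //; last lra.
rewrite mulrAC ler_pdivlMr ?exprn_gt0 // ler_wpM2l //.
by rewrite lerXn2r ?nnegrE // ltW.
Qed.

(** The interior of the zero set is open by definition and consists of flat points. A point of
    [Omega] in its closure has a flat point within the radius given by the local hypothesis, so it
    is interior as well. *)
Lemma flat_connected {R : realType} (Omega : set 'rV[R]_2) (h : 'rV[R]_2 -> R) x1 :
  connected Omega -> Omega x1 -> flat h x1 ->
  (forall x0, Omega x0 -> exists2 d : R, 0 < d & forall y, `|y - x0| < d -> flat h y ->
    forall x, `|x - x0| < d -> h x = 0) ->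
  forall x, Omega x -> h x = 0.
Proof.
move=> conn O1 f1 loc; pose S := interior [set x | h x = 0].
have Sflat y : S y -> flat h y.
  move=> Sy n; exists 0; apply: filterS Sy => x /= ->.
  by rewrite normr0 mul0r.
have inS x0 d y : 0 < d -> `|y - x0| < d -> flat h y ->
    (forall y, `|y - x0| < d -> flat h y -> forall x, `|x - x0| < d -> h x = 0) -> S x0.
  move=> d0 yd fy H; apply/nbhs_ballP; exists d => //= x.
  by rewrite mx_norm_ball /ball_ /= distrC; exact: (H y).
have : Omega `&` S = Omega.
  apply: conn.
  - exists x1; split=> //; have [d d0 H] := loc x1 O1.
    by apply: (inS x1 d x1) => //; rewrite subrr normr0.
  - by exists S => //; exact: open_interior.
  - exists (closure S); first exact: closed_closure.
    apply/seteqP; split=> x [Ox Sx]; split=> //; first exact: subset_closure.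
    have [d d0 H] := loc x Ox.
    have [y [Sy]] := Sx (ball x d) (nbhsx_ballx x d d0).
    rewrite mx_norm_ball /ball_ /= distrC => yd.
    by apply: (inS x d y) => //; exact: Sflat.
move=> E x; rewrite -E => -[_ /interior_subset]; exact.
Qed.

(** * Complex-valued functions and determinants *)

Section complex_tame_lines.
Variables (R : realType) (om : R[i] -> 'rV[R]_2) (z0 : R[i]).

Definition complex_tame_lines (f : 'rV[R]_2 -> R[i]) :=
  tame_lines om z0 (fun x => complex.Re (f x)) /\
  tame_lines om z0 (fun x => complex.Im (f x)).

Lemma complex_tame_lines_cst (a : R[i]) : complex_tame_lines (fun=> a).
Proof. by split; exact: tame_lines_cst. Qed.

Lemma complex_tame_linesD f h : complex_tame_lines f -> complex_tame_lines h ->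
  complex_tame_lines (fun x => f x + h x).
Proof.
move=> [f1 f2] [h1 h2]; split.
  apply: tame_lines_ext (tame_linesD f1 h1) => x.
  by case: (f x) => ? ?; case: (h x).
apply: tame_lines_ext (tame_linesD f2 h2) => x.
by case: (f x) => ? ?; case: (h x).
Qed.

Lemma complex_tame_linesM f h : complex_tame_lines f -> complex_tame_lines h ->
  complex_tame_lines (fun x => f x * h x).
Proof.
move=> [f1 f2] [h1 h2]; split.
  apply: tame_lines_ext (tame_linesB (tame_linesM f1 h1) (tame_linesM f2 h2)) => x.
  by case: (f x) => ? ?; case: (h x).
apply: tame_lines_ext (tame_linesD (tame_linesM f1 h2) (tame_linesM f2 h1)) => x.
by case: (f x) => ? ?; case: (h x).
Qed.

Lemma complex_tame_lines_sum (I : Type) (r : seq I) (f : I -> 'rV[R]_2 -> R[i]) :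
  (forall i, complex_tame_lines (f i)) -> complex_tame_lines (fun x => \sum_(i <- r) f i x).
Proof.
move=> H; elim: r => [|i r ih].
  rewrite (_ : (fun _ => _) = fun=> 0); first exact: complex_tame_lines_cst.
  by apply/funext => x; rewrite big_nil.
rewrite (_ : (fun _ => _) = fun x => f i x + \sum_(i <- r) f i x); first exact: complex_tame_linesD.
by apply/funext => x; rewrite big_cons.
Qed.

Lemma complex_tame_lines_prod (I : Type) (r : seq I) (f : I -> 'rV[R]_2 -> R[i]) :
  (forall i, complex_tame_lines (f i)) -> complex_tame_lines (fun x => \prod_(i <- r) f i x).
Proof.
move=> H; elim: r => [|i r ih].
  rewrite (_ : (fun _ => _) = fun=> 1); first exact: complex_tame_lines_cst.
  by apply/funext => x; rewrite big_nil.
rewrite (_ : (fun _ => _) = fun x => f i x * \prod_(i <- r) f i x); first exact: complex_tame_linesM.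
by apply/funext => x; rewrite big_cons.
Qed.

Lemma complex_tame_lines_det m (F : 'rV[R]_2 -> 'M[R[i]]_m) :
  (forall i j, complex_tame_lines (fun x => F x i j)) ->
  complex_tame_lines (fun x => \det (F x)).
Proof.
move=> H; apply: complex_tame_lines_sum => s.
apply: complex_tame_linesM; first exact: complex_tame_lines_cst.
by apply: complex_tame_lines_prod => i; exact: H.
Qed.

Lemma complex_tame_lines_analytic N (p : 'rV[R[i]]_N -> R[i]) (f : 'I_N -> 'rV[R]_2 -> R[i]) :
  complex_real_analytic p -> (forall i, complex_tame_lines (f i)) ->
  complex_tame_lines (fun x => p (\row_i f i x)).
Proof.
move=> [p1 p2] Hf.
pose u (k : 'I_(N + N)) x := row_mx (\row_i complex.Re (f i x)) (\row_i complex.Im (f i x)) 0 k.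
have Hu k : tame_lines om z0 (u k).
  rewrite /u -[k]splitK; case: (fintype.split k) => i /=.
    by apply: tame_lines_ext (proj1 (Hf i)) => x; rewrite row_mxEl mxE.
  by apply: tame_lines_ext (proj2 (Hf i)) => x; rewrite row_mxEr mxE.
have E x : complexify (\row_k u k x) = \row_i f i x.
  apply/rowP => i; rewrite !mxE /u row_mxEl row_mxEr !mxE.
  by case: (f i x).
split.
  by apply: tame_lines_ext (tame_lines_analytic p1 Hu) => x; rewrite E.
by apply: tame_lines_ext (tame_lines_analytic p2 Hu) => x; rewrite E.
Qed.

End complex_tame_lines.

(** The chart changes from point to point, so [h] is assumed tame in any chart in which all harmonic
    functions are. Both claims of the theorem reduce to closure properties of tame functions. *)
Lemma tame_lines_ucp {R : realType} (Omega : set 'rV[R]_2) (alpha : R)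
    (g : 'rV[R]_2 -> 'M[R]_2) (h : 'rV[R]_2 -> R[i]) x1 :
  open Omega -> connected Omega -> 0 < alpha -> riemannian_metric Omega g ->
  metric_holder_class Omega 1 alpha g ->
  (forall om z0, (forall u, harmonic Omega alpha g u -> tame_lines om z0 u) ->
    complex_tame_lines om z0 h) ->
  Omega x1 -> vanishes_to_infinite_order h x1 -> forall x, Omega x -> h x = 0.
Proof.
move=> oO cO a0 gm gC Hh O1 /flat_re_im[fl1 fl2].
have loc k : (forall om z0, (forall u, harmonic Omega alpha g u -> tame_lines om z0 u) ->
    tame_lines om z0 k) -> flat k x1 -> forall x, Omega x -> k x = 0.
  move=> Hk flk; apply: (flat_connected cO O1 flk) => x0 O0.
  have [Z [om [r [L [r0 L0 [omZ _] [om_lip Z_lip] H]]]]] := local_chart oO a0 gm gC O0.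
  apply: (tame_lines_flat L0 omZ om_lip Z_lip); apply: Hk => u /H[B HB].
  by exists B, r.
have l1 := loc _ (fun om z0 H => proj1 (Hh om z0 H)) fl1.
have l2 := loc _ (fun om z0 H => proj2 (Hh om z0 H)) fl2.
by move=> x Ox; move: (l1 x Ox) (l2 x Ox); case: (h x) => a b /= -> ->.
Qed.

Lemma harmonic_re_im {R : realType} (Omega : set 'rV[R]_2) (alpha : R)
    (g : 'rV[R]_2 -> 'M[R]_2) (f : 'rV[R]_2 -> R[i]) :
  complex_holder_class Omega 2 alpha f ->
  (forall x, Omega x -> complex_laplace_beltrami g f x = 0) ->
  harmonic Omega alpha g (fun x => complex.Re (f x)) /\
  harmonic Omega alpha g (fun x => complex.Im (f x)).
Proof.
move=> [c1 c2] H; split; split=> [//|x Ox].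
  exact: (congr1 (@complex.Re R) (H x Ox)).
exact: (congr1 (@complex.Im R) (H x Ox)).
Qed.

Local Close Scope complex_scope.
Unset Implicit Arguments.

Theorem theorem4p3 (R : realType) (Omega : set 'rV[R]_2) (alpha : R)
    (g : 'rV[R]_2 -> 'M[R]_2)
    (Omega_open : open Omega) (Omega_connected : connected Omega)
    (Omega0 : Omega 0) (alpha_gt0 : 0 < alpha)
    (g_metric : riemannian_metric Omega g)
    (g_C1alpha : metric_holder_class Omega 1 alpha g) :
  (forall (N : nat) (p : 'rV[R[i]]_N -> R[i]) (f : 'I_N -> 'rV[R]_2 -> R[i]),
     complex_real_analytic p ->
     (forall i, complex_holder_class Omega 2 alpha (f i)) ->
     (forall i x, Omega x -> complex_laplace_beltrami g (f i) x = 0) ->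
     vanishes_to_infinite_order (fun x => p (\row_i f i x)) 0 ->
     forall x, Omega x -> p (\row_i f i x) = 0) /\
  (forall (m : nat) (F : 'rV[R]_2 -> 'M[R[i]]_m) (x0 : 'rV[R]_2),
     (forall i j, complex_holder_class Omega 2 alpha (fun x => F x i j)) ->
     (forall i j x, Omega x ->
        complex_laplace_beltrami g (fun y => F y i j) x = 0) ->
     Omega x0 ->
     vanishes_to_infinite_order (fun x => \det (F x)) x0 ->
     forall x, Omega x -> \det (F x) = 0).
Proof.
split=> [N p f p_analytic f_C2 f_harm f_flat|m F x0 F_C2 F_harm Ox0 F_flat].
  apply: (tame_lines_ucp Omega_open Omega_connected alpha_gt0 g_metric g_C1alpha _ Omega0 f_flat).
  move=> om z0 H; apply: complex_tame_lines_analytic => // i.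
  by have [u v] := harmonic_re_im (f_C2 i) (f_harm i); split; exact: H.
apply: (tame_lines_ucp Omega_open Omega_connected alpha_gt0 g_metric g_C1alpha _ Ox0 F_flat).
move=> om z0 H; apply: complex_tame_lines_det => i j.
by have [u v] := harmonic_re_im (F_C2 i j) (F_harm i j); split; exact: H.
Qed.
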